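(* Let $K$ be a mixed-growth kernel on $\mathbb{R}^d$, let $\mathcal{L}=\mathcal{L}_K$, let $P$ be its heat kernel, and let $T\in(0,\infty)$. Let $u$ be a classical solution to $\partial_tu+\mathcal{L}u=0$ in $\mathbb{R}^d\times(0,T)$. If $u\in L^1_{\rm loc}((0,T);L^1_{P_1})$ and the function $$(x,t)\mapsto\int_{\{|y|\le1\}}\Big|u(x,t)-\tfrac12\big(u(x+y,t)+u(x-y,t)\big)\Big|K(y)\,dy$$ belongs to $L^1_{\rm loc}(\mathbb{R}^d\times(0,T))$, then $u$ is a very weak solution to the same equation.
   Context: Mixed-growth kernel: a measurable $K:\mathbb{R}^d\to\mathbb{R}$ such that (a) $K(x)>0$ and $K(x)=K(-x)$ for a.e. $x$, and $\int_{\mathbb{R}^d}\min\{1,|y|^2\}K(y)\,dy<\infty$; and there is a nondecreasing function $\tilde\varphi:(0,\infty)\to(0,\infty)$ (scale function) with (b) $\frac{C^{-1}}{|x|^d\tilde\varphi(|x|)}\le K(x)\le\frac{C}{|x|^d\tilde\varphi(|x|)}$ for all $x\ne0$, for some constant $C>1$; (c) $\lambda_1(R/r)^{\beta_1}\le\tilde\varphi(R)/\tilde\varphi(r)\le\lambda_2(R/r)^{\beta_2}$ for all $0<r\le R<\infty$, for some constants $\lambda_1,\lambda_2>0$ and $\beta_2\ge\beta_1>0$. Operator (acting in the $x$ variable): $\mathcal{L}_Ku(x)=\int_{\mathbb{R}^d}\Big(u(x)-\frac{u(x+y)+u(x-y)}2\Big)K(y)\,dy$. Heat kernel: with $m(\xi)=\int_{\mathbb{R}^d}(1-\cos\langle\xi,y\rangle)K(y)\,dy$,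 $P_t(x)=P(x,t)$ is, for $t>0$, the continuous probability density on $\mathbb{R}^d$ with $\int_{\mathbb{R}^d}e^{i\langle\xi,x\rangle}P_t(x)\,dx=e^{-tm(\xi)}$ (it exists, and it is positive). $L^1_{P_1}=\{v\in L^1_{\rm loc}(\mathbb{R}^d):\int_{\mathbb{R}^d}|v|P_1\,dx<\infty\}$; $u\in L^1_{\rm loc}((0,T);L^1_{P_1})$ means $\int_{\varepsilon}^{T'}\int_{\mathbb{R}^d}|u(x,t)|P_1(x)\,dx\,dt<\infty$ for all $0<\varepsilon<T'<T$. Classical solution: $u\in C(\mathbb{R}^d\times(0,T))$ such that $\partial_tu$ and $\mathcal{L}u$ belong to $C(\mathbb{R}^d\times(0,T))$ and $(\partial_tu+\mathcal{L}u)(x,t)=0$ for all $(x,t)\in\mathbb{R}^d\times(0,T)$. Very weak solution: $u\in L^1_{\rm loc}(\mathbb{R}^d\times(0,T))$ such that, for all $\theta\in C_c^\infty(\mathbb{R}^d\times(0,T))$, $\int_0^T\int_{\mathbb{R}^d}|u||\mathcal{L}\theta|\,dx\,dt<\infty$ and $\int_0^T\int_{\mathbb{R}^d}u(\partial_t\theta-\mathcal{L}\theta)\,dx\,dt=0$. *)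

(* Defs.v *)
From HB Require Import structures.
From mathcomp Require Import all_boot all_order all_algebra.
From mathcomp Require Import all_classical all_reals all_analysis.
From mathcomp Require Import measurable_realfun.

Set Implicit Arguments.
Unset Strict Implicit.
Unset Printing Implicit Defensive.

Import Order.TTheory GRing.Theory Num.Theory.
Import numFieldNormedType.Exports.

Local Open Scope classical_set_scope.
Local Open Scope ring_scope.

(* R^d is 'rV[R]_d with its product topology. The library norm on 'rV[R]_d is
   the sup norm, so the Euclidean norm used by kernels is defined here. *)
Section euclidean.
Context {R : realType} {d : nat}.

Definition dotv (x y : 'rV[R]_d) : R := \sum_(i < d) x 0 i * y 0 i.

Definition enorm (x : 'rV[R]_d) : R := Num.sqrt (dotv x x).

End euclidean.

(* The sigma-algebra generated by the coordinates, i.e. the Borel one. *)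
Section measurable_rV.
Context {R : realType} {n : nat}.

Let coors (i : 'I_n) (x : 'rV[R]_n) : measurableTypeR R := x 0 i.

Let rV_set0 : g_sigma_preimage coors set0.
Proof. exact: sigma_algebra0. Qed.

Let rV_setC A : g_sigma_preimage coors A -> g_sigma_preimage coors (~` A).
Proof. exact: sigma_algebraC. Qed.

Let rV_bigcup (F : (set 'rV[R]_n)^nat) :
  (forall i, g_sigma_preimage coors (F i)) ->
  g_sigma_preimage coors (\bigcup_i (F i)).
Proof. exact: sigma_algebra_bigcup. Qed.

HB.instance Definition _ := @isMeasurable.Build default_measure_display
  'rV[R]_n (g_sigma_preimage coors) rV_set0 rV_setC rV_bigcup.

End measurable_rV.

Section lebesgue_rV.
Context {R : realType}.

Lemma measurable_fun_rVP d (T : measurableType d) n (f : T -> 'rV[R]_n) :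
  (forall i, measurable_fun setT (fun x => f x 0 i : measurableTypeR R)) ->
  measurable_fun setT f.
Proof.
move=> mf _ A mA; rewrite setTI.
suff sub : g_sigma_preimage (fun i x => f x 0 i : measurableTypeR R)
    `<=` (measurable : set (set T)).
  apply: sub; rewrite (g_sigma_preimage_comp
    (fun (i : 'I_n) (x : 'rV[R]_n) => x 0 i : measurableTypeR R) f).
  by exists A => //; rewrite setTI.
apply: smallest_sub; first exact: sigma_algebra_measurable.
case: n => [|n] in f mf A mA *; first by rewrite big_ord0.
rewrite -bigcup_mkord_ord; apply: bigcup_sub => i _ B [C mC <-].
exact: mf.
Qed.

Lemma measurable_coord n (i : 'I_n) :
  measurable_fun setT (fun x : 'rV[R]_n => x 0 i : measurableTypeR R).
Proof.
move=> _ A mA; rewrite setTI; apply: sub_sigma_algebra.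
case: n i => [[]//|n] i; rewrite -bigcup_mkord_ord.
exists i; first exact: ltn_ord.
by exists A => //; rewrite setTI inord_val.
Qed.

Definition rV_cons n (p : 'rV[R]_n * measurableTypeR R) : 'rV[R]_n.+1 :=
  \row_i (if unlift ord0 i is Some j then p.1 0 j else p.2).

Lemma measurable_rV_cons n : measurable_fun setT (@rV_cons n).
Proof.
apply: measurable_fun_rVP => i; rewrite /rV_cons.
under eq_fun do rewrite mxE.
case: unliftP => [j|] _; last exact: measurable_snd.
exact: measurableT_comp (measurable_coord j) measurable_fst.
Qed.

Definition rV_uncons n (x : 'rV[R]_n.+1) : 'rV[R]_n * measurableTypeR R :=
  (\row_j x 0 (lift ord0 j), x 0 ord0).

Lemma rV_consK n : cancel (@rV_cons n) (@rV_uncons n).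
Proof.
case=> v a; congr pair; last by rewrite mxE unlift_none.
by apply/rowP => j; rewrite !mxE liftK.
Qed.

Lemma measurable_rV_uncons n : measurable_fun setT (@rV_uncons n).
Proof.
apply/measurable_fun_pairP; split; last exact: measurable_coord.
apply: measurable_fun_rVP => i /=; under eq_fun do rewrite mxE.
exact: measurable_coord.
Qed.

(* Lebesgue measure on R^n, as the image of an n-fold product of
   lebesgue_measure; see lebesgue_rV_box below. *)
Fixpoint lebesgue_rV {n} : set 'rV[R]_n -> \bar R :=
  match n with
  | 0 => dirac (0 : 'rV[R]_0)
  | n'.+1 => pushforward (lebesgue_rV \x lebesgue_measure)%E (@rV_cons n')
  end.

Section lebesgue_rV_cons.
Variables (n : nat) (m : {sigma_finite_measure set 'rV[R]_n -> \bar R}).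

Let m1 := pushforward (m \x lebesgue_measure)%E (@rV_cons n).

HB.instance Definition _ := Measure.copy m1
  (measure_function_pushforward__canonical__measure_function_Measure
     (m \x lebesgue_measure)%E (@measurable_rV_cons n)).

Let m1_sigma_finite : sigma_finite setT m1.
Proof.
have /sigma_finiteP[F [FT ndF Foo]] := sigma_finiteT m.
have /sigma_finiteP[G [GT ndG Goo]] := sigma_finiteT (@lebesgue_measure R).
exists (fun k => @rV_uncons n @^-1` (F k `*` G k)).
  rewrite -preimage_bigcup (_ : \bigcup_k _ = setT) ?preimage_setT//.
  rewrite -subTset => -[v a] _.
  have [k _ Fkv] : (\bigcup_k F k) v by rewrite -FT.
  have [l _ Gla] : (\bigcup_k G k) a by rewrite -GT.
  exists (maxn k l) => //; split=> /=.
  - by move: v Fkv; exact/subsetPset/ndF/leq_maxl.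
  - by move: a Gla; exact/subsetPset/ndG/leq_maxr.
move=> k; have [mF Fk] := Foo k; have [mG Gk] := Goo k; split.
  rewrite -[X in measurable X]setTI; apply: measurable_rV_uncons => //.
  exact: measurableX.
rewrite /m1 /pushforward -comp_preimage.
rewrite (_ : _ \o _ = id) ?preimage_id; last first.
  by apply/funext => p; exact: rV_consK.
by rewrite product_measure1E// lte_mul_pinfty// ge0_fin_numE.
Qed.

HB.instance Definition _ := Measure_isSigmaFinite.Build _ _ _ m1
  m1_sigma_finite.

Definition lebesgue_rV_cons : {sigma_finite_measure set 'rV[R]_n.+1 -> \bar R}
  := m1.

End lebesgue_rV_cons.

Let lebesgue_rV_ind n :
  exists m : {sigma_finite_measure set 'rV[R]_n -> \bar R},
    m = lebesgue_rV (n := n) :> (set _ -> _).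
Proof.
elim: n => [|n [m mE]] /=; first by exists (dirac (0 : 'rV[R]_0)).
by exists (lebesgue_rV_cons m); rewrite -mE.
Qed.

Let lebesgue_rV0 n : lebesgue_rV (n := n) set0 = 0%E.
Proof. by have [m <-] := lebesgue_rV_ind n; exact: measure0. Qed.

Let lebesgue_rV_ge0 n A : (0 <= lebesgue_rV (n := n) A)%E.
Proof. by have [m <-] := lebesgue_rV_ind n; exact: measure_ge0. Qed.

Let lebesgue_rV_sigma_additive n : semi_sigma_additive (lebesgue_rV (n := n)).
Proof.
by have [m <-] := lebesgue_rV_ind n; exact: measure_semi_sigma_additive.
Qed.

HB.instance Definition _ n := isMeasure.Build _ _ _ (lebesgue_rV (n := n))
  (@lebesgue_rV0 n) (@lebesgue_rV_ge0 n) (@lebesgue_rV_sigma_additive n).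

Let lebesgue_rV_sigma_finite n : sigma_finite setT (lebesgue_rV (n := n)).
Proof. by have [m <-] := lebesgue_rV_ind n; exact: sigma_finiteT. Qed.

HB.instance Definition _ n := Measure_isSigmaFinite.Build _ _ _
  (lebesgue_rV (n := n)) (@lebesgue_rV_sigma_finite n).

End lebesgue_rV.

Lemma lebesgue_rV_box (R : realType) n (I : 'I_n -> interval R) :
  lebesgue_rV [set x : 'rV[R]_n | forall i, x 0 i \in I i] =
  (\prod_(i < n) @lebesgue_measure R [set` I i])%E.
Proof.
elim: n I => [|n IH] I /=; first by rewrite big_ord0 diracE mem_set//; case.
rewrite /pushforward big_ord_recl muleC.
rewrite (_ : _ @^-1` _ = [set x : 'rV[R]_n | forall i, x 0 i \in
    I (lift ord0 i)] `*` [set` I ord0]); last first.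
  apply/seteqP; split => -[v a] /=.
    move=> h; split=> [i|]; last by have := h ord0; rewrite mxE unlift_none.
    by have := h (lift ord0 i); rewrite mxE liftK.
  by case=> h1 h2 i; rewrite mxE; case: unliftP => [j ->|->].
rewrite product_measure1E//; first by congr (_ * _)%E; exact: IH.
rewrite (_ : mkset _ = \bigcap_(i in [set: 'I_n])
    ((fun x : 'rV[R]_n => x 0 i : measurableTypeR R) @^-1`
     [set` I (lift ord0 i)])).
  apply: fin_bigcap_measurable => // i _.
  rewrite -[X in measurable X]setTI; apply: measurable_coord => //.
by apply/seteqP; split => x h i; [move=> _; exact: (h i)|exact: (h i)].
Qed.

(* Measurability and integrability in the sense of the completed measure:
   measurable_fun and integrable require Borel functions, whereas
   kernels are only assumed Lebesgue measurable. The library integral of a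
   function satisfying aemeasurable is that of any of its measurable
   representatives. *)
Section ae_measurability.
Context d (T : measurableType d) (R : realType) (mu : {measure set T -> \bar R}).

Definition aemeasurable d' (U : measurableType d') (D : set T)
    (f : T -> U) : Prop :=
  exists2 g : T -> U, measurable_fun D g & {ae mu, forall x, D x -> f x = g x}.

Definition aeintegrable (D : set T) (f : T -> \bar R) : Prop :=
  aemeasurable D f /\ (\int[mu]_(x in D) `|f x| < +oo)%E.

End ae_measurability.

Section nonlocal_operator.
Context {R : realType} {d : nat}.
Implicit Types (K : 'rV[R]_d -> R) (x xi : 'rV[R]_d) (phi : R -> R).

Local Notation mu := (@lebesgue_rV R d).

Definition scale_function phi : Prop :=
  (forall r, 0 < r -> 0 < phi r) /\
  (forall r s, 0 < r -> r <= s -> phi r <= phi s).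

Definition mixed_growth_kernel K : Prop :=
  [/\ aemeasurable mu setT K,
      {ae mu, forall x, 0 < K x /\ K x = K (- x)},
      (\int[mu]_y (Num.min 1 (enorm y ^+ 2) * K y)%:E < +oo)%E &
      exists2 phi, scale_function phi &
        (exists2 C, 1 < C & forall x, x != 0 ->
           C^-1 / (enorm x ^+ d * phi (enorm x)) <= K x
             <= C / (enorm x ^+ d * phi (enorm x))) /\
        (exists lambda1 lambda2 beta1 beta2 : R,
           [/\ 0 < lambda1, 0 < lambda2, 0 < beta1, beta1 <= beta2 &
             forall r s, 0 < r -> r <= s ->
               lambda1 * (s / r) `^ beta1 <= phi s / phi r
                 <= lambda2 * (s / r) `^ beta2])].

Definition sym_diff (v : 'rV[R]_d -> R) x (y : 'rV[R]_d) : R :=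
  v x - (v (x + y) + v (x - y)) / 2.

Definition nonlocal_op K (v : 'rV[R]_d -> R) x : R :=
  \int[mu]_y (sym_diff v x y * K y).

Definition symbol K xi : R := \int[mu]_y ((1 - cos (dotv xi y)) * K y).

(* The last two clauses are the real and imaginary parts of the identity
   \int e^(i <xi, x>) P_t(x) dx = e^(- t m(xi)). *)
Definition heat_kernel K (P : R -> 'rV[R]_d -> R) : Prop :=
  forall t, 0 < t ->
    [/\ continuous (P t), forall x, 0 <= P t x, (\int[mu]_x (P t x)%:E = 1)%E &
      forall xi,
        \int[mu]_x (cos (dotv xi x) * P t x) = expR (- (t * symbol K xi)) /\
        \int[mu]_x (sin (dotv xi x) * P t x) = 0].

End nonlocal_operator.

(* Space-time functions are functions on 'rV[R]_d * R, of which only the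
   values on the cylinder R^d x (0, T) matter. *)
Section parabolic.
Context {R : realType} {d : nat}.
Implicit Types (K : 'rV[R]_d -> R) (u theta : 'rV[R]_d * R -> R) (T : R).

Local Notation mu := (@lebesgue_rV R d).
Local Notation leb := (@lebesgue_measure R).

Definition cylinder T : set ('rV[R]_d * R) := [set z | 0 < z.2 < T].

Definition dt u (z : 'rV[R]_d * R) : R := derive1 (fun s => u (z.1, s)) z.2.

Definition Lx K u (z : 'rV[R]_d * R) : R :=
  nonlocal_op K (fun x => u (x, z.2)) z.1.

(* Continuity of L u presupposes that the integral defining L u(x, t) exists
   as a finite Lebesgue integral, which is required first: Rintegral takes
   the value 0 on some non-integrable functions. *)
Definition classical_solution K T u : Prop :=
  [/\ {within cylinder T, continuous u},
      (forall z, cylinder T z -> derivable (fun s => u (z.1, s)) z.2 1) /\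
        {within cylinder T, continuous (dt u)},
      (forall z, cylinder T z -> aeintegrable mu setT
         (fun y => (sym_diff (fun x => u (x, z.2)) z.1 y * K y)%:E)) /\
        {within cylinder T, continuous (Lx K u)} &
      forall z, cylinder T z -> dt u z + Lx K u z = 0].

Definition L1loc (D : set ('rV[R]_d * R)) (f : 'rV[R]_d * R -> \bar R) : Prop :=
  forall C, compact C -> C `<=` D -> aeintegrable (mu \x leb)%E C f.

Definition L1loc_time_L1 T (w : 'rV[R]_d -> R) u : Prop :=
  forall e T', 0 < e -> e < T' -> T' < T ->
    (\int[leb]_(t in `[e, T']) \int[mu]_x (`|u (x, t)| * w x)%:E < +oo)%E.

Fixpoint class_C (k : nat) (f : 'rV[R]_d * R -> R) : Prop :=
  match k with
  | 0 => continuous f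
  | k'.+1 => (forall z, differentiable f z) /\
      forall v, class_C k' (fun z => 'd f z v)
  end.

Definition test_function (D : set ('rV[R]_d * R)) theta : Prop :=
  [/\ forall k, class_C k theta,
      compact (closure [set z | theta z != 0]) &
      closure [set z | theta z != 0] `<=` D].

Definition very_weak_solution K T u : Prop :=
  L1loc (cylinder T) (EFin \o u) /\
  forall theta, test_function (cylinder T) theta ->
    (\int[(mu \x leb)%E]_(z in cylinder T) (`|u z| * `|Lx K theta z|)%:E
       < +oo)%E /\
    (\int[(mu \x leb)%E]_(z in cylinder T)
       (u z * (dt theta z - Lx K theta z))%:E = 0)%E.

End parabolic.

(* Main.v *)
From HB Require Import structures.
Require Import Defs.
From mathcomp Require Import all_boot all_order all_algebra.
From mathcomp Require Import all_classical all_reals all_analysis.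
From mathcomp Require Import measurable_realfun.
From mathcomp Require Import ring lra.

(** Let [theta] be a test function. Since [u] solves the equation, the claim amounts
to two integrations by parts over space-time,
[int theta * dt u = - int u * dt theta] and [int theta * L u = int u * L theta]. The
first one ([dt_duality]) is the fundamental theorem of calculus on lines parallel to
the time axis. For the second one ([nonlocal_duality]) fix a jump [y]: by translation
invariance, [theta] times the symmetric difference of [u] and [u] times the symmetric
difference of [theta] have the same integral over space-time. It remains to integrate
over [y] against [K], and Fubini's theorem allows this as soon as both products are
absolutely integrable over space-time and jumps.

For [u] times the difference of [theta], near the support of [theta] the difference is
quadratic in short jumps and bounded for long ones, so that the Levy condition on [K]
suffices. Far from the support, only jumps from [x] into the support matter, and their
density [K (x - w)] is at most a multiple of [P 1 x] ([heat_kernel_dominates]), against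
which [u] is integrable by assumption. For [theta] times the difference of [u], the
jumps of length at most one are covered by the assumed local integrability, and the
longer ones again by [heat_kernel_dominates], because [K] is even.

What is left is the lower bound of [heat_kernel_lower]: far from the origin [P 1] is at
least a multiple of the profile of [K]. Heuristically, the jumps longer than one form a
compound Poisson process independent of the shorter ones, so [P 1 a] is at least a
multiple of the probability density of reaching [a] by one long jump and a displacement
of size at most two made of small jumps. The proof runs on the Fourier side. The kernel of
the small jumps is known only through its transform, so everything is convolved with a
product of Cauchy kernels, whose transform [lapn s] is integrable and makes all inversion
integrals converge ([mult]). Three facts carry it. Exponentials of transforms of
symmetric densities preserve positivity, each term of the exponential series being a
lower bound ([mult_exp_ge]); the small jumps are reached from their truncations by
dominated convergence ([pos_mult_M1]). The mass that the smoothed small-jump kernel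
gives to the ball of radius two is bounded below uniformly in the smoothing scale, by
testing against the squared transform of the unit ball ([mult_square_le],
[mult_square_gt0]). Finally the smoothing is undone by averaging over small balls and
letting its scale tend to zero ([cauchy_average]), after which continuity of [P 1] gives
the pointwise bound. *)

Import Order.TTheory GRing.Theory Num.Theory.
Import numFieldNormedType.Exports.
Local Open Scope classical_set_scope.
Local Open Scope ring_scope.

Set Implicit Arguments.
Unset Strict Implicit.
Unset Printing Implicit Defensive.

(** * Lebesgue measure under reflections and translations *)

Section rV_lebesgue.
Context {R : realType}.
Local Notation leb := (@lebesgue_measure R).

Lemma measurable_reflect n (a : 'rV[R]_n) :
  measurable_fun setT (fun x : 'rV[R]_n => a - x).
Proof.
apply: measurable_fun_rVP => i; under eq_fun do rewrite !mxE.
by apply: measurable_funB => //; exact: measurable_coord.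
Qed.

Lemma measurable_rVD d (T : measurableType d) n (f g : T -> 'rV[R]_n) :
  measurable_fun setT f -> measurable_fun setT g ->
  measurable_fun setT (fun x => f x + g x).
Proof.
move=> mf mg; apply: measurable_fun_rVP => i; under eq_fun do rewrite !mxE.
by apply: measurable_funD; apply: (measurableT_comp (measurable_coord i)).
Qed.

Lemma measurable_rVN d (T : measurableType d) n (f : T -> 'rV[R]_n) :
  measurable_fun setT f -> measurable_fun setT (fun x => - f x).
Proof.
move=> mf; apply: measurable_fun_rVP => i; under eq_fun do rewrite !mxE.
apply: measurableT_comp; first exact: oppr_measurable.
exact: (measurableT_comp (measurable_coord i)).
Qed.

Lemma measurable_rVB d (T : measurableType d) n (f g : T -> 'rV[R]_n) :
  measurable_fun setT f -> measurable_fun setT g ->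
  measurable_fun setT (fun x => f x - g x).
Proof. by move=> mf mg; apply: measurable_rVD => //; exact: measurable_rVN. Qed.

Lemma measurable_dotv d (T : measurableType d) n (f g : T -> 'rV[R]_n) :
  measurable_fun setT f -> measurable_fun setT g ->
  measurable_fun setT (fun x => dotv (f x) (g x)).
Proof.
move=> mf mg; apply: measurable_sum => i.
by apply: measurable_funM; apply: (measurableT_comp (measurable_coord i)).
Qed.

Lemma measurable_enorm d (T : measurableType d) n (f : T -> 'rV[R]_n) :
  measurable_fun setT f -> measurable_fun setT (fun x => enorm (f x)).
Proof.
move=> mf; apply: (measurableT_comp (f := @Num.sqrt R)).
  by apply: continuous_measurable_fun; exact: sqrt_continuous.
exact: measurable_dotv.
Qed.

Lemma ge0_integral_rV_cons n (f : 'rV[R]_n.+1 -> \bar R) :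
  measurable_fun setT f -> (forall x, (0 <= f x)%E) ->
  (\int[lebesgue_rV]_x f x =
   \int[(lebesgue_rV \x leb)%E]_z (f \o @rV_cons R n) z)%E.
Proof.
move=> mf f0; have /= := @ge0_integral_pushforward _ _ _ _ R _ (@measurable_rV_cons R n)
  (lebesgue_rV \x leb)%E setT f measurableT mf.
by rewrite preimage_setT => <- // y _; exact: f0.
Qed.

Lemma ge0_integral_rVS n (f : 'rV[R]_n.+1 -> \bar R) :
  measurable_fun setT f -> (forall x, (0 <= f x)%E) ->
  (\int[lebesgue_rV]_x f x =
   \int[lebesgue_rV]_v \int[leb]_t f (rV_cons (v, t)))%E.
Proof.
move=> mf f0.
rewrite (ge0_integral_rV_cons mf f0).
have mfc : measurable_fun setT (f \o @rV_cons R n).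
  by apply: (measurableT_comp mf); exact: measurable_rV_cons.
exact: (fubini_tonelli1 (m1 := lebesgue_rV) (m2 := leb) _ mfc (fun z => f0 _)).
Qed.

Lemma lebesgue_measure_reflect (a : R) (A : set R) : measurable A ->
  pushforward leb (fun t : measurableTypeR R => a - t : measurableTypeR R) A = leb A.
Proof.
have mr : measurable_fun setT (fun t : measurableTypeR R => a - t : measurableTypeR R).
  by apply: measurable_funB.
move=> mA; apply/esym/(@lebesgue_measure_unique _
  (measure_function_pushforward__canonical__measure_function_Measure leb mr)) => //= _ [[c b]] _ <-.
rewrite /pushforward.
rewrite [X in _ = leb X](_ : _ = `[a - b, a - c[%classic).
  rewrite !lebesgue_measure_itv/= !lte_fin ltrD2l ltrN2 EFinB; case: ifPn => //.
  by rewrite -!EFinB => _; congr EFin; lra.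
apply/seteqP; split => t /=; rewrite !in_itv /=; lra.
Qed.

Lemma ge0_integral_reflect (a : R) (f : R -> \bar R) :
  measurable_fun setT f -> (forall x, (0 <= f x)%E) ->
  (\int[leb]_t f (a - t)%R = \int[leb]_t f t)%E.
Proof.
move=> mf f0.
have mr : measurable_fun setT (fun t : measurableTypeR R => a - t : measurableTypeR R).
  by apply: measurable_funB.
have /= := @ge0_integral_pushforward _ _ _ _ R _ mr leb setT f measurableT mf.
rewrite preimage_setT => <-; last by move=> y _; exact: f0.
apply: (@eq_measure_integral _ _ _ setT leb
  (measure_function_pushforward__canonical__measure_function_Measure leb mr)).
by move=> A mA _; exact: lebesgue_measure_reflect.
Qed.

(** Reflections are preferred to translations as the basic change of variable:
they are what the substitution [y := a - x] of convolutions needs, and a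
translation is a product of two of them. *)
Lemma ge0_integral_rV_reflect n (a : 'rV[R]_n) (f : 'rV[R]_n -> \bar R) :
  measurable_fun setT f -> (forall x, (0 <= f x)%E) ->
  (\int[lebesgue_rV]_x f (a - x)%R = \int[lebesgue_rV]_x f x)%E.
Proof.
elim: n a f => [|n IH] a f mf f0.
  by apply: eq_integral => x _; congr f; apply/rowP; case.
have mfa : measurable_fun setT (fun x : 'rV[R]_n.+1 => f (a - x)).
  exact: (measurableT_comp mf (measurable_reflect a)).
apply: (etrans (ge0_integral_rVS mfa (fun x => f0 _))).
apply: (etrans _ (esym (ge0_integral_rVS mf f0))).
have mfc : measurable_fun setT (f \o @rV_cons R n).
  exact: (measurableT_comp mf (@measurable_rV_cons R n)).
pose b : 'rV[R]_n := \row_j a 0 (lift ord0 j).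
transitivity (\int[lebesgue_rV]_v \int[leb]_t f (rV_cons ((b - v)%R, (a 0 ord0 - t)%R)))%E.
  apply: eq_integral => v _; apply: eq_integral => t _; congr f.
  by apply/rowP => i; rewrite !mxE; case: unliftP => [j ->|->]; rewrite ?mxE.
under eq_integral => v _.
  rewrite (ge0_integral_reflect (a 0 ord0) (f := fun t => f (rV_cons (b - v, t)))).
  over.
- apply: (measurableT_comp mfc); exact: measurable_pair1.
- by [].
rewrite (IH b (fun v => (\int[leb]_t f (rV_cons (v, t))))%E)//.
- exact: (@measurable_fun_fubini_tonelli_F _ _ _ _ R leb (f \o @rV_cons R n) mfc (fun z => f0 _)).
- by move=> v; apply: integral_ge0.
Qed.

Lemma integral_rV_reflect n (a : 'rV[R]_n) (f : 'rV[R]_n -> \bar R) :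
  measurable_fun setT f ->
  (\int[lebesgue_rV]_x f (a - x)%R = \int[lebesgue_rV]_x f x)%E.
Proof.
move=> mf; rewrite integralE [RHS]integralE; congr (_ - _)%E.
- rewrite -[RHS](ge0_integral_rV_reflect a (measurable_funepos mf) (funepos_ge0 f)).
  by apply: eq_integral => x _; rewrite !funeposE.
- rewrite -[RHS](ge0_integral_rV_reflect a (measurable_funeneg mf) (funeneg_ge0 f)).
  by apply: eq_integral => x _; rewrite !funenegE.
Qed.

Lemma integral_rV_translate n (a : 'rV[R]_n) (f : 'rV[R]_n -> \bar R) :
  measurable_fun setT f ->
  (\int[lebesgue_rV]_x f (x + a)%R = \int[lebesgue_rV]_x f x)%E.
Proof.
move=> mf; rewrite -(integral_rV_reflect a mf).
have mfa : measurable_fun setT (fun x : 'rV[R]_n => f (x + a)).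
  by apply: (measurableT_comp mf); exact: measurable_rVD.
rewrite -(integral_rV_reflect 0 mfa).
by apply: eq_integral => x _; rewrite sub0r addrC.
Qed.

(** Open sets are countable unions of balls of radius [1 / (k + 1)] centred at a
countable dense family, hence measurable once balls are. *)
Lemma open_measurable_balls d (T : measurableType d) (U : pseudoMetricType R)
    (f : T -> U) (D : countType) (h : D -> U) :
  (forall x e, 0 < e -> exists q, ball (h q) e x) ->
  (forall x e, 0 < e -> measurable (f @^-1` ball x e)) ->
  forall A, open A -> measurable (f @^-1` A).
Proof.
move=> dense mb A oA.
pose I := [set p : D * nat | ball (h p.1) p.2.+1%:R^-1 `<=` A].
rewrite (_ : A = \bigcup_(p in I) ball (h p.1) p.2.+1%:R^-1).
  rewrite preimage_bigcup bigcup_mkcond.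
  apply: countable_bigcupT_measurable; first exact: countableP.
  by move=> p; case: ifPn => // _; by apply: mb; rewrite invr_gt0.
apply/seteqP; split => [x Ax|x [p] Ip]; last exact: Ip.
have /nbhs_ballP[e /= e0 xeA] : nbhs x A by exact: open_nbhs_nbhs.
have [k ke] : exists k, k.+1%:R^-1 <= e / 2.
  exists (Num.truncn ((e / 2)^-1)).
  rewrite invf_ple ?posrE ?divr_gt0//.
  by apply: ltW; apply: truncnS_gt.
have k0 : 0 < k.+1%:R^-1 :> R by rewrite invr_gt0.
have [q qx] := dense x _ k0.
exists (q, k) => //= y qy; apply: xeA.
apply: (@le_ball _ _ _ (k.+1%:R^-1 + k.+1%:R^-1)).
  by rewrite (le_trans (lerD ke ke))// -splitr.
by apply: ball_triangle qy; exact: ball_sym.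
Qed.

End rV_lebesgue.

(** * Borel measurability of open sets and continuous functions *)

Section borel.
Context {R : realType}.

Lemma open_measurable_rV n (A : set 'rV[R]_n) : open A -> measurable A.
Proof.
move=> oA; rewrite -[A]preimage_id.
apply: (@open_measurable_balls R _ 'rV[R]_n 'rV[R]_n id 'rV[rat]_n
  (map_mx ratr)) oA.
- move=> x e e0.
  have q i : exists r : rat, ball (ratr r : R) e (x 0 i).
    have [r] := @rat_in_itvoo R (x 0 i - e) (x 0 i + e) ltac:(lra).
    rewrite in_itv /= => /andP[r1 r2]; exists r.
    by rewrite /ball /= ltr_norml; lra.
  exists (\row_i sval (cid (q i))); split => // i j; rewrite !mxE (ord1 i).
  by case: cid.
- move=> x e e0; rewrite preimage_id.
  rewrite (_ : ball x e = \bigcap_(i in [set: 'I_n])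
    ((fun y : 'rV[R]_n => y 0 i : measurableTypeR R) @^-1` ball (x 0 i) e)).
    apply: fin_bigcap_measurable => // i _.
    rewrite -[X in measurable X]setTI; apply: measurable_coord => //.
    exact: measurable_ball.
  apply/seteqP; split => [y [_ xy] i _ /=|y xy]; first exact: xy.
  by split => // i j; rewrite (ord1 i); exact: xy.
Qed.

Lemma open_measurable_rVR n (A : set ('rV[R]_n * R)) : open A ->
  measurable (A : set ('rV[R]_n * measurableTypeR R)).
Proof.
move=> oA; rewrite -[A]preimage_id.
apply: (@open_measurable_balls R _ ('rV[R]_n * measurableTypeR R)%type
  ('rV[R]_n * R)%type id ('rV[rat]_n * rat)%type
  (fun q => (map_mx ratr q.1, ratr q.2))) oA.
- move=> [x t] e e0.
  have q (s : R) : exists r : rat, ball (ratr r : R) e s.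
    have [r] := @rat_in_itvoo R (s - e) (s + e) ltac:(lra).
    rewrite in_itv /= => /andP[r1 r2]; exists r.
    by rewrite /ball /= ltr_norml; lra.
  have [r tr] := q t.
  exists (\row_i sval (cid (q (x 0 i))), r); split => //=; split => // i j.
  by rewrite !mxE (ord1 i); case: cid.
- move=> [x t] e e0; rewrite preimage_id.
  rewrite (_ : ball _ _ = ball x e `*` (ball t e : set (measurableTypeR R))).
    apply: measurableX; last exact: measurable_ball.
    apply: open_measurable_rV; exact: ball_open.
  by apply/seteqP; split => -[y s].
Qed.

Lemma open_continuous_measurable d (T : measurableType d) (U : topologicalType)
    (e : T -> U) (D : set U) (g : U -> R) :
  (forall A, open A -> measurable (e @^-1` A)) -> open D ->
  {in D, continuous g} -> measurable_fun (e @^-1` D) (g \o e).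
Proof.
move=> me oD cg mD; apply: (measurability _ (RGenOInfty.measurableE R)) => //.
move=> _ [_ [a ->] <-].
rewrite (_ : _ `&` _ = e @^-1` (D `&` g @^-1` `]a, +oo[)) //.
apply: me; rewrite openE => z [Dz gz].
apply: filterI; first exact: open_nbhs_nbhs.
apply: (cg z); first by rewrite inE.
by apply: open_nbhs_nbhs; split => //; exact: interval_open.
Qed.

Lemma continuous_measurable_rV n (g : 'rV[R]_n -> R) :
  continuous g -> measurable_fun setT g.
Proof.
move=> cg; exact: (@open_continuous_measurable _ 'rV[R]_n 'rV[R]_n id setT g
  (@open_measurable_rV n) openT (fun x _ => cg x)).
Qed.

Lemma continuous_measurable_rVR n (D : set ('rV[R]_n * R)) (g : 'rV[R]_n * R -> R) :
  open D -> {within D, continuous g} ->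
  measurable_fun setT (g \_ D : 'rV[R]_n * measurableTypeR R -> R).
Proof.
move=> oD; rewrite (continuous_open_subspace g oD) => cg.
apply/(measurable_restrictT _ _).1; first exact: open_measurable_rVR.
exact: (@open_continuous_measurable _ ('rV[R]_n * measurableTypeR R)%type
  _ id D g (@open_measurable_rVR n) oD cg).
Qed.

Lemma compact_measurable_rVR n (C : set ('rV[R]_n * R)) : compact C ->
  measurable (C : set ('rV[R]_n * measurableTypeR R)).
Proof.
move=> cC; rewrite -[C]setCK; apply: measurableC; apply: open_measurable_rVR.
by apply: closed_openC; apply: compact_closed => //; exact: norm_hausdorff.
Qed.

End borel.

(** * Real-valued integrable functions *)

Section real_integrals.
Context d (T : measurableType d) (R : realType) (mu : {measure set T -> \bar R}).

Implicit Types f g : T -> R.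

Definition Rintegrable (f : T -> R) := mu.-integrable setT (EFin \o f).

Lemma Rintegrable_meas f : Rintegrable f -> measurable_fun setT f.
Proof. by move=> /measurable_int /measurable_EFinP. Qed.

Lemma Rintegrable_dom f g : measurable_fun setT f -> (forall x, `|f x| <= g x) ->
  Rintegrable g -> Rintegrable f.
Proof.
move=> mf fg; apply: le_integrable => //; first exact/measurable_EFinP.
by move=> x _ /=; rewrite lee_fin (le_trans (fg x))// ler_norm.
Qed.

Lemma ge0_Rintegrable f : measurable_fun setT f -> (forall x, 0 <= f x) ->
  (\int[mu]_x (f x)%:E < +oo)%E -> Rintegrable f.
Proof.
move=> mf f0 oo; apply/integrableP; split; first exact/measurable_EFinP.
by under eq_integral do rewrite gee0_abs ?lee_fin//.
Qed.

Lemma RintegrableZl k f : Rintegrable f -> Rintegrable (fun x => k * f x).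
Proof.
move=> fi; have := integrableZl measurableT k fi.
by apply: eq_integrable => // x _; rewrite /= EFinM.
Qed.

Lemma RintegrableZr k f : Rintegrable f -> Rintegrable (fun x => f x * k).
Proof.
move=> fi; have := RintegrableZl k fi; congr Rintegrable; apply/funext => x.
by rewrite mulrC.
Qed.

Lemma RintegrableD f g : Rintegrable f -> Rintegrable g -> Rintegrable (fun x => f x + g x).
Proof.
move=> fi gi; have := integrableD measurableT fi gi.
by apply: eq_integrable => // x _; rewrite /= EFinD.
Qed.

Lemma RintegrableB f g : Rintegrable f -> Rintegrable g -> Rintegrable (fun x => f x - g x).
Proof.
move=> fi gi; have := integrableB measurableT fi gi.
by apply: eq_integrable => // x _; rewrite /= EFinB.
Qed.

Lemma Rintegrable_Mb B f g : measurable_fun setT g -> (forall x, `|g x| <= B) ->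
  Rintegrable f -> Rintegrable (fun x => f x * g x).
Proof.
move=> mg gB fi.
apply: (@Rintegrable_dom _ (fun x => `|f x| * B)).
- by apply: measurable_funM => //; exact: Rintegrable_meas.
- by move=> x; rewrite normrM ler_wpM2l.
- by apply: RintegrableZr; exact: (integrable_norm fi).
Qed.

Lemma EFin_Rintegral f : Rintegrable f ->
  (\int[mu]_x (f x))%:E = (\int[mu]_x (f x)%:E)%E.
Proof. by move=> fi; rewrite fineK//; exact: integrable_fin_num. Qed.

Lemma dominated_Rintegral (f_ : nat -> T -> R) f g :
  (forall n, measurable_fun setT (f_ n)) ->
  (forall x, f_ ^~ x @ \oo --> f x) -> Rintegrable g ->
  (forall n x, `|f_ n x| <= g x) ->
  Rintegrable f /\ (\int[mu]_x f_ n x) @[n --> \oo] --> (\int[mu]_x f x : R).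
Proof.
move=> mf ff gi fg.
have mf' : measurable_fun setT f by apply: (measurable_fun_cvg mf) => x _; exact: ff.
have [fi _ cv] : [/\ mu.-integrable setT (EFin \o f),
    [sequence \int[mu]_x `|(f_ n x)%:E - (f x)%:E|]_n @ \oo --> 0 &
    [sequence \int[mu]_x (f_ n x)%:E]_n @ \oo --> \int[mu]_x (f x)%:E]%E.
  apply: (@dominated_convergence _ _ _ mu setT measurableT
     (fun n => EFin \o f_ n) (EFin \o f) (EFin \o g)) => //.
  - by move=> n; exact/measurable_EFinP.
  - exact/measurable_EFinP.
  - by apply: aeW => x _; apply: cvg_EFin; [exact: nearW|exact: ff].
  - by apply: aeW => x n _; rewrite /= lee_fin.
split => //; apply: fine_cvg; rewrite fineK//.
exact: integrable_fin_num.
Qed.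

End real_integrals.

Section real_fubini.
Context d1 d2 (T1 : measurableType d1) (T2 : measurableType d2) (R : realType).
Variables (m1 : {sigma_finite_measure set T1 -> \bar R})
  (m2 : {sigma_finite_measure set T2 -> \bar R}).

Lemma measurable_Rintegral2 (f : T1 * T2 -> R) : measurable_fun setT f ->
  measurable_fun setT (fun x => \int[m2]_y f (x, y)).
Proof.
move=> mf; apply: (measurableT_comp (fine_measurable measurableT)).
have mEf : measurable_fun setT (EFin \o f) by exact/measurable_EFinP.
rewrite (_ : (fun x => _) = (fun x => \int[m2]_y ((EFin \o f)^\+)%E (x, y) -
    \int[m2]_y ((EFin \o f)^\-)%E (x, y))%E).
  apply: emeasurable_funB.
  - exact: (measurable_fun_fubini_tonelli_F (m2 := m2) _
      (measurable_funepos mEf) (funepos_ge0 _)).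
  - exact: (measurable_fun_fubini_tonelli_F (m2 := m2) _
      (measurable_funeneg mEf) (funeneg_ge0 _)).
apply/funext => x; rewrite integralE; congr (_ - _)%E.
  by apply: eq_integral => y _; rewrite !funeposE.
by apply: eq_integral => y _; rewrite !funenegE.
Qed.

Lemma fubini_Rintegral (f : T1 * T2 -> R) :
  Rintegrable (m1 \x m2)%E f ->
  (forall x, Rintegrable m2 (fun y => f (x, y))) ->
  (forall y, Rintegrable m1 (fun x => f (x, y))) ->
  \int[m1]_x (\int[m2]_y f (x, y)) = \int[m2]_y (\int[m1]_x f (x, y)).
Proof.
move=> fi f1 f2; rewrite /Rintegral; congr fine.
under eq_integral => x _ do rewrite (EFin_Rintegral (f1 x)).
under [RHS]eq_integral => x _ do rewrite (EFin_Rintegral (f2 x)).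
exact: (Fubini fi).
Qed.

Lemma Rintegrable_prod (f : T1 * T2 -> R) : measurable_fun setT f ->
  (\int[m1]_x \int[m2]_y `|f (x, y)|%:E < +oo)%E -> Rintegrable (m1 \x m2)%E f.
Proof.
move=> mf oo; apply/integrable12ltyP => //; exact/measurable_EFinP.
Qed.

Lemma Rintegrable_Rintegral2 (f : T1 * T2 -> R) :
  Rintegrable (m1 \x m2)%E f -> (forall x, Rintegrable m2 (fun y => f (x, y))) ->
  Rintegrable m1 (fun x => \int[m2]_y f (x, y)).
Proof.
move=> fi f1; have := integrable_fubini_F fi.
apply: eq_integrable => // x _ /=.
exact: esym (EFin_Rintegral (f1 x)).
Qed.

Lemma Rintegrable_tensor (p : T1 -> R) (q : T2 -> R) : Rintegrable m1 p -> Rintegrable m2 q ->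
  Rintegrable (m1 \x m2)%E (fun z => p z.1 * q z.2).
Proof.
move=> ip iq; apply: Rintegrable_prod.
  apply: measurable_funM.
    exact: (measurableT_comp (Rintegrable_meas ip) measurable_fst).
  exact: (measurableT_comp (Rintegrable_meas iq) measurable_snd).
have mq : measurable_fun setT (fun y => `|q y|%:E).
  by apply/measurable_EFinP; apply: measurableT_comp => //; exact: Rintegrable_meas iq.
rewrite (_ : (\int[m1]_x _)%E =
    (\int[m1]_x (`|p x|%:E * \int[m2]_y `|q y|%:E))%E); last first.
  apply: eq_integral => x _; rewrite -ge0_integralZl//=.
  by apply: eq_integral => y _; rewrite normrM.
rewrite ge0_integralZr//; last first.
- by apply: integral_ge0 => y _; rewrite lee_fin.
- apply/measurable_EFinP; apply: measurableT_comp => //; exact: Rintegrable_meas ip.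
have /integrableP[_ Ip] := ip; have /integrableP[_ Iq] := iq.
by apply: lte_mul_pinfty => //; [exact: integral_ge0|
  rewrite ge0_fin_numE//; exact: integral_ge0].
Qed.

End real_fubini.

(** Kernels are given up to null sets, and integrals of functions built from them
have to be compared and replaced although such functions need not be Borel; the
integral of a nonnegative function, being a supremum over simple functions below
it, allows this. *)
Section integral_without_measurability.
Context d (T : measurableType d) (R : realType) (mu : {measure set T -> \bar R}).
Local Open Scope ereal_scope.
Implicit Types f g : T -> \bar R.
Import HBNNSimple.

Lemma ge0_le_integralT f g : (forall x, 0 <= f x) -> (forall x, f x <= g x) ->
  \int[mu]_x f x <= \int[mu]_x g x.
Proof.
move=> f0 fg; rewrite !ge0_integralTE//; last by move=> x; exact: le_trans (fg x).
apply: ge_ereal_sup => _ [h /= hf <-]; apply: ereal_sup_ubound.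
by exists h => // x; exact: le_trans (fg x).
Qed.

(** Lower sums of [f] survive being cut off on a null set, where they no longer
see the difference between [f] and [g]. *)
Lemma ge0_le_integral_ae f g : (forall x, 0 <= f x) -> (forall x, 0 <= g x) ->
  {ae mu, forall x, f x = g x} -> \int[mu]_x f x <= \int[mu]_x g x.
Proof.
move=> f0 g0 [N [mN N0 fgN]]; rewrite !ge0_integralTE//.
apply: ge_ereal_sup => _ [h /= hf <-].
have mC := measurableC mN.
pose h' := proj_nnsfun h mC.
have h'E x : h' x = (h x * \1_(~` N) x)%R by rewrite /h' /= mindicE.
apply: (@le_trans _ _ (sintegral mu h')); last first.
  apply: ereal_sup_ubound; exists h' => // x; rewrite h'E indicE.
  have [xN|xN] := boolP (x \in ~` N); last by rewrite mulr0.
  rewrite mulr1 (_ : g x = f x)//; apply/esym.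
  move: xN; rewrite inE /= => nN; apply: contrapT => fg; exact/nN/fgN.
have hE := integral_nnsfun mu measurableT h.
have h'E2 := integral_nnsfun mu measurableT h'.
rewrite !patch_setT in hE h'E2; rewrite -hE -h'E2 le_eqVlt; apply/orP; left.
apply/eqP; apply: ge0_ae_eq_integral => //.
- exact/measurable_EFinP.
- exact/measurable_EFinP.
- by move=> x _; rewrite lee_fin.
- by move=> x _; rewrite lee_fin.
exists N; split => // x /= hx; apply: contrapT => nN; apply: hx => _.
rewrite -[(h x * mindic R mC x)%R]/(h' x) h'E indicE mem_set// mulr1.
by [].
Qed.

Lemma ge0_integral_ae f g : (forall x, 0 <= f x) -> (forall x, 0 <= g x) ->
  {ae mu, forall x, f x = g x} -> \int[mu]_x f x = \int[mu]_x g x.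
Proof.
move=> f0 g0 fg; apply/eqP; rewrite eq_le !ge0_le_integral_ae//.
by apply: filterS fg => x.
Qed.

Lemma integral_ae f g :
  {ae mu, forall x, f x = g x} -> \int[mu]_x f x = \int[mu]_x g x.
Proof.
move=> fg; rewrite integralE [RHS]integralE; congr (_ - _).
  by apply: ge0_integral_ae => //; apply: filterS fg => x; rewrite !funeposE => ->.
by apply: ge0_integral_ae => //; apply: filterS fg => x; rewrite !funenegE => ->.
Qed.

End integral_without_measurability.

(** * Positive Fourier multipliers *)

Section fourier.
Context {R : realType} {n : nat}.
Local Notation mu := (@lebesgue_rV R n).
Implicit Types (g M p : 'rV[R]_n -> R) (a x xi : 'rV[R]_n).

Lemma dotvBr xi a x : dotv xi (a - x) = dotv xi a - dotv xi x.
Proof.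
by rewrite /dotv -sumrB; apply: eq_bigr => i _; rewrite !mxE mulrBr.
Qed.

Lemma dotv0 xi : dotv xi 0 = 0.
Proof. by rewrite /dotv big1// => i _; rewrite mxE mulr0. Qed.

Definition cosT p xi : R := \int[mu]_x (cos (dotv xi x) * p x).

Definition bounded_measurable M :=
  measurable_fun setT M /\ exists B, forall x, `|M x| <= B.

(** Up to normalization and for even data, the inverse Fourier transform at [a] of
[g * M]. The integrable weight [g] makes every inversion integral converge, so that
a bounded multiplier [M] may be handled as if it were the Fourier transform of a
function, smoothed by the kernel whose transform is [g]. *)
Definition mult g M a : R := \int[mu]_xi (g xi * cos (dotv xi a) * M xi).

(** The vanishing sine transform stands for symmetry. For the heat kernel, symmetry
itself would only follow from injectivity of the Fourier transform. *)
Definition sym_density p := [/\ forall x, 0 <= p x, Rintegrable mu p &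
  forall xi, \int[mu]_x (sin (dotv xi x) * p x) = 0].

Lemma measurable_cos_dotv d (T : measurableType d) (f h : T -> 'rV[R]_n) :
  measurable_fun setT f -> measurable_fun setT h ->
  measurable_fun setT (fun t => cos (dotv (f t) (h t))).
Proof.
move=> mf mh; apply: (measurableT_comp (f := @cos R)).
  by apply: continuous_measurable_fun; exact: continuous_cos.
exact: measurable_dotv.
Qed.

Lemma measurable_sin_dotv d (T : measurableType d) (f h : T -> 'rV[R]_n) :
  measurable_fun setT f -> measurable_fun setT h ->
  measurable_fun setT (fun t => sin (dotv (f t) (h t))).
Proof.
move=> mf mh; apply: (measurableT_comp (f := @sin R)).
  by apply: continuous_measurable_fun; exact: continuous_sin.
exact: measurable_dotv.
Qed.

Lemma bounded_measurableM M N : bounded_measurable M -> bounded_measurable N -> bounded_measurable (fun x => M x * N x).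
Proof.
move=> [mM [B hB]] [mN [C hC]]; split; first exact: measurable_funM.
by exists (B * C) => x; rewrite normrM ler_pM.
Qed.

Lemma bounded_measurableD M N : bounded_measurable M -> bounded_measurable N -> bounded_measurable (fun x => M x + N x).
Proof.
move=> [mM [B hB]] [mN [C hC]]; split; first exact: measurable_funD.
by exists (B + C) => x; rewrite (le_trans (ler_normD _ _))// lerD.
Qed.

Lemma bounded_measurable_cst c : bounded_measurable (fun=> c).
Proof. by split => //; exists `|c|. Qed.

Lemma Rintegrable_cos p xi : Rintegrable mu p -> Rintegrable mu (fun x => cos (dotv xi x) * p x).
Proof.
move=> ip; have := @Rintegrable_Mb _ _ _ mu 1 p (fun x => cos (dotv xi x))
  (measurable_cos_dotv (measurable_cst xi) (@measurable_id _ _ setT))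
  (fun x => cos_max _) ip.
by congr Rintegrable; apply/funext => x; rewrite mulrC.
Qed.

Lemma Rintegrable_sin p xi : Rintegrable mu p -> Rintegrable mu (fun x => sin (dotv xi x) * p x).
Proof.
move=> ip; have := @Rintegrable_Mb _ _ _ mu 1 p (fun x => sin (dotv xi x))
  (measurable_sin_dotv (measurable_cst xi) (@measurable_id _ _ setT))
  (fun x => sin_max _) ip.
by congr Rintegrable; apply/funext => x; rewrite mulrC.
Qed.

Lemma norm_cosT p xi : (forall x, 0 <= p x) -> Rintegrable mu p ->
  `|cosT p xi| <= \int[mu]_x p x.
Proof.
move=> p0 ip; have ic := Rintegrable_cos xi ip.
apply: (le_trans (le_normr_Rintegral measurableT ic)).
apply: le_Rintegral => //; first exact: (integrable_norm ic).
by move=> x _; rewrite normrM (ger0_norm (p0 x)) ler_piMl// cos_max.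
Qed.

Lemma bounded_measurable_cosT p : (forall x, 0 <= p x) -> Rintegrable mu p -> bounded_measurable (cosT p).
Proof.
move=> p0 ip; split; last by exists (\int[mu]_x p x) => xi; exact: norm_cosT.
apply: (@measurable_Rintegral2 _ _ _ _ _ mu
  (fun z : 'rV[R]_n * 'rV[R]_n => cos (dotv z.1 z.2) * p z.2)).
apply: measurable_funM; first exact: measurable_cos_dotv.
exact: (measurableT_comp (Rintegrable_meas ip) measurable_snd).
Qed.

Section multiplier.
Variable g : 'rV[R]_n -> R.
Hypotheses (g0 : forall x, 0 <= g x) (ig : Rintegrable mu g).

Lemma Rintegrable_mult M a : bounded_measurable M ->
  Rintegrable mu (fun xi => g xi * cos (dotv xi a) * M xi).
Proof.
move=> [mM [B hB]]; apply: (Rintegrable_Mb mM hB).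
apply: (@Rintegrable_Mb _ _ _ _ 1) => //; last by move=> x; exact: cos_max.
exact: measurable_cos_dotv.
Qed.

Lemma norm_mult M B a : measurable_fun setT M -> (forall x, `|M x| <= B) ->
  `|mult g M a| <= B * \int[mu]_x g x.
Proof.
move=> mM hB; have iM := @Rintegrable_mult M a (conj mM (ex_intro _ B hB)).
apply: (le_trans (le_normr_Rintegral measurableT iM)).
rewrite -RintegralZl//; apply: le_Rintegral => //.
- exact: (integrable_norm iM).
- exact: RintegrableZl.
move=> x _; rewrite !normrM (ger0_norm (g0 x)) mulrC ler_pM ?mulr_ge0//.
by rewrite ler_piMr// cos_max.
Qed.

(** The convolution theorem: expanding [cos (xi . (a - y))] leaves a sine term,
which the symmetry of [p] removes. *)
Lemma mult_conv M p a : bounded_measurable M -> sym_density p ->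
  mult g (fun xi => M xi * cosT p xi) a = \int[mu]_y (p y * mult g M (a - y)) /\
  Rintegrable mu (fun y => p y * mult g M (a - y)).
Proof.
move=> bM [p0 ip sp]; have [mM [B hB]] := bM.
pose f (z : 'rV[R]_n * 'rV[R]_n) :=
  p z.1 * (g z.2 * cos (dotv z.2 (a - z.1)) * M z.2).
have mp := Rintegrable_meas ip; have mg := Rintegrable_meas ig.
have mf : measurable_fun setT f.
  apply: measurable_funM; first exact: (measurableT_comp mp measurable_fst).
  apply: measurable_funM; last exact: (measurableT_comp mM measurable_snd).
  apply: measurable_funM; first exact: (measurableT_comp mg measurable_snd).
  by apply: measurable_cos_dotv => //; exact: measurable_rVB.
have fi : Rintegrable (mu \x mu)%E f.
  apply: (@Rintegrable_dom _ _ _ _ _ (fun z => p z.1 * (g z.2 * B))) => //.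
    move=> z; rewrite !normrM (ger0_norm (p0 _)) (ger0_norm (g0 _)) ler_wpM2l//.
    rewrite ler_pM//; first exact: mulr_ge0.
    by rewrite ler_piMr// cos_max.
  by apply: (Rintegrable_tensor (q := fun x => g x * B)) => //; exact: RintegrableZr.
have f1 y : Rintegrable mu (fun xi => f (y, xi))
  by have := RintegrableZl (p y) (Rintegrable_mult (a - y) bM).
have fE y xi : f (y, xi) = g xi * M xi * (cos (dotv xi a) * (cos (dotv xi y) * p y) +
    sin (dotv xi a) * (sin (dotv xi y) * p y)).
  by rewrite /f /= dotvBr cosB; ring.
have f2 xi : Rintegrable mu (fun y => f (y, xi)).
  under eq_fun do rewrite fE.
  exact: (RintegrableZl (g xi * M xi) (RintegrableD (RintegrableZl (cos (dotv xi a)) (Rintegrable_cos xi ip))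
    (RintegrableZl (sin (dotv xi a)) (Rintegrable_sin xi ip)))).
have f1E y : \int[mu]_xi f (y, xi) = p y * mult g M (a - y).
  by rewrite /f /= RintegralZl//; exact: Rintegrable_mult.
split; last first.
  have := Rintegrable_Rintegral2 fi f1; congr Rintegrable; apply/funext => y; exact: f1E.
under [RHS]eq_Rintegral do rewrite -f1E.
rewrite (fubini_Rintegral fi f1 f2); apply: eq_Rintegral => xi _.
under [RHS]eq_Rintegral do rewrite fE.
have ic := RintegrableZl (cos (dotv xi a)) (Rintegrable_cos xi ip).
have isn := RintegrableZl (sin (dotv xi a)) (Rintegrable_sin xi ip).
rewrite RintegralZl//; last exact: RintegrableD.
rewrite RintegralD// !RintegralZl//; [|exact: Rintegrable_sin|exact: Rintegrable_cos].
by rewrite sp -/(cosT p xi); ring.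
Qed.

(** Positivity of the smoothed kernel whose Fourier transform is [M]. *)
Definition pos_mult M := forall a, 0 <= mult g M a.

Lemma pos_mult_conv M p : bounded_measurable M -> sym_density p -> pos_mult M ->
  pos_mult (fun xi => M xi * cosT p xi).
Proof.
move=> bM sp pM a; rewrite (mult_conv a bM sp).1.
by apply: Rintegral_ge0 => y _; rewrite mulr_ge0//; case: sp.
Qed.

Lemma mult_cvg (M_ : nat -> 'rV[R]_n -> R) M B a :
  (forall k, measurable_fun setT (M_ k)) -> (forall k x, `|M_ k x| <= B) ->
  (forall x, M_ ^~ x @ \oo --> M x) ->
  mult g (M_ k) a @[k --> \oo] --> mult g M a.
Proof.
move=> mM hB cM.
apply: (@dominated_Rintegral _ _ _ mu
  (fun k xi => g xi * cos (dotv xi a) * M_ k xi) _ (fun x => g x * B) _ _ _ _).2.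
- move=> k; apply: measurable_funM => //; apply: measurable_funM.
    exact: Rintegrable_meas ig.
  exact: measurable_cos_dotv.
- by move=> x; apply: cvgMl_tmp; exact: cM.
- exact: RintegrableZr.
- move=> k x; rewrite !normrM (ger0_norm (g0 x)) ler_pM ?mulr_ge0//.
  by rewrite ler_piMr// cos_max.
Qed.

Lemma pos_mult_cvg (M_ : nat -> 'rV[R]_n -> R) M B :
  (forall k, measurable_fun setT (M_ k)) -> (forall k x, `|M_ k x| <= B) ->
  (forall x, M_ ^~ x @ \oo --> M x) -> (forall k, pos_mult (M_ k)) ->
  pos_mult M.
Proof.
move=> mM hB cM pM a; have cv := mult_cvg (a := a) mM hB cM.
rewrite -(cvg_lim _ cv)//; apply: limr_ge; first by apply/cvg_ex; eexists; exact: cv.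
by apply: nearW => k; exact: pM.
Qed.

Lemma multD M N a : bounded_measurable M -> bounded_measurable N ->
  mult g (fun x => M x + N x) a = mult g M a + mult g N a.
Proof.
move=> bM bN; rewrite -RintegralD//; try exact: Rintegrable_mult.
by apply: eq_Rintegral => x _; rewrite mulrDr.
Qed.

Lemma multZ c M a : bounded_measurable M -> mult g (fun x => c * M x) a = c * mult g M a.
Proof.
move=> bM; rewrite -RintegralZl//; last exact: Rintegrable_mult.
by apply: eq_Rintegral => x _; rewrite mulrCA.
Qed.

(** Exponentiating the transform of a positive density sums all its convolution
powers with positive weights, so it preserves positivity; the term of degree one
already bounds the result from below. *)
Lemma mult_exp_ge M p a : bounded_measurable M -> sym_density p -> pos_mult M ->
  \int[mu]_y (p y * mult g M (a - y)) <=
    mult g (fun xi => M xi * expR (cosT p xi)) a.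
Proof.
move=> bM sp pM; have [p0 ip _] := sp.
have bq := bounded_measurable_cosT p0 ip; set q := cosT p in bq *.
pose S k xi := M xi * series (exp_coeff (q xi)) k.
have pow k : bounded_measurable (fun xi => M xi * q xi ^+ k) /\
    pos_mult (fun xi => M xi * q xi ^+ k).
  elim: k => [|k [bk pk]].
    by under eq_fun do rewrite expr0 mulr1.
  rewrite (_ : (fun xi => _) = (fun xi => M xi * q xi ^+ k * q xi)).
    by split; [exact: bounded_measurableM|exact: pos_mult_conv].
  by apply/funext => xi; rewrite exprSr mulrA.
have SS k xi : S k.+1 xi = S k xi + k`!%:R^-1 * (M xi * q xi ^+ k).
  rewrite /S /series /= big_nat_recr//= mulrDr; congr (_ + _).
  by rewrite /exp_coeff /= mulrA mulrC.
have bS k : bounded_measurable (S k).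
  elim: k => [|k IH].
    rewrite (_ : S 0%N = fun=> 0); first exact: bounded_measurable_cst.
    by apply/funext => x; rewrite /S /series /= big_geq// mulr0.
  rewrite (_ : S _ = fun xi => S k xi + k`!%:R^-1 * (M xi * q xi ^+ k)); last first.
    by apply/funext => xi; rewrite SS.
  by apply: bounded_measurableD => //; apply: bounded_measurableM; [exact: bounded_measurable_cst|exact: (pow k).1].
have multS k : mult g (S k.+1) a =
    mult g (S k) a + k`!%:R^-1 * mult g (fun xi => M xi * q xi ^+ k) a.
  have [bk _] := pow k.
  rewrite -multZ// -multD//; last by apply: bounded_measurableM => //; exact: bounded_measurable_cst.
  by congr (mult g _ a); apply/funext => xi; rewrite SS.
have mono k : mult g (S k) a <= mult g (S k.+1) a.
  by rewrite multS lerDl mulr_ge0 ?invr_ge0//; exact: (pow k).2.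
have S2 k : \int[mu]_y (p y * mult g M (a - y)) <= mult g (S k.+2) a.
  elim: k => [|k IH]; last exact: le_trans IH (mono _).
  rewrite -(mult_conv a bM sp).1 !multS.
  rewrite (_ : mult g (S 0%N) a = 0) ?add0r; last first.
    rewrite /mult (_ : (fun xi => _) = fun=> 0) ?Rintegral_cst ?mul0r//.
    by apply/funext => x; rewrite /S /series /= big_geq// !mulr0.
  rewrite (_ : (fun xi => M xi * q xi ^+ 1) = (fun xi => M xi * q xi)); last first.
    by apply/funext => xi; rewrite expr1.
  by rewrite !fact0 !invr1 !mul1r lerDr; exact: (pow 0%N).2.
have [mM [B hB]] := bM; have [mq [C hC]] := bq.
have B0 : 0 <= B by exact: le_trans (hB 0).
have hSB k xi : `|S k xi| <= B * expR C.
  rewrite /S normrM ler_pM//.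
  apply: (@le_trans _ _ (series (exp_coeff `|q xi|) k)).
    rewrite (le_trans (ler_norm_sum _ _ _))//; apply: ler_sum => i _.
    by rewrite /exp_coeff /= normrM normrX (@ger0_norm _ _^-1) ?invr_ge0.
  apply: (@le_trans _ _ (expR `|q xi|)); last by rewrite ler_expR.
  apply: nondecreasing_cvgn_le; last exact: is_cvg_series_exp_coeff.
  move=> i j ij; rewrite /series /= (@big_cat_nat _ _ _ i 0%N j)//= lerDl.
  by apply: sumr_ge0 => m _; rewrite exp_coeff_ge0.
have cv := @mult_cvg S (fun xi => M xi * expR (q xi)) _ a (fun k => (bS k).1) hSB _.
have {}cv : mult g (S k) a @[k --> \oo] --> mult g (fun xi => M xi * expR (q xi)) a.
  apply: cv => xi; apply: cvgMl_tmp; exact: is_cvg_series_exp_coeff.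
rewrite -(cvg_lim _ cv)//; apply: limr_ge.
  by apply/cvg_ex; eexists; exact: cv.
by exists 2%N => // -[|[|k]]// _; exact: S2.
Qed.

Lemma pos_mult_exp M p : bounded_measurable M -> sym_density p -> pos_mult M ->
  pos_mult (fun xi => M xi * expR (cosT p xi)).
Proof.
move=> bM sp pM a; apply: le_trans (mult_exp_ge a bM sp pM).
by apply: Rintegral_ge0 => y _; rewrite mulr_ge0//; case: sp.
Qed.

End multiplier.
End fourier.

(** * The Laplace and Cauchy densities on the line *)

Section cauchy1.
Context {R : realType}.
Local Notation leb := (@lebesgue_measure R).

Definition lap (s t : R) : R := expR (- (s * `|t|)).

Lemma lap_ge0 s t : 0 <= lap s t. Proof. exact: expR_ge0. Qed.

Lemma continuous_lap s : continuous (lap s).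
Proof.
move=> t; apply: continuous_comp; last exact: continuous_expR.
apply: continuousN; apply: continuousM; first exact: cst_continuous.
exact: norm_continuous.
Qed.

Lemma continuous_cosM (x : R) : continuous (fun t : R => cos (t * x)).
Proof.
move=> t; apply: (@continuous_comp _ _ _ (fun t : R => t * x) (@cos R)); last exact: continuous_cos.
by apply: mulrr_continuous.
Qed.

Lemma continuous_sinM (x : R) : continuous (fun t : R => sin (t * x)).
Proof.
move=> t; apply: (@continuous_comp _ _ _ (fun t : R => t * x) (@sin R)); last exact: continuous_sin.
by apply: mulrr_continuous.
Qed.

(** [1 + cos] in place of [cos] keeps the integrand nonnegative, which yields the
integrability and the value at once. *)
Lemma integral_lap_1cos (s x : R) : 0 < s ->
  (\int[leb]_t (lap s t * (1 + cos (t * x)))%:E =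
   (2 * (s^-1 + s / (s ^+ 2 + x ^+ 2)))%:E)%E.
Proof.
move=> s0; have D0 : 0 < s ^+ 2 + x ^+ 2.
  by rewrite ltr_wpDr ?sqr_ge0// exprn_gt0.
rewrite (@ge0_symfun_integralT _ (fun t => lap s t * (1 + cos (t * x)))); last 3 first.
- move=> t; apply: mulr_ge0; first exact: lap_ge0.
  by have := cos_geN1 (t * x); lra.
- move=> t; apply: continuousM; first exact: continuous_lap.
  by apply: continuousD; [exact: cst_continuous|exact: continuous_cosM].
- by move=> t /=; rewrite /lap normrN mulNr cosN.
rewrite EFinM; congr (_ * _)%E.
rewrite -set_itvcy.
pose f (t : R) : R := expR (- (s * t)) * (1 + cos (t * x)).
(* the primitive of [f] that vanishes at infinity *)
pose F (t : R) : R := expR (- (s * t)) *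
  ((x * sin (t * x) - s * cos (t * x)) / (s ^+ 2 + x ^+ 2) - s^-1).
transitivity (\int[leb]_(t in `[0%R, +oo[) (f t)%:E)%E.
  apply: eq_integral => t; rewrite inE/= in_itv/= andbT => t0.
  by rewrite /f /lap ger0_norm.
have dF (t : R) : is_derive t 1 F (f t).
  rewrite /F /f.
  have d1 : is_derive t 1 (fun t : R => expR (- (s * t))) (expR (- (s * t)) * (- s)).
    apply: (is_derive1_comp (f := expR) (g := fun t : R => - (s * t))).
    apply: is_derive_eq; rewrite /GRing.scale/=; ring.
  have d2 : is_derive t 1 (fun t : R => sin (t * x)) (cos (t * x) * x).
    apply: (is_derive1_comp (f := sin) (g := fun t : R => t * x)).
    apply: is_derive_eq; rewrite /GRing.scale/=; ring.
  have d3 : is_derive t 1 (fun t : R => cos (t * x)) (- sin (t * x) * x).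
    apply: (is_derive1_comp (f := cos) (g := fun t : R => t * x)).
    apply: is_derive_eq; rewrite /GRing.scale/=; ring.
  apply: is_derive_eq; rewrite /GRing.scale/=; field.
  by rewrite !gt_eqF.
have cF : continuous F.
  by move=> t; apply/differentiable_continuous/derivable1_diffP; have [] := dF t.
have cf : continuous f.
  rewrite /f => t; apply: (@continuousM _ _ (fun t => expR (- (s * t))) (fun t => 1 + cos (t * x))).
    apply: (@continuous_comp _ _ _ (fun t : R => - (s * t)) (@expR R)); last exact: continuous_expR.
    by apply: continuousN; exact: mulrl_continuous.
  by apply: continuousD; [exact: cst_continuous|exact: continuous_cosM].
rewrite (@ge0_continuous_FTC2y _ f F 0 0).
- by rewrite /F mul0r sin0 cos0 mulr0 oppr0 expR0 -EFinB; congr EFin; field; rewrite !gt_eqF.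
- move=> t _; apply: mulr_ge0; first exact: expR_ge0.
  by have := cos_geN1 (t * x); lra.
- exact: continuous_subspaceT.
- pose B := (`|x| + s) / (s ^+ 2 + x ^+ 2) + s^-1.
  have e0 : expR (- (s * t)) * B @[t --> +oo] --> 0.
    rewrite -[X in _ --> X](mul0r B); apply: cvgMr_tmp.
    apply: (cvg_comp (fun t => s * t) (fun t => expR (- t))); last exact: cvgr_expR.
    exact: gt0_cvgMry.
  apply: (@squeeze_cvgr _ _ _ _ (fun t => - (expR (- (s * t)) * B)) (fun t => expR (- (s * t)) * B)) => //; last first.
    by rewrite -[X in _ --> X]oppr0; exact: cvgN.
  apply: nearW => t; rewrite -ler_norml /F normrM (ger0_norm (expR_ge0 _)) ler_wpM2l ?expR_ge0//.
  rewrite /B (le_trans (ler_normB _ _))// lerD//; last by rewrite ger0_norm ?invr_ge0// ltW.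
  rewrite normrM (@ger0_norm _ _^-1) ?invr_ge0 ?(ltW D0)// ler_wpM2r ?invr_ge0 ?(ltW D0)//.
  rewrite (le_trans (ler_normB _ _))// lerD//.
    by rewrite normrM ler_piMr// sin_max.
  by rewrite normrM (ger0_norm (ltW s0)) ler_piMr ?(ltW s0)// cos_max.
- by move=> t _; have [] := dF t.
- by apply: cvg_at_right_filter; exact: cF.
- by move=> t _; rewrite derive1E; have [] := dF t.
Qed.

Lemma measurable_lap s : measurable_fun setT (lap s).
Proof. exact: continuous_measurable_fun (continuous_lap (s := s)). Qed.

Lemma Rintegrable_lap_1cos s x : 0 < s -> Rintegrable leb (fun t => lap s t * (1 + cos (t * x))).
Proof.
move=> s0; apply: ge0_Rintegrable.
- apply: measurable_funM; first exact: measurable_lap.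
  apply: measurable_funD => //.
  exact: continuous_measurable_fun (@continuous_cosM x).
- move=> t; apply: mulr_ge0; first exact: lap_ge0.
  by have := cos_geN1 (t * x); lra.
- by rewrite integral_lap_1cos// ltry.
Qed.

Lemma Rintegrable_lap s : 0 < s -> Rintegrable leb (lap s).
Proof.
move=> s0; have := RintegrableZl 2^-1 (Rintegrable_lap_1cos 0 s0); congr Rintegrable.
by apply/funext => t; rewrite mulr0 cos0; field.
Qed.

Lemma Rintegral_lap_cos s x : 0 < s ->
  \int[leb]_t (lap s t * cos (t * x)) = 2 * s / (s ^+ 2 + x ^+ 2).
Proof.
move=> s0; have D0 y : 0 < s ^+ 2 + y ^+ 2.
  by rewrite ltr_wpDr ?sqr_ge0// exprn_gt0.
have E y : \int[leb]_t (lap s t * (1 + cos (t * y))) =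
    2 * (s^-1 + s / (s ^+ 2 + y ^+ 2)).
  by rewrite /Rintegral integral_lap_1cos.
transitivity (\int[leb]_t (lap s t * (1 + cos (t * x)) -
    2^-1 * (lap s t * (1 + cos (t * 0))))).
  by apply: eq_Rintegral => t _; rewrite mulr0 cos0; field.
rewrite RintegralB//; [|exact: Rintegrable_lap_1cos|exact/RintegrableZl/Rintegrable_lap_1cos].
rewrite RintegralZl//; last exact: Rintegrable_lap_1cos.
by rewrite !E; field; rewrite !gt_eqF//; have := D0 0; rewrite expr0n/= addr0.
Qed.

Lemma Rintegrable_lap_cos s x : 0 < s -> Rintegrable leb (fun t => lap s t * cos (t * x)).
Proof.
move=> s0; apply: (@Rintegrable_Mb _ _ _ _ 1); last exact: Rintegrable_lap.
  exact: continuous_measurable_fun (@continuous_cosM x).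
by move=> t; exact: cos_max.
Qed.

Lemma Rintegrable_lap_sin s x : 0 < s -> Rintegrable leb (fun t => lap s t * sin (t * x)).
Proof.
move=> s0; apply: (@Rintegrable_Mb _ _ _ _ 1); last exact: Rintegrable_lap.
  exact: continuous_measurable_fun (@continuous_sinM x).
by move=> t; exact: sin_max.
Qed.

Lemma integral_reflect (a : R) (f : R -> \bar R) : measurable_fun setT f ->
  (\int[leb]_t f (a - t)%R = \int[leb]_t f t)%E.
Proof.
move=> mf; rewrite integralE [RHS]integralE; congr (_ - _)%E.
- rewrite -[RHS](ge0_integral_reflect a (measurable_funepos mf) (funepos_ge0 f)).
  by apply: eq_integral => x _; rewrite !funeposE.
- rewrite -[RHS](ge0_integral_reflect a (measurable_funeneg mf) (funeneg_ge0 f)).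
  by apply: eq_integral => x _; rewrite !funenegE.
Qed.

Lemma Rintegral_lap_sin s x : 0 < s -> \int[leb]_t (lap s t * sin (t * x)) = 0.
Proof.
move=> s0; have ils := Rintegrable_lap_sin x s0.
have mls := Rintegrable_meas ils.
have : \int[leb]_t (lap s t * sin (t * x)) = - \int[leb]_t (lap s t * sin (t * x)).
  rewrite -mulN1r -RintegralZl// /Rintegral; congr fine.
  rewrite -(@integral_reflect 0 (fun t => (lap s t * sin (t * x))%:E)); last first.
    exact/measurable_EFinP.
  by apply: eq_integral => t _; rewrite sub0r /lap normrN mulNr sinN mulrN mulN1r.
by lra.
Qed.

Lemma integral_cauchy (s x p q : R) : 0 < s -> p <= q ->
  (\int[leb]_(t in `[p, q]) (2 * s / (s ^+ 2 + (t - x) ^+ 2))%:E =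
  (2 * (atan ((q - x) / s) - atan ((p - x) / s)))%:E)%E.
Proof.
move=> s0; rewrite le_eqVlt => /predU1P[<-|pq].
  by rewrite set_itv1 integral_set1 subrr mulr0.
have D0 t : 0 < s ^+ 2 + (t - x) ^+ 2.
  by rewrite ltr_wpDr ?sqr_ge0// exprn_gt0.
pose F (t : R) : R := 2 * atan ((t - x) / s).
pose f (t : R) : R := 2 * s / (s ^+ 2 + (t - x) ^+ 2).
have dF (t : R) : is_derive t 1 F (f t).
  have d1 : is_derive t 1 (fun t : R => atan ((t - x) / s)) ((1 + ((t - x) / s) ^+ 2)^-1 * s^-1).
    apply: (is_derive1_comp (f := atan) (g := fun t : R => (t - x) / s)).
    apply: is_derive_eq; rewrite /GRing.scale/=; ring.
  apply: is_derive_eq; rewrite /GRing.scale/= /f; field.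
  rewrite !gt_eqF//=.
have cF : continuous F.
  by move=> t; apply/differentiable_continuous/derivable1_diffP; have [] := dF t.
have cf : continuous f.
  rewrite /f => t.
  apply: (@continuousM _ _ (fun=> 2 * s) (fun t => (s ^+ 2 + (t - x) ^+ 2)^-1)); first exact: cst_continuous.
  apply: (@continuousV _ _ (fun t => s ^+ 2 + (t - x) ^+ 2)); first by rewrite gt_eqF.
  apply: (@continuousD _ _ _ (fun=> s ^+ 2) (fun t => (t - x) ^+ 2)); first exact: cst_continuous.
  apply: (@continuous_comp _ _ _ (fun t : R => t - x) (fun t : R => t ^+ 2)); last exact: exprn_continuous.
  by apply: continuousB; [exact: cvg_id|exact: cst_continuous].
rewrite (@continuous_FTC2 _ f F)//.
- by rewrite /F -EFinB mulrBr.
- exact: continuous_subspaceT.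
- split; [by move=> t _; have [] := dF t|by apply: cvg_at_right_filter; exact: cF|
    by apply: cvg_at_left_filter; exact: cF].
- by move=> t _; rewrite derive1E; have [] := dF t.
Qed.

End cauchy1.

(** * Product densities and their transforms *)

Section products.
Context {R : realType}.
Local Notation leb := (@lebesgue_measure R).

Lemma Rintegral_tensor d1 d2 (T1 : measurableType d1) (T2 : measurableType d2)
    (m1 : {sigma_finite_measure set T1 -> \bar R})
    (m2 : {sigma_finite_measure set T2 -> \bar R}) (p : T1 -> R) (q : T2 -> R) :
  Rintegrable m1 p -> Rintegrable m2 q ->
  \int[(m1 \x m2)%E]_z (p z.1 * q z.2) = \int[m1]_x p x * \int[m2]_y q y.
Proof.
move=> ip iq; rewrite [LHS]/Rintegral.
rewrite -(integral12_prod_meas1 (Rintegrable_tensor ip iq)) /fubini_F /=.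
rewrite -[RHS]/(fine (\int[m1]_x p x * \int[m2]_y q y)%:E); congr fine.
rewrite mulrC -RintegralZl// EFin_Rintegral; last exact: RintegrableZl.
apply: eq_integral => x _; rewrite -EFin_Rintegral; last exact: RintegrableZl.
by rewrite RintegralZl// mulrC.
Qed.

Lemma Rintegrable_rVS n (F : 'rV[R]_n.+1 -> R) : measurable_fun setT F ->
  Rintegrable (lebesgue_rV \x leb)%E (F \o @rV_cons R n) ->
  Rintegrable lebesgue_rV F /\
  \int[lebesgue_rV]_x F x = \int[(lebesgue_rV \x leb)%E]_z F (rV_cons z).
Proof.
move=> mF iF.
have mEF : measurable_fun setT (EFin \o F) by exact/measurable_EFinP.
split.
  apply/integrableP; split => //.
  have /integrableP[_] := iF; rewrite ge0_integral_rV_cons//.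
  exact: measurableT_comp.
rewrite /Rintegral integralE [in RHS]integralE; congr (fine (_ - _)).
  rewrite (ge0_integral_rV_cons (measurable_funepos mEF) (funepos_ge0 _)).
  by apply: eq_integral => z _; rewrite /= !funeposE.
rewrite (ge0_integral_rV_cons (measurable_funeneg mEF) (funeneg_ge0 _)).
by apply: eq_integral => z _; rewrite /= !funenegE.
Qed.

Lemma Rintegrable_rVS_tensor n (F : 'rV[R]_n.+1 -> R) (p : 'rV[R]_n -> R) (q : R -> R) :
  measurable_fun setT F ->
  (forall v t, F (rV_cons (v, t)) = p v * q t) ->
  Rintegrable lebesgue_rV p -> Rintegrable leb q ->
  Rintegrable lebesgue_rV F /\
  \int[lebesgue_rV]_x F x = \int[lebesgue_rV]_v p v * \int[leb]_t q t.
Proof.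
move=> mF FE ip iq.
have E : F \o @rV_cons R n = fun z => p z.1 * q z.2.
  by apply/funext => -[v t]; exact: FE.
have i1 : Rintegrable (lebesgue_rV \x leb)%E (F \o @rV_cons R n).
  by rewrite E; exact: Rintegrable_tensor.
have [-> ->] := Rintegrable_rVS mF i1; split => //.
by rewrite -Rintegral_tensor//; apply: eq_Rintegral => -[v t] _; exact: FE.
Qed.

Lemma rV_cons0 n (v : 'rV[R]_n) (t : R) : rV_cons (v, t) 0 ord0 = t.
Proof. by rewrite mxE unlift_none. Qed.

Lemma rV_consS n (v : 'rV[R]_n) (t : R) j : rV_cons (v, t) 0 (lift ord0 j) = v 0 j.
Proof. by rewrite mxE liftK. Qed.

Lemma measurable_prod_coord n (h : 'I_n -> R -> R) :
  (forall i, measurable_fun setT (h i)) ->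
  measurable_fun setT (fun x : 'rV[R]_n => \prod_(i < n) h i (x 0 i)).
Proof.
move=> mh; apply: measurable_prod => i _.
exact: (measurableT_comp (mh i) (measurable_coord i)).
Qed.

Lemma lebesgue_rV0T : (lebesgue_rV [set: 'rV[R]_0] = 1 :> \bar R)%E.
Proof. exact: diracT. Qed.

Lemma Rintegral_rV_prod n (h : 'I_n -> R -> R) : (forall i, Rintegrable leb (h i)) ->
  Rintegrable lebesgue_rV (fun x : 'rV[R]_n => \prod_(i < n) h i (x 0 i)) /\
  \int[lebesgue_rV]_x (\prod_(i < n) h i (x 0 i)) = \prod_(i < n) \int[leb]_t h i t.
Proof.
elim: n h => [|n IH] h ih.
  have E : (fun x : 'rV[R]_0 => \prod_(i < 0) h i (x 0 i)) = cst 1.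
    by apply/funext => x; rewrite big_ord0.
  rewrite E Rintegral_cst// big_ord0 mul1r [X in fine X]lebesgue_rV0T; split => //.
  apply: ge0_Rintegrable => //; by rewrite (integral_cst lebesgue_rV measurableT 1%E) mul1e
    [X in (X < _)%E]lebesgue_rV0T ltry.
have [i1 e1] := IH (fun i => h (lift ord0 i)) (fun i => ih _).
have [//||i2 e2] := @Rintegrable_rVS_tensor n (fun x => \prod_(i < n.+1) h i (x 0 i)) _ (h ord0) _ _ i1 (ih _).
- by apply: measurable_prod_coord => i; exact: Rintegrable_meas (ih i).
- move=> v t; rewrite big_ord_recl rV_cons0 mulrC; congr (_ * _).
  by apply: eq_bigr => i _; rewrite rV_consS.
by split => //; rewrite e2 e1 big_ord_recl mulrC.
Qed.

Section laplace.
Variables (s : R) (s0 : 0 < s).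

Definition lapn n (xi : 'rV[R]_n) : R := \prod_(i < n) lap s (xi 0 i).

Lemma lapn_ge0 n (xi : 'rV[R]_n) : 0 <= lapn xi.
Proof. by apply: prodr_ge0 => i _; exact: lap_ge0. Qed.

Lemma Rintegrable_lapn n : Rintegrable lebesgue_rV (@lapn n).
Proof. exact: (Rintegral_rV_prod (h := fun=> lap s) (fun=> Rintegrable_lap s0)).1. Qed.

Lemma lapn_cons n v t : @lapn n.+1 (rV_cons (v, t)) = lapn v * lap s t.
Proof.
rewrite /lapn big_ord_recl rV_cons0 mulrC; congr (_ * _).
by apply: eq_bigr => i _; rewrite rV_consS.
Qed.

Lemma dotv_cons n v t (x : 'rV[R]_n.+1) :
  dotv (rV_cons (v, t)) x = dotv v (\row_j x 0 (lift ord0 j)) + t * x 0 ord0.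
Proof.
rewrite /dotv big_ord_recl rV_cons0 addrC; congr (_ + _).
by apply: eq_bigr => i _; rewrite rV_consS mxE.
Qed.

(** Both transforms are computed together because the addition formulas for [cos]
and [sin] mix them when a coordinate is split off. *)
Lemma Rintegral_lapn_cos_sin n (x : 'rV[R]_n) :
  \int[lebesgue_rV]_xi (lapn xi * cos (dotv xi x)) =
    \prod_(i < n) (2 * s / (s ^+ 2 + x 0 i ^+ 2)) /\
  \int[lebesgue_rV]_xi (lapn xi * sin (dotv xi x)) = 0.
Proof.
elim: n x => [|n IH] x.
  have E y : dotv (y : 'rV[R]_0) x = 0 by rewrite /dotv big_ord0.
  split.
    rewrite big_ord0 (_ : (fun xi => _) = cst 1).
      by rewrite Rintegral_cst// [X in fine X]lebesgue_rV0T mul1r.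
    by apply/funext => xi; rewrite E cos0 /lapn big_ord0 mulr1.
  rewrite (_ : (fun xi => _) = cst 0) ?Rintegral_cst ?mul0r//.
  by apply/funext => xi; rewrite E sin0 mulr0.
set x' := \row_j x 0 (lift ord0 j); set x0 := x 0 ord0.
have [IC IS] := IH x'.
have ml m : measurable_fun setT (@lapn m) by exact: Rintegrable_meas (@Rintegrable_lapn m).
have ic : Rintegrable lebesgue_rV (fun xi : 'rV[R]_n => lapn xi * cos (dotv xi x')).
  apply: (@Rintegrable_Mb _ _ _ _ 1); last exact: Rintegrable_lapn.
    by apply: measurable_cos_dotv.
  by move=> ?; exact: cos_max.
have isn : Rintegrable lebesgue_rV (fun xi : 'rV[R]_n => lapn xi * sin (dotv xi x')).
  apply: (@Rintegrable_Mb _ _ _ _ 1); last exact: Rintegrable_lapn.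
    by apply: measurable_sin_dotv.
  by move=> ?; exact: sin_max.
pose cs (a b : R -> R) (xi : 'rV[R]_n.+1) :=
  lapn xi * (a (dotv (rV_uncons xi).1 x') * b ((rV_uncons xi).2 * x0)).
have mu1 : measurable_fun setT (fun xi : 'rV[R]_n.+1 => dotv (rV_uncons xi).1 x').
  apply: measurable_dotv => //.
  exact: (measurableT_comp measurable_fst (@measurable_rV_uncons R n)).
have mu2 : measurable_fun setT (fun xi : 'rV[R]_n.+1 => (rV_uncons xi).2 * x0).
  apply: measurable_funM => //.
  exact: (measurableT_comp measurable_snd (@measurable_rV_uncons R n)).
have mcos : measurable_fun setT (@cos R).
  by apply: continuous_measurable_fun; exact: continuous_cos.
have msin : measurable_fun setT (@sin R).
  by apply: continuous_measurable_fun; exact: continuous_sin.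
have csP (a b : R -> R) : measurable_fun setT a -> measurable_fun setT b ->
    Rintegrable lebesgue_rV (fun xi : 'rV[R]_n => lapn xi * a (dotv xi x')) ->
    Rintegrable leb (fun t => lap s t * b (t * x0)) ->
    Rintegrable lebesgue_rV (cs a b) /\ \int[lebesgue_rV]_xi cs a b xi =
     \int[lebesgue_rV]_xi (lapn xi * a (dotv xi x')) * \int[leb]_t (lap s t * b (t * x0)).
  move=> ma mb ia ib; apply: Rintegrable_rVS_tensor => //.
    apply: measurable_funM; first exact: ml.
    apply: measurable_funM; first exact: (measurableT_comp ma mu1).
    exact: (measurableT_comp mb mu2).
  by move=> v t; rewrite /cs rV_consK /= lapn_cons; ring.
have unc xi : dotv xi x = dotv (rV_uncons xi).1 x' + (rV_uncons xi).2 * x0.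
  rewrite -dotv_cons; congr dotv; apply/rowP => i; rewrite !mxE.
  by case: unliftP => [j ->|->] //=; rewrite mxE.
have [icc ecc] := csP _ _ mcos mcos ic (Rintegrable_lap_cos x0 s0).
have [iss ess] := csP _ _ msin msin isn (Rintegrable_lap_sin x0 s0).
have [isc esc] := csP _ _ msin mcos isn (Rintegrable_lap_cos x0 s0).
have [ics ecs] := csP _ _ mcos msin ic (Rintegrable_lap_sin x0 s0).
split.
  transitivity (\int[lebesgue_rV]_xi (cs cos cos xi - cs sin sin xi)).
    by apply: eq_Rintegral => xi _; rewrite /cs unc cosD mulrBr.
  rewrite RintegralB// ecc ess IS mul0r subr0 IC Rintegral_lap_cos//.
  rewrite big_ord_recl mulrC; congr (_ * _).
  by apply: eq_bigr => i _; rewrite mxE.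
transitivity (\int[lebesgue_rV]_xi (cs sin cos xi + cs cos sin xi)).
  by apply: eq_Rintegral => xi _; rewrite /cs unc sinD mulrDr.
by rewrite RintegralD// esc ecs IS mul0r Rintegral_lap_sin// mulr0 addr0.
Qed.

Lemma mult_lapn1 n (x : 'rV[R]_n) :
  mult (@lapn n) (fun=> 1) x = \prod_(i < n) (2 * s / (s ^+ 2 + x 0 i ^+ 2)).
Proof.
rewrite -(Rintegral_lapn_cos_sin x).1; apply: eq_Rintegral => xi _.
by rewrite mulr1.
Qed.

Lemma pos_mult_lapn1 n : pos_mult (@lapn n) (fun=> 1).
Proof.
move=> x; rewrite mult_lapn1; apply: prodr_ge0 => i _.
by rewrite divr_ge0 ?mulr_ge0 ?(ltW s0)// addr_ge0// sqr_ge0.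
Qed.

End laplace.
End products.

(** * Norms and regular versions of the jump kernel *)

Section norms.
Context {R : realType} {d : nat}.
Implicit Types x y : 'rV[R]_d.

Lemma enorm_ge0 x : 0 <= enorm x. Proof. exact: sqrtr_ge0. Qed.

Lemma enorm0 : enorm (0 : 'rV[R]_d) = 0.
Proof. by rewrite /enorm dotv0 sqrtr0. Qed.

Lemma enormN x : enorm (- x) = enorm x.
Proof.
by rewrite /enorm; congr Num.sqrt; apply: eq_bigr => i _; rewrite !mxE mulrNN.
Qed.

Lemma coord_le_norm x i : `|x 0 i| <= `|x|.
Proof.
rewrite /Num.norm/= mx_normrE.
by rewrite (le_bigmax _ (fun ij : 'I_1 * 'I_d => `|x ij.1 ij.2|) (0, i)).
Qed.

Lemma norm_le_coord x c : 0 <= c -> (forall i, `|x 0 i| <= c) -> `|x| <= c.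
Proof.
move=> c0 xc; rewrite /Num.norm/= mx_normrE.
by apply: bigmax_le => // -[i j] _ /=; rewrite (ord1 i).
Qed.

Lemma norm_le_enorm x : `|x| <= enorm x.
Proof.
apply: norm_le_coord; first exact: enorm_ge0.
move=> i; rewrite -sqrtr_sqr ler_wsqrtr//.
rewrite /dotv (bigD1 i)//= expr2 lerDl.
by apply: sumr_ge0 => j _; rewrite -expr2 sqr_ge0.
Qed.

Lemma enorm_le_norm x : enorm x <= d%:R * `|x|.
Proof.
have c0 : 0 <= d%:R * `|x| by rewrite mulr_ge0.
rewrite -(ger0_norm c0) -sqrtr_sqr ler_wsqrtr//.
apply: (@le_trans _ _ (\sum_(i < d) `|x| ^+ 2)).
  apply: ler_sum => i _; rewrite -expr2 -[leLHS]real_normK ?num_real//.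
  by rewrite ler_sqr ?nnegrE// coord_le_norm.
rewrite sumr_const card_ord exprMn -[leLHS]mulr_natl ler_wpM2r ?sqr_ge0//.
by rewrite -natrX ler_nat -mulnn; case: (d) => // m; exact: leq_pmulr.
Qed.

Lemma enorm_gt0 x : x != 0 -> 0 < enorm x.
Proof. by move=> x0; apply: lt_le_trans (norm_le_enorm x); rewrite normr_gt0. Qed.

End norms.

Section kernel_rep.
Context {R : realType} {d : nat}.
Local Notation mu := (@lebesgue_rV R d).
Implicit Types K : 'rV[R]_d -> R.

(** Translating the kernel and integrating it in several variables require a Borel
function that is even everywhere, whereas [K] has these properties almost everywhere
only. The profile [kap r] stands for [1 / (r ^ d phi r)]; the scaling of [phi] enters
through the monotonicity and the doubling of [kap]. *)
Record kernel_version K (k : 'rV[R]_d -> R) (kap : R -> R) (C : R) : Prop := {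
  kv_meas : measurable_fun setT k ;
  kv_ge0 : forall y, 0 <= k y ;
  kv_even : forall y, k (- y) = k y ;
  kv_ae : {ae mu, forall y, K y = k y} ;
  kv_levy : Rintegrable mu (fun y => Num.min 1 (enorm y ^+ 2) * k y) ;
  kv_C : 0 < C ;
  kv_kap : forall r, 0 < r -> 0 < kap r ;
  kv_decr : forall r s, 0 < r -> r <= s -> kap s <= kap r ;
  kv_doubling : forall A, 1 <= A ->
    exists2 D, 0 < D & forall r, 0 < r -> kap r <= D * kap (A * r) ;
  kv_lower : forall y, y != 0 -> C^-1 * kap (enorm y) <= k y ;
  kv_upper : forall y, y != 0 -> k y <= C * kap (enorm y) }.

Lemma lebesgue_rV_set1 (x : 'rV[R]_d) : (0 < d)%N -> mu [set x] = 0%E.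
Proof.
move=> d0; have := lebesgue_rV_box (fun i : 'I_d => `[x 0 i, x 0 i]).
rewrite (_ : [set y : 'rV[R]_d | _] = [set x]) => [->|].
  by rewrite (bigD1 (Ordinal d0))//= set_itv1 lebesgue_measure_set1 mul0e.
apply/seteqP; split => [y /= xy|y -> i]; last by rewrite in_itv /= lexx.
by apply/rowP => i; have := xy i; rewrite in_itv /= -eq_le => /eqP ->.
Qed.

Lemma ae_reflect (Q : 'rV[R]_d -> Prop) :
  {ae mu, forall y, Q y} -> {ae mu, forall y, Q (- y)}.
Proof.
move=> [N [mN N0 QN]].
have mo : measurable_fun setT (fun y : 'rV[R]_d => - y) by exact: measurable_rVN.
have mNN : measurable ((fun y : 'rV[R]_d => - y) @^-1` N).
  by rewrite -[X in measurable X]setTI; exact: mo.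
exists ((fun y => - y) @^-1` N); split => //.
- have mN1 : measurable_fun setT (fun y : 'rV[R]_d => (\1_N y)%:E : \bar R).
    exact/measurable_EFinP.
  have N01 (y : 'rV[R]_d) : (0 <= (\1_N y)%:E :> \bar R)%E by rewrite lee_fin.
  have := ge0_integral_rV_reflect 0 mN1 N01.
  rewrite [RHS]integral_indic// setIT => E; rewrite -[RHS]N0 -[RHS]E.
  rewrite (_ : (fun x => _) = (fun x => (\1_((fun y : 'rV[R]_d => - y) @^-1` N) x)%:E)).
    by rewrite integral_indic// setIT.
  by apply/funext => y; rewrite sub0r.
- by move=> y /= ny; apply: QN.
Qed.

(** A Borel representative of [K] is made even by averaging with its reflection, and
then clamped between the two bounds; neither operation changes it away from a null
set. *)
Lemma kernel_versionP K : (0 < d)%N -> mixed_growth_kernel K ->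
  exists k kap C, kernel_version K k kap C.
Proof.
move=> d0 [[g mg Kg] Kpos Kint [phi [phi0 phi_nd] [[C C1 KC]
  [l1 [l2 [b1 [b2 [l10 l20 b10 b12 sc]]]]]]]].
have C0 : 0 < C by exact: lt_trans C1.
pose phi' (r : R) := if 0 < r then phi r else 0.
pose kap (r : R) := (r ^+ d * phi' r)^-1.
have mphi : measurable_fun setT phi'.
  apply: nondecreasing_measurable => // r s rs; rewrite /phi'.
  case: ifPn => r0; first by rewrite (lt_le_trans r0 rs) phi_nd.
  by case: ifPn => // s0; exact/ltW/phi0.
have kap_ge0 r : 0 <= r ^+ d * phi' r.
  rewrite /phi'; case: ifPn => r0; last by rewrite mulr0.
  by rewrite mulr_ge0 ?exprn_ge0 ?(ltW r0)// ltW ?phi0.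
have mkap : measurable_fun setT kap.
  rewrite (_ : kap = (fun x => x `^ (-1)) \o (fun r => r ^+ d * phi' r)).
    apply: (measurableT_comp (measurable_powR _)).
    by apply: measurable_funM => //; exact: exprn_measurable.
  by apply/funext => r /=; rewrite powR_inv1.
have kapE r : 0 < r -> kap r = (r ^+ d * phi r)^-1 by rewrite /kap /phi' => ->.
have kap_gt0 r : 0 < r -> 0 < kap r.
  by move=> r0; rewrite kapE// invr_gt0 mulr_gt0 ?exprn_gt0 ?phi0.
have kap_nneg (y : 'rV[R]_d) : 0 <= kap (enorm y).
  by rewrite /kap invr_ge0.
have mke : measurable_fun setT (fun y : 'rV[R]_d => kap (enorm y)).
  exact: (measurableT_comp mkap (measurable_enorm (@measurable_id _ _ setT))).
pose h y := (g y + g (- y)) / 2.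
pose k y := Num.min (Num.max (h y) (C^-1 * kap (enorm y))) (C * kap (enorm y)).
have CC : C^-1 <= C by rewrite (@le_trans _ _ 1)// ?invf_le1// ltW.
have k_lower y : C^-1 * kap (enorm y) <= k y.
  by rewrite /k le_min le_max lexx orbT /= ler_wpM2r.
have k_upper y : k y <= C * kap (enorm y) by rewrite /k ge_min lexx orbT.
have mk : measurable_fun setT k.
  apply: measurable_minr; last exact: measurable_funM.
  apply: measurable_maxr; last exact: measurable_funM.
  apply: measurable_funM => //; apply: measurable_funD => //.
  by apply: (measurableT_comp mg); exact: measurable_rVN.
have k_ge0 y : 0 <= k y.
  by apply: le_trans (k_lower y); rewrite mulr_ge0// invr_ge0 ltW.
have aek : {ae mu, forall y, K y = k y}.
  have n0 : {ae mu, forall y : 'rV[R]_d, y != 0}.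
    exists [set 0]; split; [|exact: lebesgue_rV_set1|].
      rewrite -[X in measurable X]setCK; apply: measurableC.
      apply: open_measurable_rV; apply: closed_openC.
      apply: accessible_closed_set1; apply: hausdorff_accessible.
      exact: norm_hausdorff.
    by move=> y /= /negP; rewrite negbK => /eqP.
  have {}Kg : {ae mu, forall y, K y = g y} by apply: filterS Kg => y; exact.
  have KgN := ae_reflect Kg.
  near=> y.
  have y0 : y != 0 by near: y.
  have Ey : K y = g y by near: y.
  have [_ Ks] : 0 < K y /\ K y = K (- y) by near: y.
  have ENy : K (- y) = g (- y) by near: y.
  have -> : k y = Num.min (Num.max (K y) (C^-1 * kap (enorm y))) (C * kap (enorm y)).
    by rewrite /k /h -Ey -ENy -Ks; congr (Num.min (Num.max _ _) _); field.
  have /andP[] := KC y y0; rewrite -kapE ?enorm_gt0// => K1 K2.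
  by rewrite max_l// min_l.
exists k, kap, C; split => //.
- move=> y; rewrite /k /h enormN opprK; congr (Num.min (Num.max _ _) _).
  by rewrite addrC.
- have m1 : measurable_fun setT (fun y : 'rV[R]_d => Num.min 1 (enorm y ^+ 2)).
    apply: measurable_minr => //.
    by apply: measurable_funX; exact: measurable_enorm.
  have nn y : 0 <= Num.min 1 (enorm (y : 'rV[R]_d) ^+ 2) by rewrite le_min ler01 sqr_ge0.
  apply: ge0_Rintegrable.
  + exact: measurable_funM.
  + by move=> y; rewrite mulr_ge0.
  + rewrite (@integral_ae _ _ _ _ _
      (fun y => (Num.min 1 (enorm y ^+ 2) * K y)%:E))//.
    by apply: filterS aek => y ->.
- move=> r s r0 rs; have s0 := lt_le_trans r0 rs.
  rewrite !kapE// lef_pV2 ?posrE ?mulr_gt0 ?exprn_gt0 ?phi0//.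
  rewrite ler_pM ?exprn_ge0 ?(ltW r0) ?(ltW (phi0 _ _))//; last exact: phi_nd.
  by rewrite lerXn2r ?nnegrE ?(ltW r0) ?(ltW s0).
- move=> A A1; have A0 : 0 < A by exact: lt_le_trans A1.
  exists (A ^+ d * (l2 * A `^ b2)).
    by rewrite mulr_gt0 ?exprn_gt0// mulr_gt0// powR_gt0.
  move=> r r0; have Ar0 : 0 < A * r by exact: mulr_gt0.
  have rA : r <= A * r by rewrite ler_peMl// ltW.
  have /andP[_] := sc r (A * r) r0 rA.
  rewrite mulfK ?gt_eqF// ler_pdivrMr ?phi0// => H.
  have p0 : 0 < phi r by exact: phi0.
  have pA0 : 0 < phi (A * r) by exact: phi0.
  have rd : 0 < r ^+ d by exact: exprn_gt0.
  have Ad : 0 < A ^+ d by exact: exprn_gt0.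
  have La : 0 < l2 * A `^ b2 by rewrite mulr_gt0// powR_gt0.
  rewrite !kapE// exprMn -ler_pdivrMl; last exact: mulr_gt0.
  have X1 : 0 < A ^+ d * (l2 * A `^ b2) * (r ^+ d * phi r).
    by apply: mulr_gt0; exact: mulr_gt0.
  have X2 : 0 < A ^+ d * r ^+ d * phi (A * r).
    by apply: mulr_gt0 => //; exact: mulr_gt0.
  rewrite -invfM lef_pV2 ?posrE//.
  rewrite [leRHS](_ : _ = A ^+ d * r ^+ d * (l2 * A `^ b2 * phi r)); last by ring.
  by rewrite ler_wpM2l ?mulr_ge0 ?(ltW Ad) ?(ltW rd).
Unshelve. all: by end_near. Qed.

End kernel_rep.

(** * The symbol, reflections and balls *)

Section symbol.
Context {R : realType} {d : nat}.
Local Notation mu := (@lebesgue_rV R d).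

Lemma norm_sin_le (t : R) : `|sin t| <= `|t|.
Proof.
wlog t0 : t / 0 <= t.
  move=> H; have [|t0] := leP 0 t; first exact: H.
  by rewrite -normrN -sinN -[leRHS]normrN; apply: H; rewrite oppr_ge0 ltW.
have [c _] := @MVT_segment R sin cos 0 t t0 (fun x _ => is_derive_sin x)
  (continuous_subspaceT (@continuous_sin R)).
by rewrite sin0 !subr0 => ->; rewrite normrM ler_piMl// cos_max.
Qed.

Lemma one_sub_cos_le (t : R) : 1 - cos t <= t ^+ 2 / 2.
Proof.
pose h := t / 2; have -> : t = h + h by rewrite /h; field.
have H : sin h ^+ 2 <= h ^+ 2.
  by rewrite -[leLHS]real_normK ?num_real// -[leRHS]real_normK ?num_real//
    ler_sqr ?nnegrE// norm_sin_le.
have := cos2Dsin2 h; rewrite cosD; lra.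
Qed.

Lemma norm_dotv (x y : 'rV[R]_d) : `|dotv x y| <= d%:R * `|x| * `|y|.
Proof.
apply: (le_trans (ler_norm_sum _ _ _)).
apply: (@le_trans _ _ (\sum_(i < d) `|x| * `|y|)).
  by apply: ler_sum => i _; rewrite normrM ler_pM// coord_le_norm.
by rewrite sumr_const card_ord -[leLHS]mulr_natl mulrA.
Qed.

(** The constant serves both ranges: [1 - cos <= 2] for long [y], and the quadratic
bound on [1 - cos] for short [y]. *)
Lemma one_sub_cos_dotv (xi y : 'rV[R]_d) :
  1 - cos (dotv xi y) <= (2 + (d%:R * `|xi|) ^+ 2) * Num.min 1 (enorm y ^+ 2).
Proof.
have A0 : 0 <= (d%:R * `|xi|) ^+ 2 by exact: sqr_ge0.
have [_|e1] := leP 1 (enorm y ^+ 2).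
  by have := cos_geN1 (dotv xi y); lra.
apply: le_trans (one_sub_cos_le _) _.
have : dotv xi y ^+ 2 <= (d%:R * `|xi|) ^+ 2 * enorm y ^+ 2.
  rewrite -[leLHS]real_normK ?num_real// -exprMn ler_sqr ?nnegrE ?mulr_ge0 ?enorm_ge0//.
  by rewrite (le_trans (norm_dotv _ _))// ler_wpM2l ?mulr_ge0// norm_le_enorm.
have := sqr_ge0 (dotv xi y); have := sqr_ge0 (enorm y).
nra.
Qed.

Lemma sym_density_even (p : 'rV[R]_d -> R) : (forall y, 0 <= p y) -> Rintegrable mu p ->
  (forall y, p (- y) = p y) -> sym_density p.
Proof.
move=> p0 ip ep; split=> // xi.
have isn := Rintegrable_sin xi ip.
have : \int[mu]_x (sin (dotv xi x) * p x) = - \int[mu]_x (sin (dotv xi x) * p x).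
  rewrite -mulN1r -RintegralZl// /Rintegral; congr fine.
  rewrite -(integral_rV_reflect 0 (f := fun x => (sin (dotv xi x) * p x)%:E)); last first.
    by apply/measurable_EFinP; exact: Rintegrable_meas isn.
  by apply: eq_integral => x _; rewrite dotvBr dotv0 !sub0r sinN ep mulNr mulN1r.
by lra.
Qed.

End symbol.

Section reflection.
Context {R : realType} {d : nat}.
Local Notation mu := (@lebesgue_rV R d).

Lemma Rintegrable_reflect (a : 'rV[R]_d) (f : 'rV[R]_d -> R) :
  Rintegrable mu f -> Rintegrable mu (fun z => f (a - z)).
Proof.
move=> /integrableP[mf foo]; apply/integrableP; split.
  exact: (measurableT_comp mf (measurable_reflect a)).
rewrite (ge0_integral_rV_reflect a (f := fun z => `|(f z)%:E|%E))//.
exact: measurableT_comp.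
Qed.

Lemma Rintegral_reflect (a : 'rV[R]_d) (f : 'rV[R]_d -> R) :
  measurable_fun setT f -> \int[mu]_z f (a - z) = \int[mu]_z f z.
Proof.
move=> mf; rewrite /Rintegral; congr fine.
by apply: (integral_rV_reflect a (f := EFin \o f)); exact/measurable_EFinP.
Qed.

Lemma bounded_measurable_expR (M : 'rV[R]_d -> R) : bounded_measurable M -> bounded_measurable (fun x => expR (M x)).
Proof.
move=> [mM [B hB]]; split.
  exact: (measurableT_comp (@measurable_expR R) mM).
exists (expR B) => x; rewrite ger0_norm ?expR_ge0// ler_expR.
exact: le_trans (ler_norm _) (hB x).
Qed.

End reflection.

Section norm_balls.
Context {R : realType} {d : nat}.
Local Notation mu := (@lebesgue_rV R d).

Lemma measurable_norm_ball (a : 'rV[R]_d) r : measurable [set y | `|y - a| <= r].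
Proof.
have mn : measurable_fun setT (fun y : 'rV[R]_d => `|y - a|).
  apply: (measurableT_comp (f := fun y : 'rV[R]_d => `|y|)).
    by apply: continuous_measurable_rV; exact: norm_continuous.
  exact: measurable_rVB.
have := mn measurableT `]-oo, r]%classic (measurable_itv _); rewrite setTI.
by congr measurable; apply/seteqP; split => y /=; rewrite in_itv.
Qed.

Lemma norm_ballE (a : 'rV[R]_d) r : 0 <= r ->
  [set y | `|y - a| <= r] = [set y | forall i, y 0 i \in `[a 0 i - r, a 0 i + r]].
Proof.
move=> r0; apply/seteqP; split => y /=.
  move=> yr i; have := le_trans (coord_le_norm (y - a) i) yr.
  by rewrite !mxE in_itv /= ler_distl.
move=> yr; apply: norm_le_coord => // i.
by have := yr i; rewrite !mxE in_itv /= ler_distl.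
Qed.

Lemma lebesgue_norm_ball (a : 'rV[R]_d) r : 0 <= r ->
  mu [set y | `|y - a| <= r] = ((2 * r) ^+ d)%:E.
Proof.
move=> r0; rewrite norm_ballE//.
apply: (etrans (lebesgue_rV_box (fun i => `[a 0 i - r, a 0 i + r]))).
have I n : iter n (mule (2 * r)%:E) 1%E = ((2 * r) ^+ n)%:E.
  by elim: n => [|n IH] //=; rewrite IH -EFinM exprS.
rewrite (eq_bigr (fun=> (2 * r)%:E)); first by rewrite big_const_ord I.
move=> i _.
rewrite lebesgue_measure_itv /= lte_fin; case: ifPn => [_|].
  by rewrite -EFinB; congr EFin; lra.
by rewrite -leNgt => H; congr EFin; lra.
Qed.

Lemma Rintegrable_norm_ball (a : 'rV[R]_d) r : 0 <= r ->
  Rintegrable mu (\1_[set y | `|y - a| <= r] : 'rV[R]_d -> R) /\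
  \int[mu]_y (\1_[set y | `|y - a| <= r] y : R) = (2 * r) ^+ d.
Proof.
move=> r0; have mb := measurable_norm_ball a r.
have E : (\int[mu]_y (\1_[set y | `|y - a| <= r] y)%:E = ((2 * r) ^+ d)%:E)%E.
  by rewrite integral_indic// setIT; exact: lebesgue_norm_ball.
split; last by rewrite /Rintegral E.
by apply: ge0_Rintegrable => //; rewrite E ltry.
Qed.

End norm_balls.

(** * Removing a Cauchy smoothing *)

Section cauchy_average.
Context {R : realType} {d : nat}.
Local Notation mu := (@lebesgue_rV R d).
Local Notation leb := (@lebesgue_measure R).

Definition cauchy (s : R) (x : 'rV[R]_d) : R :=
  \prod_(i < d) (2 * s / (s ^+ 2 + x 0 i ^+ 2)).

Lemma cauchy1_ge0 (s t : R) : 0 < s -> 0 <= 2 * s / (s ^+ 2 + t ^+ 2).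
Proof. by move=> s0; rewrite divr_ge0 ?mulr_ge0 ?(ltW s0)// addr_ge0// sqr_ge0. Qed.

Lemma cauchy1_le (s t : R) : 0 < s -> 2 * s / (s ^+ 2 + t ^+ 2) <= 2 / s.
Proof.
move=> s0; have D0 : 0 < s ^+ 2 + t ^+ 2.
  by rewrite ltr_wpDr ?sqr_ge0// exprn_gt0.
rewrite ler_pdivrMr// mulrAC ler_pdivlMr// -mulrA -expr2 ler_wpM2l//.
by rewrite lerDl sqr_ge0.
Qed.

Lemma cauchy_ge0 s x : 0 < s -> 0 <= cauchy s x.
Proof. by move=> s0; apply: prodr_ge0 => i _; exact: cauchy1_ge0. Qed.

Lemma cauchy_le s x : 0 < s -> cauchy s x <= (2 / s) ^+ d.
Proof.
move=> s0; rewrite -[X in _ ^+ X]card_ord -prodr_const.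
by apply: ler_prod => i _; rewrite cauchy1_ge0// cauchy1_le.
Qed.

Lemma measurable_cauchy1 (s : R) : 0 < s ->
  measurable_fun setT (fun t : R => 2 * s / (s ^+ 2 + t ^+ 2)).
Proof.
move=> s0; have D0 (t : R) : 0 < s ^+ 2 + t ^+ 2.
  by rewrite ltr_wpDr ?sqr_ge0// exprn_gt0.
pose f (t : R) : R := 2 * s / (s ^+ 2 + t ^+ 2).
have cf : continuous f.
  rewrite /f => t.
  apply: (@continuousM _ _ (fun=> 2 * s) (fun t : R => (s ^+ 2 + t ^+ 2)^-1)).
    exact: cst_continuous.
  apply: (@continuousV _ _ (fun t : R => s ^+ 2 + t ^+ 2)); first by rewrite gt_eqF.
  apply: (@continuousD _ _ _ (fun=> s ^+ 2) (fun t : R => t ^+ 2)).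
    exact: cst_continuous.
  exact: exprn_continuous.
exact: continuous_measurable_fun.
Qed.

Lemma measurable_cauchy s : 0 < s -> measurable_fun setT (cauchy s).
Proof.
move=> s0; apply: (measurable_prod_coord
  (h := fun=> fun t : R => 2 * s / (s ^+ 2 + t ^+ 2))) => i.
exact: measurable_cauchy1.
Qed.

Variables (a : 'rV[R]_d) (e : R).
Hypothesis e0 : 0 < e.
Let J := [set y : 'rV[R]_d | `|y - a| <= e].

Lemma indic_norm_ball y :
  \1_J y = \prod_(i < d) (\1_`[a 0 i - e, a 0 i + e] (y 0 i) : R) :> R.
Proof.
rewrite /J (norm_ballE a (ltW e0)) indicE; have [|] := boolP (_ \in _).
  rewrite inE /= => yJ; rewrite big1// => i _.
  by rewrite indicE mem_set//; exact: yJ.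
rewrite notin_setE /= => /existsNP[i yi]; rewrite (bigD1 i)//=.
by rewrite indicE memNset// mul0r.
Qed.

(** The integral over [[p, q]] of the Cauchy density of scale [s] centred at [x],
of total mass [2 * pi]. *)
Definition atan_gap (s p q x : R) := 2 * (atan ((q - x) / s) - atan ((p - x) / s)).

Lemma integral_cauchy_ball s y : 0 < s ->
  \int[mu]_b (\1_J b * cauchy s (b - y)) =
  \prod_(i < d) atan_gap s (a 0 i - e) (a 0 i + e) (y 0 i).
Proof.
move=> s0.
pose h i (t : R) : R := \1_`[a 0 i - e, a 0 i + e] t *
   (2 * s / (s ^+ 2 + (t - y 0 i) ^+ 2)).
have pq i : a 0 i - e <= a 0 i + e by have := e0; lra.
have hE i : (\int[leb]_t (h i t)%:E)%E =
    (atan_gap s (a 0 i - e) (a 0 i + e) (y 0 i))%:E.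
  rewrite -integral_cauchy// [RHS]integral_mkcond; apply: eq_integral => t _.
  rewrite patchE /h indicE; case: ifPn => _; first by rewrite mul1r.
  by rewrite mul0r.
have mh i : measurable_fun setT (h i).
  apply: measurable_funM; first exact: measurable_indic.
  apply: (measurableT_comp (measurable_cauchy1 s0)).
  by apply: measurable_funB.
have h0 i t : 0 <= h i t by rewrite mulr_ge0// cauchy1_ge0.
have ih i : Rintegrable leb (h i).
  by apply: ge0_Rintegrable; [exact: mh|exact: h0|rewrite hE ltry].
transitivity (\int[mu]_b (\prod_(i < d) h i (b 0 i))).
  apply: eq_Rintegral => b _; rewrite indic_norm_ball /cauchy -big_split /=.
  by apply: eq_bigr => i _; rewrite !mxE.
rewrite (Rintegral_rV_prod ih).2; apply: eq_bigr => i _.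
by rewrite /Rintegral hE.
Qed.

Lemma atan_gap_ge0 s p q x : 0 < s -> p <= q -> 0 <= atan_gap s p q x.
Proof.
move=> s0 pq; rewrite mulr_ge0// subr_ge0 le_atan//.
by rewrite ler_wpM2r ?invr_ge0 ?(ltW s0)// lerD2r.
Qed.

Lemma atan_gap_le s p q x : atan_gap s p q x <= 2 * pi.
Proof.
have := atan_ltpi2 ((q - x) / s); have := atan_gtNpi2 ((p - x) / s).
rewrite /atan_gap; lra.
Qed.

Lemma cvg_atan_gap (p q x : R) : ~~ (p <= x <= q) -> p <= q ->
  atan_gap k.+1%:R^-1 p q x @[k --> \oo] --> (0 : R).
Proof.
have lim (c : R) : 0 < c -> atan (c / k.+1%:R^-1) @[k --> \oo] --> (pi / 2 : R).
  move=> c0; apply: (cvg_comp (fun k : nat => c / k.+1%:R^-1) (@atan R)); last exact: cvgy_atan.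
  under eq_fun do rewrite invrK.
  have H : (k.+1%:R : R) @[k --> \oo] --> +oo.
    by rewrite (cvg_shiftS (fun k => k%:R : R)); exact: cvgr_idn.
  apply: (cvg_comp (fun k : nat => k.+1%:R : R) (fun r : R => c * r)) H _.
  by apply: (gt0_cvgMry c0); exact: cvg_id.
have limN (c : R) : c < 0 -> atan (c / k.+1%:R^-1) @[k --> \oo] --> - (pi / 2 : R).
  move=> c0; have c0' : 0 < - c by rewrite oppr_gt0.
  apply: cvg_trans (cvgN (lim _ c0')); apply: near_eq_cvg; apply: nearW => k.
  by rewrite opprfctE mulNr atanN opprK.
rewrite negb_and -!ltNge => xpq pq; rewrite /atan_gap.
rewrite -(mulr0 2); apply: cvgMl_tmp.
case/orP : xpq => [xp|qx].
  rewrite -(subrr (pi / 2)); apply: cvgB; apply: lim; lra.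
rewrite -(subrr (- (pi / 2))); apply: cvgB; apply: limN; lra.
Qed.

(** As [s -> 0] the averages over [J] of the Cauchy means concentrate on [J];
being products of increments of [atan], they never exceed [(2 * pi) ^+ d]. *)
Lemma cauchy_average (p : 'rV[R]_d -> R) (v : R) :
  (forall y, 0 <= p y) -> Rintegrable mu p ->
  (forall (s : R) b, 0 < s <= 1 -> J b -> v <= \int[mu]_y (p y * cauchy s (b - y))) ->
  v * (2 * e) ^+ d <= (2 * pi) ^+ d * \int[mu]_y (p y * \1_J y).
Proof.
move=> p0 ip vle.
have [iJ eJ] := Rintegrable_norm_ball a (ltW e0); rewrite -/J in iJ eJ.
have pi0 : 0 <= pi :> R by exact: pi_ge0.
pose s (k : nat) : R := k.+1%:R^-1.
have s0 k : 0 < s k by rewrite invr_gt0.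
have s1 k : s k <= 1 by rewrite invf_le1// ler1n.
have mp := Rintegrable_meas ip.
have mJ : measurable_fun setT (\1_J : 'rV[R]_d -> R) by exact: Rintegrable_meas iJ.
have step k : v * (2 * e) ^+ d <=
    \int[mu]_y (p y * \prod_(i < d) atan_gap (s k) (a 0 i - e) (a 0 i + e) (y 0 i)).
  pose f (z : 'rV[R]_d * 'rV[R]_d) := \1_J z.1 * (p z.2 * cauchy (s k) (z.1 - z.2)).
  have mf : measurable_fun setT f.
    apply: measurable_funM; first exact: (measurableT_comp mJ measurable_fst).
    apply: measurable_funM; first exact: (measurableT_comp mp measurable_snd).
    by apply: (measurableT_comp (measurable_cauchy (s0 k))); exact: measurable_rVB.
  have c0 x := cauchy_ge0 x (s0 k).
  have cle x := cauchy_le x (s0 k).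
  have ncle x : `|cauchy (s k) x| <= (2 / s k) ^+ d by rewrite ger0_norm.
  have fi : Rintegrable (mu \x mu)%E f.
    apply: (@Rintegrable_dom _ _ _ _ _ (fun z => \1_J z.1 * (p z.2 * (2 / s k) ^+ d))) => //.
      move=> z; rewrite ger0_norm; first by rewrite ler_wpM2l// ler_wpM2l.
      by rewrite mulr_ge0// mulr_ge0.
    by apply: (Rintegrable_tensor (q := fun y => p y * (2 / s k) ^+ d)) => //; exact: RintegrableZr.
  have ipc b : Rintegrable mu (fun y => p y * cauchy (s k) (b - y)).
    apply: (@Rintegrable_Mb _ _ _ _ ((2 / s k) ^+ d)) => //.
    exact: (measurableT_comp (measurable_cauchy (s0 k)) (measurable_reflect b)).
  have f1 b : Rintegrable mu (fun y => f (b, y)) by have := RintegrableZl (\1_J b) (ipc b).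
  have iJc y : Rintegrable mu (fun b => \1_J b * cauchy (s k) (b - y)).
    apply: (@Rintegrable_Mb _ _ _ _ ((2 / s k) ^+ d)) => //.
    by apply: (measurableT_comp (measurable_cauchy (s0 k))); exact: measurable_rVB.
  have fE b y : f (b, y) = p y * (\1_J b * cauchy (s k) (b - y)).
    by rewrite /f /= mulrCA.
  have f2 y : Rintegrable mu (fun b => f (b, y)).
    by under eq_fun do rewrite fE; exact: RintegrableZl.
  have -> : \int[mu]_y (p y * \prod_(i < d) atan_gap (s k) (a 0 i - e) (a 0 i + e) (y 0 i))
      = \int[mu]_b (\int[mu]_y f (b, y)).
    rewrite (fubini_Rintegral fi f1 f2); apply: eq_Rintegral => y _.
    under [RHS]eq_Rintegral do rewrite fE.
    rewrite RintegralZl//; last exact: iJc.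
    by rewrite -integral_cauchy_ball.
  rewrite -eJ -RintegralZl//; apply: le_Rintegral => //; first exact: RintegrableZl.
    exact: Rintegrable_Rintegral2.
  move=> b _; rewrite /f /= RintegralZl//; last exact: ipc.
  rewrite mulrC indicE.
  have [|_] := boolP (b \in J); last by rewrite !mul0r.
  by rewrite inE => Jb; rewrite !mul1r; apply: vle => //; rewrite s0 s1.
(* a factor of [w k y] is replaced by its bound [2 * pi] when [y 0 i] lies in its
   interval, so that the product converges to [(2 * pi) ^+ d * \1_J y] even for [y] on
   the boundary of [J] *)
pose w k (y : 'rV[R]_d) i : R := 2 * pi * \1_`[a 0 i - e, a 0 i + e] (y 0 i) +
  \1_(~` `[a 0 i - e, a 0 i + e]) (y 0 i) * atan_gap (s k) (a 0 i - e) (a 0 i + e) (y 0 i).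
have pq i : a 0 i - e <= a 0 i + e by have := e0; lra.
have wE k y i : w k y i = if y 0 i \in `[a 0 i - e, a 0 i + e] then 2 * pi
    else atan_gap (s k) (a 0 i - e) (a 0 i + e) (y 0 i).
  rewrite /w !indicE in_setC mem_setE; case: ifPn => _.
    by rewrite mulr1 mul0r addr0.
  by rewrite mulr0 add0r mul1r.
have gap0 k (y : 'rV[R]_d) i : 0 <= atan_gap (s k) (a 0 i - e) (a 0 i + e) (y 0 i).
  exact: atan_gap_ge0.
have gap_w k (y : 'rV[R]_d) i : atan_gap (s k) (a 0 i - e) (a 0 i + e) (y 0 i) <= w k y i <= 2 * pi.
  by rewrite wE; case: ifPn => _; rewrite lexx ?andbT atan_gap_le.
have w0 k (y : 'rV[R]_d) i : 0 <= w k y i by have /andP[+ _] := gap_w k y i; exact: le_trans.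
have matan : measurable_fun setT (@atan R).
  by apply: continuous_measurable_fun; exact: continuous_atan.
have mgap k i : measurable_fun setT (fun t : R => atan_gap (s k) (a 0 i - e) (a 0 i + e) t).
  apply: measurable_funM => //; apply: measurable_funB.
    by apply: (measurableT_comp matan); apply: measurable_funM => //; exact: measurable_funB.
  by apply: (measurableT_comp matan); apply: measurable_funM => //; exact: measurable_funB.
have mw k : measurable_fun setT (fun y : 'rV[R]_d => \prod_(i < d) w k y i).
  apply: (measurable_prod_coord (h := fun i (t : R) =>
    2 * pi * \1_`[a 0 i - e, a 0 i + e] t + \1_(~` `[a 0 i - e, a 0 i + e]) t *
    atan_gap (s k) (a 0 i - e) (a 0 i + e) t)) => i.
  apply: measurable_funD.
    by apply: measurable_funM => //; exact: measurable_indic.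
  by apply: measurable_funM => //; apply: measurable_indic; exact: measurableC.
have mP : measurable_fun setT (fun y : 'rV[R]_d => p y * ((2 * pi) ^+ d * \1_J y)).
  by apply: measurable_funM => //; exact: measurable_funM.
have w_le k (y : 'rV[R]_d) : 0 <= \prod_(i < d) w k y i <= (2 * pi) ^+ d.
  rewrite prodr_ge0//= -[X in _ ^+ X]card_ord -prodr_const.
  by apply: ler_prod => i _; rewrite w0; have /andP[] := gap_w k y i.
have [_ cv] : Rintegrable mu (fun y => p y * ((2 * pi) ^+ d * \1_J y)) /\
    (\int[mu]_y (p y * \prod_(i < d) w k y i)) @[k --> \oo] -->
    (\int[mu]_y (p y * ((2 * pi) ^+ d * \1_J y)) : R).
  apply: (@dominated_Rintegral _ _ _ mu (fun k y => p y * \prod_(i < d) w k y i) _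
    (fun y => p y * (2 * pi) ^+ d)).
  - by move=> k; exact: measurable_funM.
  - move=> y; apply: cvgMl_tmp.
    rewrite indic_norm_ball -[X in _ ^+ X]card_ord -prodr_const -big_split /=.
    apply: cvg_big; first by move=> x; exact: mul_continuous.
    move=> i _ /=; rewrite indicE mem_setE; have [yi|yi] := boolP (y 0 i \in _).
      rewrite mulr1; apply: cvg_near_cst; apply: nearW => k.
      by rewrite wE yi.
    rewrite mulr0; under eq_cvg do rewrite wE (negbTE yi).
    by apply: cvg_atan_gap => //; move: yi; rewrite in_itv.
  - exact: RintegrableZr.
  - move=> k y; have /andP[w1 w2] := w_le k y.
    by rewrite ger0_norm ?mulr_ge0// ler_wpM2l.
have le_w k : v * (2 * e) ^+ d <= \int[mu]_y (p y * \prod_(i < d) w k y i).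
  apply: le_trans (step k) _.
  have bgap (y : 'rV[R]_d) : 0 <= \prod_(i < d) atan_gap (s k) (a 0 i - e) (a 0 i + e) (y 0 i) <=
      \prod_(i < d) w k y i.
    rewrite prodr_ge0//=; apply: ler_prod => i _; rewrite gap0.
    by have /andP[] := gap_w k y i.
  apply: le_Rintegral => //.
  - apply: (@Rintegrable_Mb _ _ _ _ ((2 * pi) ^+ d)) => //.
      exact: (measurable_prod_coord (h := fun i => atan_gap (s k) (a 0 i - e) (a 0 i + e))).
    move=> y; have /andP[b0 bw] := bgap y; have /andP[_ w2] := w_le k y.
    by rewrite ger0_norm// (le_trans bw).
  - apply: (@Rintegrable_Mb _ _ _ _ ((2 * pi) ^+ d)) => // y.
    by have /andP[w1 w2] := w_le k y; rewrite ger0_norm.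
  - by move=> y _; rewrite ler_wpM2l//; have /andP[] := bgap y.
apply: (@le_trans _ _ (\int[mu]_y (p y * ((2 * pi) ^+ d * \1_J y)))).
  rewrite -(cvg_lim _ cv)//; apply: limr_ge.
    by apply/cvg_ex; eexists; exact: cv.
  by apply: nearW => k; exact: le_w.
under eq_Rintegral do rewrite mulrCA.
rewrite RintegralZl//; apply: (@Rintegrable_Mb _ _ _ _ 1) => // y.
by rewrite indicE; case: (_ \in _); rewrite ?normr1 ?normr0.
Qed.

End cauchy_average.

(** * Lower bound for the heat kernel *)

Section heat_kernel_lower_bound.
Context {R : realType} {d : nat}.
Local Notation mu := (@lebesgue_rV R d).
Implicit Types f : 'rV[R]_d -> R.
Variables (K k : 'rV[R]_d -> R) (kap : R -> R) (C : R).
Hypothesis kv : kernel_version K k kap C.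

Let k_small (c : R) (y : 'rV[R]_d) := k y * (\1_[set z | c < enorm z <= 1] y).
Let k_large y := k y * (\1_[set z | 1 < enorm z] y).
Let k_near y := k y * (\1_[set z | enorm z <= 1] y).

Let mk : measurable_fun setT k := kv_meas kv.
Let k0 : forall y, 0 <= k y := kv_ge0 kv.

Let m_enorm : measurable_fun setT (@enorm R d).
Proof. exact: measurable_enorm. Qed.

Lemma measurable_enorm_preimage (A : set R) : measurable A ->
  measurable [set y : 'rV[R]_d | A (enorm y)].
Proof. by move=> mA; rewrite -[X in measurable X]setTI; exact: m_enorm. Qed.

Let indic01 (A : set 'rV[R]_d) y : 0 <= (\1_A y : R) <= 1.
Proof. by rewrite indicE; case: (y \in A); rewrite ?lexx ?ler01. Qed.

Lemma Rintegrable_levy_dom (f : 'rV[R]_d -> R) A : measurable_fun setT f ->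
  (forall y, `|f y| <= A * (Num.min 1 (enorm y ^+ 2) * k y)) -> Rintegrable mu f.
Proof.
move=> mf fA; apply: (Rintegrable_dom mf fA); apply: RintegrableZl; exact: (kv_levy kv).
Qed.

Let m_small c : measurable_fun setT (k_small c).
Proof.
apply: measurable_funM => //; apply: measurable_indic.
by have := @measurable_enorm_preimage `]c, 1] (measurable_itv _); congr measurable;
  apply/seteqP; split => y /=; rewrite in_itv.
Qed.

Let m_near : measurable_fun setT k_near.
Proof.
apply: measurable_funM => //; apply: measurable_indic.
by have := @measurable_enorm_preimage `]-oo, 1] (measurable_itv _); congr measurable;
  apply/seteqP; split => y /=; rewrite in_itv.
Qed.

Let m_large : measurable_fun setT k_large.
Proof.
apply: measurable_funM => //; apply: measurable_indic.
by have := @measurable_enorm_preimage `]1, +oo[ (measurable_itv _); congr measurable;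
  apply/seteqP; split => y /=; rewrite in_itv /= andbT.
Qed.

Let small_ge0 c y : 0 <= k_small c y.
Proof. by rewrite mulr_ge0//; have /andP[] := indic01 [set z | c < enorm z <= 1] y. Qed.
Let near_ge0 y : 0 <= k_near y.
Proof. by rewrite mulr_ge0//; have /andP[] := indic01 [set z | enorm z <= 1] y. Qed.
Let large_ge0 y : 0 <= k_large y.
Proof. by rewrite mulr_ge0//; have /andP[] := indic01 [set z | 1 < enorm z] y. Qed.

Let small_le_near c y : k_small c y <= k_near y.
Proof.
rewrite ler_wpM2l// !indicE; case: (boolP (_ \in _)) => //; rewrite inE /= => /andP[_ y1].
by rewrite mem_set.
Qed.

Let levy_ge0 y : 0 <= Num.min 1 (enorm y ^+ 2) * k y.
Proof. by rewrite mulr_ge0// le_min ler01 sqr_ge0. Qed.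

Lemma Rintegrable_small c : 0 < c -> Rintegrable mu (k_small c).
Proof.
move=> c0; apply: (@Rintegrable_levy_dom _ (1 + c^-1 ^+ 2)) => // y.
rewrite (ger0_norm (small_ge0 _ _)) /k_small indicE; have [|_] := boolP (_ \in _); last first.
  by rewrite mulr0 mulr_ge0// addr_ge0// sqr_ge0.
rewrite inE /= => /andP[cy y1].
rewrite mulr1 mulrA ler_peMl//.
have e0 := enorm_ge0 y.
rewrite min_r; last by rewrite expr_le1.
have H : 1 <= c^-1 * enorm y.
  by rewrite -ler_pdivrMl ?invr_gt0// invrK mulr1 ltW.
by rewrite mulrDl mul1r -exprMn -[leLHS]add0r lerD ?sqr_ge0 ?exprn_ege1.
Qed.

Lemma Rintegrable_large : Rintegrable mu k_large.
Proof.
apply: (@Rintegrable_levy_dom _ 1) => // y.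
rewrite (ger0_norm (large_ge0 _)) /k_large indicE mul1r; have [|_] := boolP (_ \in _); last first.
  by rewrite mulr0.
rewrite inE /= => y1; rewrite mulr1 min_l ?mul1r//.
by rewrite exprn_ege1// ltW.
Qed.

Let m_one_cos xi : measurable_fun setT (fun y : 'rV[R]_d => 1 - cos (dotv xi y)).
Proof. by apply: measurable_funB => //; exact: measurable_cos_dotv. Qed.

Lemma Rintegrable_one_cos xi (f : 'rV[R]_d -> R) : measurable_fun setT f ->
  (forall y, 0 <= f y <= k y) -> Rintegrable mu (fun y => (1 - cos (dotv xi y)) * f y).
Proof.
move=> mf fk; apply: (@Rintegrable_levy_dom _ (2 + (d%:R * `|xi|) ^+ 2)).
  exact: measurable_funM.
move=> y; have /andP[f0 fky] := fk y.
rewrite ger0_norm ?mulr_ge0// mulrA.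
by apply: ler_pM => //; exact: one_sub_cos_dotv.
Qed.

Let small_k c y : 0 <= k_small c y <= k y.
Proof.
by rewrite small_ge0 /= ler_piMr.
Qed.
Let near_k y : 0 <= k_near y <= k y.
Proof.
by rewrite near_ge0 /= ler_piMr.
Qed.
Let large_k y : 0 <= k_large y <= k y.
Proof.
by rewrite large_ge0 /= ler_piMr.
Qed.

Let m1 (f : 'rV[R]_d -> R) xi := \int[mu]_y ((1 - cos (dotv xi y)) * f y).

(** The part of the heat kernel multiplier due to the jumps of size at most one. *)
Let M1 xi := expR (- m1 k_near xi).

Let m1_ge0 f xi : (forall y, 0 <= f y) -> 0 <= m1 f xi.
Proof. by move=> f0; apply: Rintegral_ge0 => y _; exact: mulr_ge0. Qed.

Let m1_cosT f xi : (forall y, 0 <= f y <= k y) -> Rintegrable mu f ->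
  m1 f xi = \int[mu]_y f y - cosT f xi.
Proof.
move=> fk fi; rewrite -RintegralB//; last exact: Rintegrable_cos.
by apply: eq_Rintegral => y _; rewrite mulrBl mul1r.
Qed.

(** The symbol splits along the length of the jumps: the heat semigroup is the
small-jump semigroup followed by a compound Poisson one. *)
Lemma symbolE xi : symbol K xi = m1 k_near xi + m1 k_large xi.
Proof.
rewrite -RintegralD//; [|exact: Rintegrable_one_cos..].
transitivity (m1 k xi); rewrite /symbol /m1.
  rewrite /Rintegral; congr fine; apply: integral_ae.
  by apply: filterS (kv_ae kv) => y ->.
apply: eq_Rintegral => y _; rewrite -mulrDr -mulrDr -[LHS]mulr1 -mulrA; congr (_ * (_ * _)).
rewrite !indicE; have [y1|y1] := leP (enorm y) 1.
  by rewrite mem_set// memNset ?addr0//= ltNge y1.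
by rewrite memNset ?mem_set ?add0r//=; apply/negP; rewrite -ltNge.
Qed.

Let measurable_m1 f : measurable_fun setT f -> measurable_fun setT (m1 f).
Proof.
move=> mf; apply: (@measurable_Rintegral2 _ _ _ _ _ mu
  (fun z : 'rV[R]_d * 'rV[R]_d => (1 - cos (dotv z.1 z.2)) * f z.2)).
apply: measurable_funM; last exact: (measurableT_comp mf measurable_snd).
by apply: measurable_funB => //; exact: measurable_cos_dotv.
Qed.

Let bounded_measurable_M1 f : measurable_fun setT f -> (forall y, 0 <= f y) ->
  bounded_measurable (fun xi => expR (- m1 f xi)).
Proof.
move=> mf f0; split.
  apply: (measurableT_comp (f := @expR R)); first exact: measurable_expR.
  exact: (measurableT_comp (@oppr_measurable R setT) (measurable_m1 mf)).
by exists 1 => xi; rewrite ger0_norm ?expR_ge0// -expR0 ler_expR oppr_le0 m1_ge0.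
Qed.

Let small_even c : 0 < c -> sym_density (k_small c).
Proof.
move=> c0; apply: sym_density_even => //; first exact: Rintegrable_small.
by move=> y; rewrite /k_small (kv_even kv) !indicE; congr (_ * _%:R);
  congr nat_of_bool; apply/idP/idP; rewrite !inE /= enormN.
Qed.

Let large_even : sym_density k_large.
Proof.
apply: sym_density_even => //; first exact: Rintegrable_large.
by move=> y; rewrite /k_large (kv_even kv) !indicE; congr (_ * _%:R);
  congr nat_of_bool; apply/idP/idP; rewrite !inE /= enormN.
Qed.

Let ball r := [set y : 'rV[R]_d | `|y - 0| <= r].

Let p1 : 'rV[R]_d -> R := \1_(ball 1).

Let sd1 : sym_density p1.
Proof.
have [ip _] := @Rintegrable_norm_ball R d 0 1 ler01.
apply: sym_density_even => // y; rewrite /p1 !indicE; congr (nat_of_bool _)%:R.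
by apply/idP/idP; rewrite !inE /ball /= !subr0 normrN.
Qed.

(** Fourier transform of the indicator of the unit ball. *)
Let q := cosT p1.

Let bq : bounded_measurable q.
Proof. by have [p0 ip _] := sd1; exact: bounded_measurable_cosT. Qed.

Section fixed_scale.
Variables (s : R) (s0 : 0 < s).
Local Notation g := (@lapn R s d).
Let g0 : forall xi, 0 <= g xi := @lapn_ge0 R s d.
Let ig : Rintegrable mu g := @Rintegrable_lapn R s s0 d.

(** A jump density of finite mass generates a compound Poisson semigroup: up to the
factor [exp (- mass)], its multiplier is the exponential of a Fourier transform. *)
Lemma pos_mult_small c : 0 < c -> pos_mult g (fun xi => expR (- m1 (k_small c) xi)).
Proof.
move=> c0 a; have sd := small_even c0.
have ism := Rintegrable_small c0.
rewrite (_ : (fun xi => _) = (fun xi => expR (- \int[mu]_y k_small c y) *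
    (1 * expR (cosT (k_small c) xi)))); last first.
  by apply/funext => xi; rewrite m1_cosT// opprB addrC expRD mul1r.
rewrite multZ//; last first.
  rewrite (_ : (fun xi => _) = (fun xi => expR (\int[mu]_y k_small c y) *
      expR (- m1 (k_small c) xi))).
    by apply: bounded_measurableM; [exact: bounded_measurable_cst|exact: bounded_measurable_M1].
  by apply/funext => xi; rewrite m1_cosT// -expRD mul1r; congr expR; ring.
rewrite mulr_ge0 ?expR_ge0//.
exact: (pos_mult_exp g0 ig (bounded_measurable_cst 1) sd (pos_mult_lapn1 s0 (n := d))).
Qed.

(** The small jumps have infinite mass, so positivity for them is the limit of
positivity for the truncations [k_small c], [c -> 0]. *)
Lemma pos_mult_M1 : pos_mult g M1.
Proof.
pose c (j : nat) : R := j.+1%:R^-1.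
have c0 j : 0 < c j by rewrite invr_gt0.
apply: (@pos_mult_cvg _ _ _ g0 ig (fun j xi => expR (- m1 (k_small (c j)) xi)) _ 1).
- by move=> j; have [] := bounded_measurable_M1 (m_small (c j)) (small_ge0 (c j)).
- by move=> j xi; rewrite ger0_norm ?expR_ge0// -expR0 ler_expR oppr_le0 m1_ge0.
- move=> xi; apply: continuous_cvg; first exact: continuous_expR.
  apply: cvgN.
  apply: (@dominated_Rintegral _ _ _ mu
    (fun j y => (1 - cos (dotv xi y)) * k_small (c j) y) _
    (fun y => (1 - cos (dotv xi y)) * k_near y) _ _ _ _).2.
  + by move=> j; exact: measurable_funM.
  + move=> y; have [y0|y0] := eqVneq y 0.
      rewrite y0 dotv0 cos0 subrr mul0r; under eq_cvg do rewrite mul0r.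
      exact: cvg_cst.
    apply: cvgMl_tmp; apply: cvg_near_cst.
    exists (Num.truncn (enorm y)^-1) => // j /= jy.
    rewrite /k_small /k_near; congr (_ * _); rewrite !indicE; congr (nat_of_bool _)%:R.
    apply/idP/idP; rewrite !inE /=; first by case/andP.
    move=> ->; rewrite andbT /c invf_plt ?posrE ?enorm_gt0//.
    by rewrite (lt_le_trans (truncnS_gt _))// ler_nat ltnS.
  + exact: Rintegrable_one_cos.
  + by move=> j y; rewrite ger0_norm ?mulr_ge0// ler_wpM2l.
- by move=> j; exact: pos_mult_small.
Qed.

(** The heat kernel of the small jumps, smoothed at scale [s]. *)
Let G := mult g M1.

Let bM1 : bounded_measurable M1 := bounded_measurable_M1 m_near near_ge0.

Let mG : measurable_fun setT G.
Proof.
apply: (@measurable_Rintegral2 _ _ _ _ _ mu (fun z : 'rV[R]_d * 'rV[R]_d =>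
  g z.2 * cos (dotv z.2 z.1) * M1 z.2)).
apply: measurable_funM; last exact: (measurableT_comp bM1.1 measurable_snd).
apply: measurable_funM; last exact: measurable_cos_dotv.
exact: (measurableT_comp (Rintegrable_meas ig) measurable_snd).
Qed.

Let G0 : forall a, 0 <= G a := pos_mult_M1.

Let Rintegrable_MG f : Rintegrable mu f -> Rintegrable mu (fun z => f z * G z).
Proof.
have [mM [B hB]] := bM1.
apply: (@Rintegrable_Mb _ _ _ _ (B * \int[mu]_x g x)) => // x.
exact: norm_mult.
Qed.

Let W := \int[mu]_z (\1_(ball 2) z * G z).

(** The left-hand side is [G] convolved with two indicators of the unit ball and
evaluated at the origin, which only involves the values of [G] on the ball of
radius two. *)
Lemma mult_square_le : mult g (fun xi => M1 xi * q xi * q xi) 0 <= 2 ^+ d * W.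
Proof.
have [p0 ip _] := sd1.
have [i1 e1] := @Rintegrable_norm_ball R d 0 1 ler01.
have [i2 _] := @Rintegrable_norm_ball R d 0 2 (ler0n _ 2).
have bMq : bounded_measurable (fun xi => M1 xi * q xi) by exact: bounded_measurableM.
have [-> iX] := mult_conv g0 ig 0 bMq sd1.
have X_le y : ball 1 y -> mult g (fun xi => M1 xi * q xi) (0 - y) <= W.
  rewrite /ball /= subr0 => y1; rewrite (mult_conv g0 ig _ bM1 sd1).1.
  have ir := Rintegrable_reflect (0 - y) ip.
  have -> : \int[mu]_z (p1 z * mult g M1 (0 - y - z)) =
      \int[mu]_z (p1 (0 - y - z) * G z).
    rewrite -[RHS](Rintegral_reflect (0 - y) (Rintegrable_meas (Rintegrable_MG ir))).
    by apply: eq_Rintegral => z _; rewrite subKr.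
  apply: le_Rintegral => //; [exact: Rintegrable_MG|exact: Rintegrable_MG|].
  move=> z _; rewrite ler_wpM2r// /p1 !indicE.
  have [|_] := boolP (0 - y - z \in ball 1); last by rewrite ler0n.
  rewrite inE /ball /= subr0 sub0r => yz.
  rewrite mem_set//= subr0 -[z](subKr (- y)) -[2]/(1 + 1).
  by rewrite (le_trans (ler_normB _ _))// lerD// normrN.
rewrite -[2](mulr1 2) -e1 mulrC -RintegralZl//.
apply: le_Rintegral => //; first exact: RintegrableZl.
move=> y _; rewrite mulrC /p1 indicE.
have [|_] := boolP (y \in ball 1); last by rewrite !mulr0.
by rewrite inE !mulr1 => /X_le.
Qed.

Section with_heat_kernel.
Variables (P : R -> 'rV[R]_d -> R).
Hypothesis HP : heat_kernel K P.

Let sdP : sym_density (P 1).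
Proof.
have [cP P0 P1 E] := HP ltr01; split => //; last by move=> xi; have [] := E xi.
apply: ge0_Rintegrable => //; first exact: continuous_measurable_rV.
by rewrite P1 ltry.
Qed.

(** The right-hand side is the heat kernel smoothed at scale [s]. Of the expansion of
its compound Poisson factor only the term of a single long jump is kept: the jump
[b - z] complements a displacement [z] made of small jumps, and by [mult_square_le]
the displacements of size at most two carry a definite mass. *)
Lemma heat_ge b c : 0 <= c -> (forall z, `|z| <= 2 -> c <= k_large (b - z)) ->
  expR (- \int[mu]_y k_large y) *
    (c * (mult g (fun xi => M1 xi * q xi * q xi) 0 / 2 ^+ d)) <=
  \int[mu]_y (P 1 y * mult g (fun=> 1) (b - y)).
Proof.
move=> c0 ck; have [P0 iP _] := sdP; have [_ ik _] := large_even.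
have [_ _ _ PE] := HP ltr01.
have [i2 _] := @Rintegrable_norm_ball R d 0 2 (ler0n _ 2).
rewrite -(mult_conv g0 ig b (bounded_measurable_cst 1) sdP).1.
rewrite (_ : (fun xi => 1 * cosT (P 1) xi) = (fun xi =>
    expR (- \int[mu]_y k_large y) * (M1 xi * expR (cosT k_large xi)))); last first.
  apply/funext => xi; rewrite mul1r /cosT (PE xi).1 mul1r symbolE.
  rewrite (m1_cosT _ large_k ik) /M1 -!expRD; congr expR; rewrite /cosT; ring.
rewrite multZ//; last first.
  by apply: bounded_measurableM => //; apply: bounded_measurable_expR; exact: bounded_measurable_cosT.
rewrite ler_wpM2l ?expR_ge0//.
apply: le_trans (mult_exp_ge g0 ig b bM1 large_even pos_mult_M1).
have ikr := Rintegrable_reflect b ik.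
have -> : \int[mu]_y (k_large y * mult g M1 (b - y)) = \int[mu]_z (k_large (b - z) * G z).
  rewrite -[RHS](Rintegral_reflect b (Rintegrable_meas (Rintegrable_MG ikr))).
  by apply: eq_Rintegral => z _; rewrite subKr.
apply: (@le_trans _ _ (c * W)).
  by rewrite ler_wpM2l// ler_pdivrMr ?exprn_gt0// mulrC; exact: mult_square_le.
rewrite -RintegralZl//; last exact: Rintegrable_MG.
apply: le_Rintegral => //; [exact/RintegrableZl/Rintegrable_MG|exact: Rintegrable_MG|].
move=> z _; rewrite mulrA ler_wpM2r// indicE.
have [|_] := boolP (z \in ball 2); last by rewrite mulr0.
by rewrite inE /ball /= subr0 mulr1 => /ck.
Qed.

End with_heat_kernel.
End fixed_scale.

Let ball1_measure_gt0 (r : R) : 0 < r -> (0 < mu (ball r))%E.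
Proof.
move=> r0; have := @lebesgue_norm_ball R d 0 r (ltW r0).
by rewrite /ball => ->; rewrite lte_fin exprn_gt0// mulr_gt0.
Qed.

Let q_gt0 (xi : 'rV[R]_d) : `|xi| <= d.+1%:R^-1 -> 0 < q xi.
Proof.
move=> xr; have [p0 ip _] := sd1.
have [i1 e1] := @Rintegrable_norm_ball R d 0 1 ler01.
have i2 : Rintegrable mu (fun y => 2^-1 * p1 y) by exact: RintegrableZl.
apply: (@lt_le_trans _ _ (\int[mu]_y (2^-1 * p1 y))).
  by rewrite RintegralZl// e1 mulr1 mulr_gt0// exprn_gt0.
apply: le_Rintegral => //; first exact: Rintegrable_cos.
move=> y _; rewrite /p1 indicE; have [|_] := boolP (y \in ball 1); last by rewrite !mulr0.
rewrite inE /ball /= subr0 !mulr1 => y1.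
have : `|dotv xi y| <= 1.
  apply: le_trans (norm_dotv _ _) _.
  rewrite -[leRHS](mulr1 1) ler_pM ?mulr_ge0//.
  apply: (@le_trans _ _ (d%:R * d.+1%:R^-1)); first by rewrite ler_wpM2l.
  by rewrite ler_pdivrMr// mul1r ler_nat.
have := one_sub_cos_le (dotv xi y).
rewrite ler_norml => H1 H2; nra.
Qed.

(** As the weight [lapn s] decreases with [s], the value at [s = 1] is a uniform
lower bound; it is positive because the integrand is nonnegative and does not vanish
near the origin. *)
Lemma mult_square_gt0 : exists2 c0, 0 < c0 & forall s, 0 < s <= 1 ->
  c0 <= mult (@lapn R s d) (fun xi => M1 xi * q xi * q xi) 0.
Proof.
have ltr01' : 0 < 1 :> R := ltr01.
pose N xi := M1 xi * q xi * q xi.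
have bN : bounded_measurable N by apply: bounded_measurableM => //; apply: bounded_measurableM => //; exact: bounded_measurable_M1.
have N0 xi : 0 <= N xi by rewrite /N -mulrA -expr2 mulr_ge0 ?expR_ge0 ?sqr_ge0.
pose h s xi := @lapn R s d xi * cos (dotv xi 0) * N xi.
have h0 s xi : 0 <= h s xi.
  by rewrite /h dotv0 cos0 mulr1 mulr_ge0// lapn_ge0.
have ih s : 0 < s -> Rintegrable mu (h s).
  by move=> s0; apply: Rintegrable_mult => //; exact: Rintegrable_lapn.
exists (mult (@lapn R 1 d) N 0); last first.
  move=> s /andP[s0 s1]; apply: le_Rintegral => //; try exact: ih.
  move=> xi _; rewrite dotv0 cos0 !mulr1 ler_wpM2r//.
  apply: ler_prod => i _; rewrite lap_ge0/= /lap ler_expR lerN2.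
  by rewrite ler_wpM2r.
rewrite lt_neqAle (Rintegral_ge0 _ (fun xi _ => h0 1 xi)) andbT eq_sym.
apply/eqP => int0.
have : (\int[mu]_xi `|(h 1 xi)%:E| = 0)%E.
  under eq_integral do rewrite gee0_abs ?lee_fin//.
  by rewrite -EFin_Rintegral; [congr EFin|exact: ih].
move/(ae_eq_integral_abs _ measurableT).
have mh : measurable_fun setT (fun xi => (h 1 xi)%:E).
  by apply/measurable_EFinP; exact: Rintegrable_meas (ih _ ltr01).
move=> /(_ mh) [Z [mZ Z0 hZ]].
have r0 : 0 < d.+1%:R^-1 :> R by rewrite invr_gt0.
have := ball1_measure_gt0 r0.
rewrite (@subset_measure0 _ _ _ mu _ Z) ?ltxx//.
  exact: measurable_norm_ball.
move=> xi; rewrite /ball /= subr0 => /q_gt0 qx; apply: hZ => /(_ I) /= /eqP.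
apply/negP; rewrite eqe /h dotv0 cos0 mulr1 gt_eqF// mulr_gt0//.
  by apply: prodr_gt0 => i _; exact: expR_gt0.
by rewrite /N -mulrA -expr2 mulr_gt0 ?expR_gt0 ?exprn_gt0.
Qed.

Variables (P : R -> 'rV[R]_d -> R).
Hypothesis HP : heat_kernel K P.

(** The smoothed heat kernel is at least a fixed multiple of [kap (enorm a)] at all
points near [a], uniformly in the smoothing scale. [cauchy_average] removes the smoothing at the
cost of an average over a small ball, and continuity of the heat kernel removes the
average. *)
Lemma heat_kernel_lower : exists2 c, 0 < c &
  forall a, 5 <= `|a| -> c * kap (enorm a) <= P 1 a.
Proof.
have [c0 c00 c0le] := mult_square_gt0.
pose A : R := (2 * d + 1)%:R.
have A1 : 1 <= A by rewrite ler1n addn1.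
have [D D0 DP] := kv_doubling kv A1.
have C0 := kv_C kv.
pose c1 := C^-1 * D^-1.
have c10 : 0 < c1 by rewrite mulr_gt0 ?invr_gt0.
pose lam := expR (- \int[mu]_y k_large y).
have lam0 : 0 < lam by exact: expR_gt0.
(* [b - z] has sup norm between [|a| - 3 >= 2] and [|a| + 3 <= 2 |a|]: the jump to it
   is long, and at most [A] times as long as [a] in Euclidean norm *)
have large_ge (a b z : 'rV[R]_d) : 5 <= `|a| -> `|b - a| <= 1 -> `|z| <= 2 ->
    c1 * kap (enorm a) <= k_large (b - z).
  move=> a5 ba z2.
  have na : `|a| <= enorm a by exact: norm_le_enorm.
  have lo : `|a| - 3 <= `|b - z|.
    have : `|a| <= `|b - z| + `|b - a| + `|z|.
      rewrite {1}(_ : a = (b - z) - (b - a) + z); last first.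
        by rewrite opprB addrAC subrK addrC subrK.
      by rewrite (le_trans (ler_normD _ _))// lerD2r ler_normB.
    lra.
  have hi : `|b - z| <= `|a| + 3.
    have : `|b - z| <= `|b - a| + `|a| + `|z|.
      rewrite {1}(_ : b = (b - a) + a); last by rewrite subrK.
      by rewrite (le_trans (ler_normB _ _))// lerD2r ler_normD.
    lra.
  have e1 : 1 < enorm (b - z).
    by apply: lt_le_trans (norm_le_enorm _); lra.
  have eA : enorm (b - z) <= A * enorm a.
    apply: le_trans (enorm_le_norm _) _.
    apply: (@le_trans _ _ (d%:R * (2 * `|a|))).
      by rewrite ler_wpM2l//; lra.
    have dA : d%:R * 2 <= A by rewrite /A mulrC -natrM ler_nat leq_addr.
    by rewrite mulrA ler_pM// mulr_ge0.
  have ea0 : 0 < enorm a by lra.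
  have bz0 : b - z != 0 by apply/negP => /eqP bz; move: e1; rewrite bz enorm0; lra.
  rewrite /k_large indicE mem_set//= mulr1.
  apply: le_trans (kv_lower kv bz0).
  rewrite /c1 -mulrA ler_wpM2l ?invr_ge0 ?(ltW C0)//.
  rewrite ler_pdivrMl//; apply: le_trans (DP _ ea0) _.
  rewrite ler_wpM2l ?(ltW D0)//; apply: (kv_decr kv) => //.
  by lra.
pose c2 := lam * (c1 * (c0 / 2 ^+ d)).
have c20 : 0 < c2.
  by do 2![apply: mulr_gt0 => //]; rewrite divr_gt0// exprn_gt0.
have tp0 : 0 < (2 * pi) ^+ d :> R by rewrite exprn_gt0// mulr_gt0// pi_gt0.
have [cP P0 PI PE] := HP ltr01.
have iP : Rintegrable mu (P 1).
  by apply: ge0_Rintegrable => //; [exact: continuous_measurable_rV|rewrite PI ltry].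
exists (c2 / (2 * pi) ^+ d); first by rewrite divr_gt0.
move=> a a5; rewrite leNgt; apply/negP => Pa.
pose v := c2 * kap (enorm a).
have kapa : 0 < kap (enorm a).
  by apply: (kv_kap kv); apply: lt_le_trans (norm_le_enorm _); lra.
have v0 : 0 < v by rewrite mulr_gt0.
have Pv : P 1 a < v / (2 * pi) ^+ d by rewrite /v mulrAC.
(* a level strictly between the value at [a] and the claimed bound, under which
   continuity keeps the heat kernel in a neighbourhood of [a] *)
pose w := (P 1 a + v / (2 * pi) ^+ d) / 2.
have [aw wv] : P 1 a < w /\ w < v / (2 * pi) ^+ d.
  by rewrite /w; move: Pv; set x := v / _ => Pv; split; lra.
have : \forall b \near a, P 1 b < w by have := cP a; move/cvgr_lt; apply.
move=> /nbhs_ballP[r /= r0 rP].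
pose e := Num.min 1 (r / 2).
have e0 : 0 < e by rewrite lt_min ltr01 divr_gt0.
have avg : v * (2 * e) ^+ d <= (2 * pi) ^+ d *
    \int[mu]_y (P 1 y * \1_[set y | `|y - a| <= e] y).
  apply: cauchy_average => // s b /andP[s0 s1] /= ba.
  have be : `|b - a| <= 1 by rewrite (le_trans ba)// ge_min lexx.
  have := heat_ge s0 HP (mulr_ge0 (ltW c10) (ltW kapa))
    (fun z => large_ge a b z a5 be).
  rewrite -/lam => H; apply: (le_trans _ (le_trans H _)).
    rewrite /v /c2 (_ : lam * (c1 * (c0 / 2 ^+ d)) * kap (enorm a) =
      lam * (c1 * kap (enorm a) * (c0 / 2 ^+ d))); last by ring.
    apply: ler_wpM2l; first exact: ltW.
    apply: ler_wpM2l; first exact: mulr_ge0 (ltW c10) (ltW kapa).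
    apply: ler_wpM2r; first by rewrite invr_ge0 exprn_ge0.
    by apply: c0le; rewrite s0.
  rewrite le_eqVlt; apply/orP; left; apply/eqP; apply: eq_Rintegral => y _.
  by rewrite mult_lapn1.
have [iJ eJ] := Rintegrable_norm_ball a (ltW e0).
have : \int[mu]_y (P 1 y * \1_[set y | `|y - a| <= e] y) <= w * (2 * e) ^+ d.
  rewrite -eJ -RintegralZl//; apply: le_Rintegral => //; last 2 first.
  - exact: RintegrableZl.
  - move=> y _; rewrite indicE; have [|_] := boolP (_ \in _); last by rewrite !mulr0.
    rewrite inE /= => ya; rewrite !mulr1 ltW//; apply: rP.
    rewrite -ball_normE /= distrC (le_lt_trans ya)//.
    by rewrite gt_min; apply/orP; right; rewrite ltr_pdivrMr// ltr_pMr// ltr1n.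
  apply: (@Rintegrable_Mb _ _ _ _ 1) => //; first exact: Rintegrable_meas iJ.
  by move=> y; rewrite indicE; case: (_ \in _); rewrite ?normr1 ?normr0.
move=> le_w; have := le_trans avg (ler_wpM2l (ltW tp0) le_w).
rewrite leNgt mulrA ltr_pM2r; last by rewrite exprn_gt0// mulr_gt0.
by rewrite mulrC -ltr_pdivlMr// wv.
Qed.

End heat_kernel_lower_bound.

(** * Domination of the jump kernel by the heat kernel; second differences *)

Section heat_kernel_dominates.
Context {R : realType} {d : nat}.

(** [x - w] is at least half as long as [x], so doubling bounds the jump kernel at
[x - w] by its profile at [x], which [heat_kernel_lower] compares with the heat
kernel. *)
Lemma heat_kernel_dominates (K k : 'rV[R]_d -> R) kap C
    (kv : kernel_version K k kap C) P (HP : heat_kernel K P) :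
  (0 < d)%N -> exists2 C0, 0 < C0 & forall r x w, 5 <= `|x| -> 2 * r <= `|x| ->
    `|w| <= r -> k (x - w) <= C0 * P 1 x.
Proof.
move=> d0; have [c c0 cP] := heat_kernel_lower kv HP.
pose A : R := (2 * d + 1)%:R.
have A1 : 1 <= A by rewrite ler1n addn1.
have [D D0 DP] := kv_doubling kv A1.
have C0 := kv_C kv.
exists (C * D / c); first by rewrite divr_gt0// mulr_gt0.
move=> r x w x5 xr wr.
have lo : `|x| / 2 <= `|x - w|.
  have : `|x| <= `|x - w| + `|w| by rewrite -{1}[x](subrK w) ler_normD.
  by lra.
have e0 : 0 < enorm (x - w) by apply: lt_le_trans (norm_le_enorm _); lra.
have ex0 : 0 < enorm x by apply: lt_le_trans (norm_le_enorm _); lra.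
have xw0 : x - w != 0 by apply/negP => /eqP xw; move: e0; rewrite xw enorm0; lra.
apply: le_trans (kv_upper kv xw0) _.
have xA : enorm x <= A * enorm (x - w).
  apply: le_trans (enorm_le_norm x) _.
  apply: (@le_trans _ _ (d%:R * (2 * enorm (x - w)))).
    rewrite ler_wpM2l//; have := norm_le_enorm (x - w); lra.
  rewrite mulrA ler_wpM2r ?enorm_ge0//.
  by rewrite /A mulrC -natrM ler_nat leq_addr.
have K1 : kap (enorm (x - w)) <= D * kap (enorm x).
  apply: le_trans (DP _ e0) _; rewrite ler_wpM2l ?(ltW D0)//.
  exact: (kv_decr kv ex0 xA).
rewrite (_ : C * D / c * P 1 x = C * (D * (P 1 x / c))); last first.
  by rewrite -!mulrA [c^-1 * _]mulrC.
rewrite ler_wpM2l ?(ltW C0)//; apply: le_trans K1 _.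
by rewrite ler_wpM2l ?(ltW D0)// ler_pdivlMr// mulrC cP.
Qed.

End heat_kernel_dominates.

Section directional.
Context {R : realType} {V : normedModType R}.

Lemma is_derive_line (f : V -> R) z v (s : R) : differentiable f (z + s *: v) ->
  is_derive s 1 (fun s : R => f (z + s *: v)) ('d f (z + s *: v) v).
Proof.
move=> df; pose l (s : R) := z + s *: v.
have dl : is_diff s l (fun h : R => h *: v).
  apply: is_diff_eq; by apply/funext => h /=; rewrite add0r.
have dfl : differentiable (f \o l) s by apply: differentiable_comp; [exact: ex_diff|].
apply: DeriveDef; first exact/derivable1_diffP.
rewrite deriveE// [LHS](_ : _ = 'd (f \o l) s 1)// diff_comp//=.
by rewrite diff_val scale1r.
Qed.

(** Second order Taylor bound for the symmetric difference, from the mean value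
theorem for [f] on both sides of [z] and then for its directional derivative. *)
Lemma second_difference_le (f : V -> R) z v M :
  (forall x, differentiable f x) ->
  (forall x, differentiable (fun y => 'd f y v) x) ->
  (forall x, `|'d (fun y => 'd f y v) x v| <= M) ->
  `|f z - (f (z + v) + f (z - v)) / 2| <= M.
Proof.
move=> df ddf dM.
pose h (s : R) : R := f (z + s *: v).
pose h' (s : R) : R := 'd f (z + s *: v) v.
have dh (s : R) : is_derive s 1 h (h' s) by exact: is_derive_line.
have dh' (s : R) : is_derive s 1 h' ('d (fun y => 'd f y v) (z + s *: v) v).
  exact: (is_derive_line (f := fun y => 'd f y v)).
have ch : continuous h.
  by move=> t; apply/differentiable_continuous/derivable1_diffP; have [] := dh t.
have ch' : continuous h'.
  by move=> t; apply/differentiable_continuous/derivable1_diffP; have [] := dh' t.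
have [c1 c1I e1] := @MVT_segment R h h' 0 1 ler01 (fun x _ => dh x)
  (continuous_subspaceT ch).
have [c2 c2I e2] := @MVT_segment R h h' (-1) 0 ltac:(lra) (fun x _ => dh x)
  (continuous_subspaceT ch).
move: c1I c2I; rewrite !in_itv /= => /andP[c10 c11] /andP[c20 c21].
have c12 : c2 <= c1 by lra.
have [c3 _ e3] := @MVT_segment R h' _ c2 c1 c12 (fun x _ => dh' x)
  (continuous_subspaceT ch').
have h0 : h 0 = f z by rewrite /h scale0r addr0.
have h1 : h 1 = f (z + v) by rewrite /h scale1r.
have hN1 : h (-1) = f (z - v) by rewrite /h scaleN1r.
move: e1 e2; rewrite h0 h1 hN1 => e1 e2.
rewrite (_ : f z - _ = - (2^-1 * (h' c1 - h' c2))); last by lra.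
rewrite normrN e3 normrM ger0_norm ?invr_ge0// normrM.
have -> : `|c1 - c2| = c1 - c2 by rewrite ger0_norm ?subr_ge0.
have M0 : 0 <= M by exact: le_trans (dM z).
apply: (@le_trans _ _ (2^-1 * (M * 2))); last by lra.
by rewrite ler_wpM2l// ?invr_ge0// ler_pM ?subr_ge0//; lra.
Qed.

End directional.

(** * Compact sets, slabs and test functions *)

Section compact_bounds.
Context {R : realType} {T : topologicalType}.

Lemma within_compact_bounded (C : set T) (f : T -> R) : compact C ->
  {within C, continuous f} -> exists2 M, 0 <= M & forall z, C z -> `|f z| <= M.
Proof.
move=> cC cf; have [M [_ HM]] := compact_bounded (continuous_compact cf cC).
exists (`|M| + 1); first by rewrite addr_ge0.
move=> z Cz; apply: (HM (`|M| + 1)); last by exists z.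
by rewrite (le_lt_trans (ler_norm _))// ltrDl.
Qed.

Lemma compact_support_bounded (C : set T) (f : T -> R) : compact C ->
  continuous f -> (forall z, ~ C z -> f z = 0) ->
  exists2 M, 0 <= M & forall z, `|f z| <= M.
Proof.
move=> cC cf f0.
have [M M0 HM] := within_compact_bounded cC (continuous_subspaceT cf).
exists M => // z; have [/HM//|/f0 ->] := pselect (C z).
by rewrite normr0.
Qed.

End compact_bounds.

Section space_time.
Context {R : realType} {d : nat}.
Local Notation V := ('rV[R]_d * R)%type.

Lemma open_cylinder (T : R) : open (cylinder (R := R) (d := d) T).
Proof.
rewrite (_ : cylinder T = snd @^-1` `]0, T[%classic); last first.
  by apply/seteqP; split => z /=; rewrite /cylinder /= in_itv.
apply: open_comp; last exact: interval_open.
by move=> z _; exact: cvg_snd.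
Qed.

Definition slab (r e T1 : R) : set V := [set z | `|z.1| <= r /\ e <= z.2 <= T1].

Lemma compact_slab r e T1 : compact (slab r e T1).
Proof.
rewrite (_ : slab r e T1 = [set x | `|x| <= r] `*` `[e, T1]%classic); last first.
  by apply/seteqP; split => -[x t] /=; rewrite in_itv.
apply: compact_setX; last exact: segment_compact.
apply: bounded_closed_compact.
  exists r; split; first exact: num_real.
  by move=> y ry x /= xr; exact: le_trans xr (ltW ry).
rewrite (_ : [set x | _] = (fun x : 'rV[R]_d => `|x|) @^-1` `]-oo, r]%classic); last first.
  by apply/seteqP; split => x /=; rewrite in_itv.
apply: closed_comp; last exact: interval_closed.
by move=> x _; exact: norm_continuous.
Qed.

Lemma slab_sub_cylinder r e T1 T : 0 < e -> T1 < T -> slab r e T1 `<=` cylinder T.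
Proof.
move=> e0 T1T z [_ /andP[z1 z2]]; rewrite /cylinder /=.
by rewrite (lt_le_trans e0 z1) (le_lt_trans z2 T1T).
Qed.

Lemma slab_bounded (g : V -> R) r e T1 T : 0 < e -> T1 < T ->
  {within cylinder T, continuous g} ->
  exists2 U, 0 <= U & forall z, slab r e T1 z -> `|(g \_ (cylinder T)) z| <= U.
Proof.
move=> e0 T1T cg; have sT := slab_sub_cylinder (r := r) e0 T1T.
have [U U0 HU] := within_compact_bounded (@compact_slab r e T1) (continuous_subspaceW sT cg).
by exists U => // z sz; rewrite patchE mem_set; [exact: HU|exact: sT].
Qed.

(** The inverses of [t] and [T - t] are bounded on a compact subset of the open
cylinder, which keeps it away from both ends. *)
Lemma compact_sub_slab (C : set V) (T : R) : 0 < T -> compact C -> C `<=` cylinder T ->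
  exists r e T1, [/\ 0 <= r, 0 < e, e < T1, T1 < T &
    forall z, C z -> `|z.1| <= r /\ e < z.2 < T1].
Proof.
move=> T0 cC CT.
have c1 : continuous (fun z : V => `|z.1|).
  move=> z; apply: (@continuous_comp _ _ _ fst (fun x : 'rV[R]_d => `|x|)).
    exact: cvg_fst.
  exact: norm_continuous.
have [r r0 Hr] := within_compact_bounded cC (continuous_subspaceT c1).
have c2 : {within C, continuous (fun z : V => z.2^-1)}.
  apply: continuous_in_subspaceT => z; rewrite inE => /CT /andP[z0 _].
  by apply: cvgV; [rewrite gt_eqF|exact: cvg_snd].
have c3 : {within C, continuous (fun z : V => (T - z.2)^-1)}.
  apply: continuous_in_subspaceT => z; rewrite inE => /CT /andP[_ zT].
  apply: cvgV; first by rewrite gt_eqF// subr_gt0.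
  by apply: cvgB; [exact: cvg_cst|exact: cvg_snd].
have [M2 M20 H2] := within_compact_bounded cC c2.
have [M3 M30 H3] := within_compact_bounded cC c3.
pose N := M2 + M3 + 3 / T.
have N2 : M2 < N by rewrite /N; have := divr_gt0 (ltr0n R 3) T0; lra.
have N3 : M3 < N by rewrite /N; have := divr_gt0 (ltr0n R 3) T0; lra.
have N0 : 0 < N by lra.
have NT : 3 * N^-1 <= T.
  rewrite ler_pdivrMr// -ler_pdivrMl// mulrC /N; lra.
have N0' : 0 < N^-1 by rewrite invr_gt0.
exists r, N^-1, (T - N^-1); split => //; [lra|lra|].
move=> z Cz; have /andP[z0 zT] := CT _ Cz; split.
  by rewrite -normr_id; exact: Hr.
have := H2 _ Cz; have := H3 _ Cz.
rewrite !ger0_norm ?invr_ge0 ?subr_ge0 ?(ltW z0) ?(ltW zT)// => h3 h2.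
apply/andP; split.
  by rewrite invf_plt ?posrE// (le_lt_trans h2).
suff : N^-1 < T - z.2 by lra.
by rewrite invf_plt ?posrE ?subr_gt0// (le_lt_trans h3).
Qed.

End space_time.

Section test_functions.
Context {R : realType} {d : nat}.
Local Notation V := ('rV[R]_d * R)%type.
Variables (D : set V) (theta : V -> R).
Hypothesis Htheta : test_function D theta.

Let S := closure [set z | theta z != 0].

Lemma test_continuous : continuous theta.
Proof. by have [/(_ 0%N)] := Htheta. Qed.

Lemma test_differentiable z : differentiable theta z.
Proof. by have [/(_ 1%N) []] := Htheta. Qed.

Lemma test_off z : ~ S z -> theta z = 0.
Proof.
move=> Sz; apply/eqP; apply/negPn/negP => t0; apply: Sz.
exact: subset_closure.
Qed.

Lemma diff_off (f : V -> R) : (forall z, differentiable f z) ->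
  (forall z, ~ S z -> f z = 0) -> forall v z, ~ S z -> 'd f z v = 0.
Proof.
move=> df f0 v z Sz; rewrite -deriveE//.
have zS : \forall y \near z, f y = cst 0 y.
  have : open (~` S) by apply: closed_openC; exact: closed_closure.
  rewrite openE => /(_ z Sz); apply: filterS => y; exact: f0.
by rewrite (near_eq_derive _ zS)// derive_cst.
Qed.

Lemma test_bounded : exists2 M, 0 <= M & forall z, `|theta z| <= M.
Proof.
have [_ cS _] := Htheta.
exact: compact_support_bounded cS test_continuous test_off.
Qed.

Lemma dt_testE z : dt theta z = 'd theta z (0, 1).
Proof.
rewrite /dt derive1E.
have := @is_derive_line R V theta (z.1, 0) (0, 1) z.2.
have E (s : R) : (z.1, 0) + s *: (0, 1) = (z.1, s) :> V.
  by congr pair => /=; rewrite ?scaler0 ?addr0// add0r [_ *: _]mulr1.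
rewrite E => /(_ (test_differentiable _)) H.
have -> : (fun s => theta (z.1, s)) = (fun s : R => theta ((z.1, 0) + s *: (0, 1))).
  by apply/funext => s; rewrite E.
by rewrite (@derive_val _ _ _ _ _ _ _ H) -surjective_pairing.
Qed.

Lemma derivable_test z : derivable (fun s => theta (z.1, s)) z.2 1.
Proof.
have := @is_derive_line R V theta (z.1, 0) (0, 1) z.2.
have E (s : R) : (z.1, 0) + s *: (0, 1) = (z.1, s) :> V.
  by congr pair => /=; rewrite ?scaler0 ?addr0// add0r [_ *: _]mulr1.
rewrite E => /(_ (test_differentiable _)) [H _].
rewrite (_ : (fun s => theta (z.1, s)) = (fun s : R => theta ((z.1, 0) + s *: (0, 1))))//.
by apply/funext => s; rewrite E.
Qed.

Lemma continuous_dt_test : continuous (dt theta).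
Proof.
have [/(_ 1%N) [_ /(_ (0, 1)) /= c1] _ _] := Htheta.
rewrite (_ : dt theta = fun z => 'd theta z (0, 1))//.
by apply/funext => z; exact: dt_testE.
Qed.

Lemma dt_test_off z : ~ S z -> dt theta z = 0.
Proof.
move=> Sz; rewrite dt_testE; apply: diff_off => //.
  exact: test_differentiable.
exact: test_off.
Qed.

Lemma dt_test_bounded : exists2 M, 0 <= M & forall z, `|dt theta z| <= M.
Proof.
have [_ cS _] := Htheta.
exact: compact_support_bounded cS continuous_dt_test dt_test_off.
Qed.

Let e_ i : V := (delta_mx 0 i, 0).

Let basisE (y : 'rV[R]_d) : (y, 0) = \sum_i y 0 i *: e_ i :> V.
Proof.
rewrite [LHS]surjective_pairing [RHS]surjective_pairing; congr pair => /=.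
  rewrite [LHS]row_sum_delta (raddf_sum (fst : {additive V -> _})).
  by apply: eq_bigr.
rewrite (raddf_sum (snd : {additive V -> _})) big1// => i _ /=.
by rewrite scaler0.
Qed.

Let diffE (f : V -> R) z y : 'd f z (y, 0) = \sum_i y 0 i * 'd f z (e_ i).
Proof. by rewrite basisE linear_sum; apply: eq_bigr => i _; rewrite linearZ. Qed.

(** The second derivatives of a test function are continuous with compact support. *)
Lemma test_second_difference : exists2 M, 0 <= M & forall z y,
  `|sym_diff (fun x => theta (x, z.2)) z.1 y| <= M * `|y| ^+ 2.
Proof.
have [C2 cS _] := Htheta.
have [_ /= C1] := C2 2%N.
pose phi i := fun z => 'd theta z (e_ i).
have dphi i z : differentiable (phi i) z by have [] := C1 (e_ i).
have cpsi i j : continuous (fun z => 'd (phi i) z (e_ j)) by have [_] := C1 (e_ i).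
have phi0 i z : ~ S z -> phi i z = 0.
  by apply: diff_off; [exact: test_differentiable|exact: test_off].
have psi0 i j z : ~ S z -> 'd (phi i) z (e_ j) = 0.
  by apply: diff_off => //; exact: phi0.
have B i j := compact_support_bounded cS (cpsi i j) (psi0 i j).
pose M i j := sval (cid2 (B i j)).
have M0 i j : 0 <= M i j by rewrite /M; case: cid2.
have MP i j z : `|'d (phi i) z (e_ j)| <= M i j by rewrite /M; case: cid2.
exists (\sum_i \sum_j M i j).
  by apply: sumr_ge0 => i _; apply: sumr_ge0.
move=> z y; have phiE : (fun x => 'd theta x (y, 0)) = \sum_i (y 0 i *: phi i).
  apply/funext => x; rewrite diffE fct_sumE; apply: eq_bigr => i _.
  by rewrite fctE.
have dz (x : V) i : differentiable (y 0 i *: phi i) x by exact: differentiableZ.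
(* jumps in space are space-time displacements [(y, 0)] *)
have E : sym_diff (fun x => theta (x, z.2)) z.1 y =
    theta z - (theta (z + (y, 0)) + theta (z - (y, 0))) / 2.
  rewrite /sym_diff; case: z => x t /=; congr (_ - (theta _ + theta _) / _).
    by congr pair => /=; rewrite addr0.
  by congr pair => /=; rewrite subr0.
rewrite E; apply: second_difference_le; first exact: test_differentiable.
  by move=> x; rewrite phiE; apply: differentiable_sum.
move=> x; rewrite phiE -deriveE; last exact: differentiable_sum.
have dv i : derivable (y 0 i *: phi i) x (y, 0) by exact: diff_derivable.
rewrite derive_sum//.
have -> : \sum_(i < d) 'D_(y, 0) (y 0 i *: phi i) x =
    \sum_(i < d) \sum_(j < d) y 0 i * (y 0 j * 'd (phi i) x (e_ j)).
  apply: eq_bigr => i _; rewrite deriveZ; last exact: diff_derivable.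
  rewrite deriveE// diffE [LHS]/GRing.scale /= mulr_sumr.
  by [].
rewrite mulr_suml; apply: le_trans (ler_norm_sum _ _ _) _; apply: ler_sum => i _.
rewrite mulr_suml; apply: le_trans (ler_norm_sum _ _ _) _; apply: ler_sum => j _.
rewrite !normrM mulrA mulrC expr2 ler_pM ?mulr_ge0//.
by rewrite ler_pM// coord_le_norm.
Qed.

End test_functions.

(** * Duality in space *)

Section space_time_measure.
Context {R : realType} {d : nat}.
Local Notation mu := (@lebesgue_rV R d).
Local Notation leb := (@lebesgue_measure R).
Local Notation VT := ('rV[R]_d * measurableTypeR R)%type.

(** The space-time Lebesgue measure, named so that its sigma-finiteness can be
attached to it and used in further products. *)
Definition stm : set VT -> \bar R := (mu \x leb)%E.

HB.instance Definition _ := Measure.copy stm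
  (lebesgue_integral_fubini_product_measure1__canonical__measure_function_Measure
    mu leb).

Let stm_sigma_finite : sigma_finite setT stm.
Proof.
have /sigma_finiteP[F [FT ndF Foo]] := sigma_finiteT mu.
have /sigma_finiteP[G [GT ndG Goo]] := sigma_finiteT leb.
exists (fun k => F k `*` G k).
  apply/esym; rewrite -subTset => -[v a] _.
  have [k _ Fkv] : (\bigcup_k F k) v by rewrite -FT.
  have [l _ Gla] : (\bigcup_k G k) a by rewrite -GT.
  exists (maxn k l) => //; split=> /=.
  - by move: v Fkv; exact/subsetPset/ndF/leq_maxl.
  - by move: a Gla; exact/subsetPset/ndG/leq_maxr.
move=> k; have [mF Fk] := Foo k; have [mG Gk] := Goo k; split.
  exact: measurableX.
by rewrite /stm product_measure1E// lte_mul_pinfty// ge0_fin_numE.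
Qed.

HB.instance Definition _ := Measure_isSigmaFinite.Build _ _ _ stm
  stm_sigma_finite.

Local Notation m := stm.

Lemma stm_tonelli1 (f : VT -> \bar R) :
  measurable_fun setT f -> (forall z, (0 <= f z)%E) ->
  (\int[m]_z f z = \int[mu]_x \int[leb]_t f (x, t))%E.
Proof. exact: fubini_tonelli1. Qed.

Lemma stm_tonelli2 (f : VT -> \bar R) :
  measurable_fun setT f -> (forall z, (0 <= f z)%E) ->
  (\int[m]_z f z = \int[leb]_t \int[mu]_x f (x, t))%E.
Proof. exact: fubini_tonelli2. Qed.

Lemma measurable_shift (y : 'rV[R]_d) :
  measurable_fun setT (fun z : VT => (z.1 + y, z.2) : VT).
Proof.
by apply: measurable_fun_pair => //; exact: measurable_rVD.
Qed.

Lemma ge0_integral_shift y (f : VT -> \bar R) :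
  measurable_fun setT f -> (forall z, (0 <= f z)%E) ->
  (\int[m]_z f ((z.1 + y)%R, z.2) = \int[m]_z f z)%E.
Proof.
move=> mf f0.
have mfy : measurable_fun setT (fun z : VT => f (z.1 + y, z.2)).
  exact: (measurableT_comp mf (measurable_shift y)).
rewrite (stm_tonelli2 mfy (fun z => f0 _)) (stm_tonelli2 mf f0).
apply: eq_integral => t _.
apply: (integral_rV_translate y (f := fun x => f (x, t))).
exact: (measurableT_comp mf (pair2_measurable t)).
Qed.

Lemma integral_shift y (f : VT -> R) : measurable_fun setT f ->
  (\int[m]_z (f ((z.1 + y)%R, z.2))%:E = \int[m]_z (f z)%:E)%E.
Proof.
move=> mf; have mEf : measurable_fun setT (EFin \o f) by exact/measurable_EFinP.
rewrite integralE [RHS]integralE; congr (_ - _)%E.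
- rewrite -[RHS](ge0_integral_shift y (measurable_funepos mEf) (funepos_ge0 _)).
  by apply: eq_integral => x _; rewrite !funeposE.
- rewrite -[RHS](ge0_integral_shift y (measurable_funeneg mEf) (funeneg_ge0 _)).
  by apply: eq_integral => x _; rewrite !funenegE.
Qed.

Lemma Rintegrable_shift y (f : VT -> R) : Rintegrable m f -> Rintegrable m (fun z => f (z.1 + y, z.2)).
Proof.
move=> /integrableP[mf foo]; apply/integrableP; split.
  exact: (measurableT_comp mf (measurable_shift y)).
rewrite (ge0_integral_shift y (f := fun z => `|(f z)%:E|%E))//.
exact: measurableT_comp.
Qed.

Lemma Rintegrable_slices d1 d2 (T1 : measurableType d1) (T2 : measurableType d2)
    (m1 : {sigma_finite_measure set T1 -> \bar R})
    (m2 : {sigma_finite_measure set T2 -> \bar R}) (f : T1 * T2 -> R) (h : T1 -> R) :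
  measurable_fun setT f -> Rintegrable m1 h ->
  (forall x, (\int[m2]_y `|f (x, y)|%:E <= (h x)%:E)%E) -> Rintegrable (m1 \x m2)%E f.
Proof.
move=> mf ih fh; apply: Rintegrable_prod => //.
apply: (@le_lt_trans _ _ (\int[m1]_x (h x)%:E)%E); last exact: integrable_lty ih.
apply: ge0_le_integralT => // x; apply: integral_ge0 => y _.
by rewrite lee_fin.
Qed.

Lemma Rintegrable_ball_itv s e T1 : 0 <= s ->
  Rintegrable m (fun z => \1_(`[e, T1]%classic : set (measurableTypeR R)) z.2 *
    \1_[set x : 'rV[R]_d | `|x - 0| <= s] z.1 : R).
Proof.
move=> s0; have [ib _] := @Rintegrable_norm_ball R d 0 s s0.
have iI : Rintegrable leb (\1_(`[e, T1]%classic) : measurableTypeR R -> R).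
  exact: (integrable_indic_itv e T1 true false).
have := Rintegrable_tensor ib iI; congr integrable; apply/funext => z.
by rewrite /= mulrC.
Qed.

Lemma Rintegrable_bounded_slab (f : VT -> R) r e T1 M : measurable_fun setT f -> 0 <= r ->
  (forall z, slab r e T1 z -> `|f z| <= M) -> (forall z, ~ slab r e T1 z -> f z = 0) ->
  Rintegrable m f.
Proof.
move=> mf r0 fM f0; apply: (Rintegrable_dom mf _ (RintegrableZl M (Rintegrable_ball_itv e T1 r0))) => -[x t].
rewrite /= !indicE; have [[/= xr tI]|zn] := pselect (slab r e T1 (x, t)).
  by rewrite !mem_set ?mulr1 ?fM//= ?subr0 ?in_itv.
rewrite f0// normr0; have [tI|] := boolP (t \in _); last by rewrite mul0r mulr0.
have [xB|] := boolP (x \in _); last by rewrite !mulr0.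
exfalso; apply: zn; move: tI xB; rewrite !inE /= in_itv /= subr0 => tI xB.
by split.
Qed.

End space_time_measure.

Section duality.
Context {R : realType} {d : nat}.
Local Notation mu := (@lebesgue_rV R d).
Local Notation leb := (@lebesgue_measure R).
Local Notation VT := ('rV[R]_d * measurableTypeR R)%type.
Local Notation m := (@stm R d).
Variables (K k : 'rV[R]_d -> R) (kap : R -> R) (C : R).
Hypothesis kv : kernel_version K k kap C.
Variables (p : 'rV[R]_d -> R) (C0 : R).
Hypotheses (mp : measurable_fun setT p) (p0 : forall x, 0 <= p x) (C00 : 0 < C0).
Hypothesis k_le_p : forall (r : R) (x w : 'rV[R]_d), 5 <= `|x| -> 2 * r <= `|x| -> `|w| <= r ->
  k (x - w) <= C0 * p x.
Variables (T : R) (T_gt0 : 0 < T) (u : 'rV[R]_d * R -> R).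
Hypothesis cu : {within cylinder T, continuous u}.
Hypothesis Hup : L1loc_time_L1 T p u.
Variable theta : 'rV[R]_d * R -> R.
Hypothesis Htheta : test_function (cylinder T) theta.

Let k0 : forall y, 0 <= k y := kv_ge0 kv.
Let mk : measurable_fun setT k := kv_meas kv.

Definition cut : VT -> R := u \_ (cylinder T).
Local Notation ut := cut.

Let mut : measurable_fun setT ut.
Proof. exact: (continuous_measurable_rVR (@open_cylinder R d T) cu). Qed.

Lemma cutE z : cylinder T z -> ut z = u z.
Proof. by move=> zT; rewrite /cut patchE mem_set. Qed.

Hypothesis Hsol : forall z, cylinder T z -> aeintegrable mu setT
  (fun y => (sym_diff (fun x => u (x, z.2)) z.1 y * K y)%:E).
Hypothesis Hloc : L1loc (cylinder T) (fun z =>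
  (\int[mu]_(y in [set y : 'rV[R]_d | (enorm y <= 1)%R])
    (`|sym_diff (fun x => u (x, z.2)) z.1 y| * K y)%:E)%E).

Let S := closure [set z | theta z != 0].

Section fixed_slab.
Variables (r e T1 : R).
Hypotheses (r0 : 0 <= r) (e0 : 0 < e) (eT1 : e < T1) (T1T : T1 < T).
Hypothesis S_slab : forall z, S z -> `|z.1| <= r /\ e < z.2 < T1.

Let I := `[e, T1]%classic : set (measurableTypeR R).
Let B := [set x : 'rV[R]_d | `|x - 0| <= r].
(** Outside the ball of radius [rho] the weight [p] dominates the jumps into the
ball of radius [r]. *)
Let rho := Num.max 5 (2 * r).
Let Brho := [set x : 'rV[R]_d | `|x - 0| <= rho].

Let mtheta : measurable_fun setT (theta : VT -> R).
Proof.
have := @continuous_measurable_rVR R d setT theta openT.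
rewrite patch_setT => H; apply: H.
exact: continuous_subspaceT (test_continuous Htheta).
Qed.

Let rho0 : 0 <= rho. Proof. by rewrite /rho le_max ler0n. Qed.

Let r_rho : r <= rho.
Proof. by rewrite /rho le_max; apply/orP; right; rewrite ler_peMl// ler1n. Qed.

Lemma cut_bounded s : exists2 U, 0 <= U & forall z, slab s e T1 z -> `|ut z| <= U.
Proof.
by have := slab_bounded s e0 T1T cu.
Qed.

Let theta_off (z : 'rV[R]_d * R) : ~ (`|z.1| <= r /\ z.2 \in `[e, T1]) -> theta z = 0.
Proof.
move=> zn; apply: test_off => Sz.
have [z1 /andP[z2 z3]] := S_slab Sz; apply: zn; split => //.
by rewrite in_itv /= !ltW.
Qed.

(** The integrand of the weighted hypothesis on [u], cut off in time so as to be
integrable over the whole of space-time. *)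
Let Q (z : VT) : R := \1_I z.2 * (`|ut z| * p z.1).

Let mI : measurable_fun setT (fun z : VT => \1_I z.2 : R).
Proof.
apply: (measurableT_comp (f := \1_I : measurableTypeR R -> R)) => //.
by apply: measurable_indic; exact: measurable_itv.
Qed.

Let mQ : measurable_fun setT Q.
Proof.
apply: measurable_funM => //; apply: measurable_funM.
  exact: measurableT_comp.
exact: (measurableT_comp mp measurable_fst).
Qed.

Let Q0 z : 0 <= Q z.
Proof. by rewrite /Q mulr_ge0// mulr_ge0. Qed.

Let integral_Q : (\int[m]_z (Q z)%:E = \int[leb]_t \int[mu]_x (Q (x, t))%:E)%E.
Proof.
apply: (stm_tonelli2 (f := fun z => (Q z)%:E)); first exact/measurable_EFinP.
by move=> z; rewrite lee_fin.
Qed.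

Let iQ : Rintegrable m Q.
Proof.
apply: ge0_Rintegrable => //; rewrite integral_Q.
apply: le_lt_trans (Hup e0 eT1 T1T).
rewrite [leRHS]integral_mkcond; apply: ge0_le_integralT => t.
  by apply: integral_ge0 => x _; rewrite lee_fin.
rewrite patchE; case: ifPn => [|tI]; last first.
  rewrite integral0_eq// => x _.
  by rewrite /Q indicE /= (negbTE tI) mul0r.
rewrite inE => tI; apply: ge0_le_integralT => x; first by rewrite lee_fin.
rewrite lee_fin /Q indicE /= mem_set// mul1r cutE//.
move: tI; rewrite /I /= in_itv /= => /andP[t1 t2]; rewrite /cylinder /=.
by rewrite (lt_le_trans e0 t1) (le_lt_trans t2 T1T).
Qed.

Definition symt (z : VT) y := sym_diff (fun x => theta (x, z.2)) z.1 y.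
Definition symu (z : VT) y := sym_diff (fun x => ut (x, z.2)) z.1 y.

(** Taylor's formula for short jumps and boundedness for long ones. *)
Lemma symt_le : exists2 M, 0 <= M &
  forall z y, `|symt z y| <= M * Num.min 1 (enorm y ^+ 2).
Proof.
have [M2 M20 H2] := test_second_difference Htheta.
have [M0 M00 H0] := test_bounded Htheta.
exists (M2 + 2 * M0); first by rewrite addr_ge0// mulr_ge0.
move=> z y; have [e1|e1] := leP 1 (enorm y ^+ 2).
  rewrite mulr1; apply: (@le_trans _ _ (2 * M0)); last by rewrite lerDr.
  rewrite /symt /sym_diff (le_trans (ler_normB _ _))//.
  rewrite normrM (@ger0_norm _ 2^-1) ?invr_ge0//.
  have := ler_normD (theta (z.1 + y, z.2)) (theta (z.1 - y, z.2)).
  have := H0 (z.1, z.2); have := H0 (z.1 + y, z.2); have := H0 (z.1 - y, z.2); lra.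
apply: le_trans (H2 z y) _.
rewrite ler_pM ?sqr_ge0//; last by rewrite lerXn2r ?nnegrE ?enorm_ge0// norm_le_enorm.
by rewrite lerDl mulr_ge0.
Qed.

Let time_off (x : 'rV[R]_d) (t : R) : t \notin `[e, T1] -> theta (x, t) = 0.
Proof. by move=> tI; apply: theta_off => -[_ /=]; rewrite (negbTE tI). Qed.

Let space_off (x : 'rV[R]_d) (t : R) : r < `|x| -> theta (x, t) = 0.
Proof. by move=> xr; apply: theta_off => -[/= + _]; rewrite leNgt xr. Qed.

Let minl0 (y : 'rV[R]_d) : 0 <= Num.min 1 (enorm y ^+ 2).
Proof. by rewrite le_min ler01 sqr_ge0. Qed.

Let rho_P (x : 'rV[R]_d) : rho < `|x| -> 5 <= `|x| /\ 2 * r <= `|x|.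
Proof. by rewrite /rho gt_max => /andP[/ltW ? /ltW ?]. Qed.

Let indicB (x : 'rV[R]_d) : (\1_B x : R) = (`|x| <= r)%R%:R.
Proof.
rewrite indicE; congr (nat_of_bool _)%:R.
apply/idP/idP => [/set_mem|xr]; first by rewrite /B /= subr0.
by apply/mem_set; rewrite /B /= subr0.
Qed.

Let indicI (t : R) : (\1_I t : R) = (t \in `[e, T1])%:R.
Proof. by rewrite indicE /I mem_setE. Qed.

(** Near the support the symmetric difference of [theta] is controlled by its
second derivatives; away from it only jumps landing in the support contribute,
and for those the jump kernel is at most a multiple of [p]. *)
Lemma cut_symt_le : exists A1 A2 : R, forall z y,
  `|ut z * (symt z y * k y)| <=
    A1 * (\1_I z.2 * \1_Brho z.1 * (Num.min 1 (enorm y ^+ 2) * k y)) +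
    A2 * (Q z * (\1_B (z.1 + y) + \1_B (z.1 - y))).
Proof.
have [M M0 HM] := symt_le.
have [U U0 HU] := cut_bounded rho.
have [N N0 HN] := test_bounded Htheta.
exists (U * M), (N * C0) => -[x t] y /=.
have rhs0 : 0 <= U * M * (\1_I t * \1_Brho x * (Num.min 1 (enorm y ^+ 2) * k y)).
  by rewrite mulr_ge0 ?mulr_ge0.
have rhs1 : 0 <= N * C0 * (Q (x, t) * (\1_B (x + y) + \1_B (x - y))).
  by rewrite mulr_ge0 ?(ltW C00)// mulr_ge0 ?(ltW C00)// addr_ge0.
have [tI|tI] := boolP (t \in `[e, T1]); last first.
  rewrite (_ : symt _ _ = 0) ?mul0r ?mulr0 ?normr0 ?addr_ge0//.
  by rewrite /symt /sym_diff !time_off// addr0 mul0r subr0.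
have It : \1_I t = 1 :> R by rewrite indicI tI.
have [xr|xr] := leP `|x| rho.
  have Bx : \1_Brho x = 1 :> R by rewrite indicE mem_set// /Brho /= subr0.
  apply: (@le_trans _ _ (U * M * (\1_I t * \1_Brho x *
    (Num.min 1 (enorm y ^+ 2) * k y)))); last by rewrite lerDl.
  rewrite It Bx !mul1r.
  rewrite !normrM (ger0_norm (k0 y)) mulrA [leRHS]mulrA.
  rewrite ler_wpM2r// -[leRHS]mulrA ler_pM//.
  apply: HU; split => //=; move: tI; rewrite in_itv //.
have [x5 xr2] := rho_P xr.
have xr1 : r < `|x| by exact: le_lt_trans xr.
apply: (@le_trans _ _ (N * C0 * (Q (x, t) * (\1_B (x + y) + \1_B (x - y)))));
  last by rewrite lerDr.
have bnd x' : `|x'| <= r -> k (x - x') <= C0 * p x by exact: k_le_p.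
have thetaB x' : `|theta (x', t)| <= N * \1_B x'.
  rewrite indicB; have [|xr'] := leP `|x'| r; first by rewrite mulr1.
  by rewrite mulr0 space_off// normr0.
have kB1 : \1_B (x + y) * k y <= \1_B (x + y) * (C0 * p x) :> R.
  rewrite indicB; have [xy|_] := leP `|x + y| r; last by rewrite !mul0r.
  by rewrite !mul1r -(kv_even kv) (_ : - y = x - (x + y)) ?bnd// opprD addrA subrr sub0r.
have kB2 : \1_B (x - y) * k y <= \1_B (x - y) * (C0 * p x) :> R.
  rewrite indicB; have [xy|_] := leP `|x - y| r; last by rewrite !mul0r.
  by rewrite !mul1r (_ : y = x - (x - y)) ?bnd// subKr.
rewrite /Q /= It mul1r /symt /sym_diff /= (space_off t xr1) sub0r.
rewrite normrM [leRHS](_ : _ = `|ut (x, t)| *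
  (N * (\1_B (x + y) * (C0 * p x) + \1_B (x - y) * (C0 * p x)))); last by ring.
rewrite ler_wpM2l//.
rewrite !normrM normrN normrM (ger0_norm (k0 y)) (@ger0_norm _ 2^-1) ?invr_ge0//.
apply: (@le_trans _ _ ((N * \1_B (x + y) + N * \1_B (x - y)) / 2 * k y)).
  rewrite ler_wpM2r// ler_wpM2r ?invr_ge0// (le_trans (ler_normD _ _))// lerD//;
  exact: thetaB.
have Bk0 : 0 <= (\1_B (x + y) * k y + \1_B (x - y) * k y : R).
  by rewrite addr_ge0// mulr_ge0.
have := ler_wpM2l N0 (lerD kB1 kB2).
have := mulr_ge0 N0 Bk0.
set b1 := \1_B (x + y); set b2 := \1_B (x - y); lra.
Qed.

(** For [x] in the support of [theta], a jump to a point [x'] outside the ball of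
radius [rho] has density at most [C0 * p x'], which is where the integrability of
[u] against [p] enters; inside that ball [u] is bounded. *)
Lemma cut_symu_far_le : exists A1 A2 : R, forall z y,
  `|theta z * (symu z y * (k y * \1_[set z | 1 < enorm z] y))| <=
    A1 * (\1_I z.2 * \1_B z.1 * (k y * \1_[set z | 1 < enorm z] y)) +
    A2 * (\1_B z.1 * (Q (z.1 + y, z.2) + Q (z.1 - y, z.2))).
Proof.
have [U U0 HU] := cut_bounded rho.
have [N N0 HN] := test_bounded Htheta.
exists (2 * U * N), (C0 * N) => -[x t] y /=.
set kl := k y * _.
have kl0 : 0 <= kl by rewrite mulr_ge0.
have kl_k : kl <= k y by rewrite ler_piMr.
have rhs0 : 0 <= 2 * U * N * (\1_I t * \1_B x * kl).
  by rewrite mulr_ge0 ?mulr_ge0.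
have rhs1 : 0 <= C0 * N * (\1_B x * (Q (x + y, t) + Q (x - y, t))).
  by rewrite mulr_ge0 ?mulr_ge0 ?(ltW C00)// addr_ge0.
have [[xr tI]|nxt] := pselect (`|x| <= r /\ t \in `[e, T1]); last first.
  by rewrite (theta_off (z := (x, t)))// mul0r normr0 addr_ge0.
have It : \1_I t = 1 :> R by rewrite indicI tI.
have Bx : \1_B x = 1 :> R by rewrite indicB xr.
have far x' : k (x' - x) = k y -> `|ut (x', t)| * kl <= U * kl + C0 * Q (x', t).
  move=> kx'; have Q1 : 0 <= C0 * Q (x', t) by rewrite mulr_ge0// ltW.
  have [xr'|xr'] := leP `|x'| rho.
    apply: (@le_trans _ _ (U * kl)); last by rewrite lerDl.
    rewrite ler_wpM2r//; apply: HU; split => //=; move: tI; rewrite in_itv //.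
  have [x5 xr2] := rho_P xr'.
  apply: (@le_trans _ _ (C0 * Q (x', t))); last by rewrite lerDr mulr_ge0.
  rewrite /Q /= It mul1r [leRHS]mulrCA ler_wpM2l// (le_trans kl_k)// -kx'.
  exact: k_le_p x5 xr2 xr.
have f1 : `|ut (x + y, t)| * kl <= U * kl + C0 * Q (x + y, t).
  by apply: far; rewrite addrAC subrr add0r.
have f2 : `|ut (x - y, t)| * kl <= U * kl + C0 * Q (x - y, t).
  by apply: far; rewrite addrAC subrr add0r (kv_even kv).
have f0 : `|ut (x, t)| * kl <= U * kl.
  rewrite ler_wpM2r//; apply: HU; split => /=; first exact: le_trans xr r_rho.
  by move: tI; rewrite in_itv.
rewrite It Bx !mul1r normrM [leRHS](_ : _ =
  N * (2 * U * kl + C0 * (Q (x + y, t) + Q (x - y, t)))); last by ring.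
rewrite ler_pM// normrM (ger0_norm kl0).
apply: (@le_trans _ _ ((`|ut (x, t)| + (`|ut (x + y, t)| + `|ut (x - y, t)|) / 2) * kl)).
  rewrite ler_wpM2r// /symu /sym_diff /= (le_trans (ler_normB _ _))// lerD//.
  by rewrite normrM (@ger0_norm _ 2^-1) ?invr_ge0// ler_wpM2r ?invr_ge0// ler_normD.
have q1 := Q0 (x + y, t); have q2 := Q0 (x - y, t).
have q3 := mulr_ge0 (ltW C00) (addr_ge0 q1 q2).
have uk := mulr_ge0 U0 kl0.
rewrite mulrDl [_ / 2 * kl]mulrAC mulrDl; lra.
Qed.

Local Notation mm := (m \x mu)%E.
Local Notation VTV := (VT * 'rV[R]_d)%type.

Let mplus : measurable_fun setT (fun w : VTV => (w.1.1 + w.2, w.1.2) : VT).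
Proof.
apply: measurable_fun_pair.
  apply: measurable_rVD => //.
  exact: (measurableT_comp measurable_fst measurable_fst).
exact: (measurableT_comp measurable_snd measurable_fst).
Qed.

Let mminus : measurable_fun setT (fun w : VTV => (w.1.1 - w.2, w.1.2) : VT).
Proof.
apply: measurable_fun_pair.
  apply: measurable_rVB => //.
  exact: (measurableT_comp measurable_fst measurable_fst).
exact: (measurableT_comp measurable_snd measurable_fst).
Qed.

Let measurable_sym (f : VT -> R) : measurable_fun setT f ->
  measurable_fun setT (fun w : VTV => sym_diff (fun x => f (x, w.1.2)) w.1.1 w.2).
Proof.
move=> mf; rewrite /sym_diff; apply: measurable_funB.
  rewrite (_ : (fun w : VTV => _) = (fun w : VTV => f w.1)).
    exact: (measurableT_comp mf measurable_fst).
  by apply/funext => -[[x t] y].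
apply: measurable_funM => //; apply: measurable_funD.
  exact: (measurableT_comp mf mplus).
exact: (measurableT_comp mf mminus).
Qed.

Let mkw : measurable_fun setT (fun w : VTV => k w.2).
Proof. exact: (measurableT_comp mk measurable_snd). Qed.

Let mB : measurable B. Proof. exact: measurable_norm_ball. Qed.

Let iIB s : 0 <= s -> Rintegrable m (fun z : VT => \1_I z.2 * \1_[set x | `|x - 0| <= s] z.1).
Proof. exact: Rintegrable_ball_itv. Qed.

Let iB_reflect x : Rintegrable mu (fun y => \1_B (x - y) : R) /\
  \int[mu]_y (\1_B (x - y) : R) = (2 * r) ^+ d.
Proof.
have [ib eb] := @Rintegrable_norm_ball R d 0 r r0; split; first exact: Rintegrable_reflect.
by rewrite (Rintegral_reflect x (Rintegrable_meas ib)).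
Qed.

Let B_even x y : \1_B (x + y) = \1_B (- x - y) :> R.
Proof. by rewrite !indicB -opprD normrN. Qed.

Lemma Rintegrable_cut_symt : Rintegrable mm (fun w : VTV => ut w.1 * (symt w.1 w.2 * k w.2)).
Proof.
have [A1 [A2 H]] := cut_symt_le.
have HH (w : VTV) := H w.1 w.2; apply: (Rintegrable_dom _ HH).
  apply: measurable_funM; first exact: (measurableT_comp mut measurable_fst).
  by apply: measurable_funM => //; exact: measurable_sym.
apply: RintegrableD; apply: RintegrableZl.
  exact: (@Rintegrable_tensor _ _ VT 'rV[R]_d R m mu _ _ (iIB rho0) (kv_levy kv)).
apply: (Rintegrable_slices (h := fun z => Q z * (2 * (2 * r) ^+ d))).
- apply: measurable_funM; first exact: (measurableT_comp mQ measurable_fst).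
  have mBi : measurable_fun setT (\1_B : 'rV[R]_d -> R) by exact: measurable_indic.
  apply: measurable_funD.
    exact: (measurableT_comp mBi (measurableT_comp measurable_fst mplus)).
  exact: (measurableT_comp mBi (measurableT_comp measurable_fst mminus)).
- exact: RintegrableZr.
move=> z /=.
have [i1 e1] := iB_reflect z.1; have [i2 e2] := iB_reflect (- z.1).
under eq_integral => y _.
  rewrite ger0_norm ?mulr_ge0// ?addr_ge0//.
  rewrite B_even.
  over.
rewrite -EFin_Rintegral; last exact: (RintegrableZl (Q z) (RintegrableD i2 i1)).
by rewrite RintegralZl ?RintegralD ?e1 ?e2 ?lee_fin//; [lra|exact: RintegrableD].
Qed.

Let Psi (t : measurableTypeR R) : \bar R := (\int[mu]_x (Q (x, t))%:E)%E.

Let mEQ : measurable_fun setT (fun z : VT => (Q z)%:E).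
Proof. exact/measurable_EFinP. Qed.

Let EQ0 z : (0 <= (Q z)%:E)%E. Proof. by rewrite lee_fin. Qed.

Let mPsi : measurable_fun setT Psi.
Proof. exact: (measurable_fun_fubini_tonelli_G (m1 := mu) _ mEQ EQ0). Qed.

Let Psi0 t : (0 <= Psi t)%E.
Proof. by apply: integral_ge0 => x _. Qed.

Let Rintegrable_ball_slice (F : VTV -> R) : measurable_fun setT F ->
  (forall z, (\int[mu]_y `|F (z, y)|%:E = (\1_B z.1)%:E * Psi z.2)%E) -> Rintegrable mm F.
Proof.
move=> mF HF; have [ib _] := @Rintegrable_norm_ball R d 0 r r0.
apply: Rintegrable_prod => //; under eq_integral do rewrite HF.
have mBi : measurable_fun setT (fun x : 'rV[R]_d => (\1_B x)%:E : \bar R).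
  by apply/measurable_EFinP; exact: measurable_indic.
rewrite (stm_tonelli1 (f := fun z : VT => (\1_B z.1)%:E * Psi z.2)%E); last 2 first.
- apply: emeasurable_funM; first exact: (measurableT_comp mBi measurable_fst).
  exact: (measurableT_comp mPsi measurable_snd).
- by move=> z; rewrite mule_ge0// lee_fin.
rewrite (_ : (\int[mu]_x _)%E =
    (\int[mu]_x ((\1_B x)%:E * \int[leb]_t Psi t))%E); last first.
  by apply: eq_integral => x _ /=; rewrite ge0_integralZl ?lee_fin.
have c0 : (0 <= \int[leb]_t Psi t)%E by exact: integral_ge0.
have b0 (x : 'rV[R]_d) : setT x -> (0 <= (\1_B x)%:E :> \bar R)%E.
  by rewrite lee_fin.
rewrite (ge0_integralZr mu measurableT mBi b0 c0).
apply: lte_mul_pinfty; first exact: integral_ge0.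
  rewrite ge0_fin_numE; last exact: integral_ge0.
  exact: (integrable_lty measurableT ib).
rewrite -integral_Q; exact: (integrable_lty measurableT iQ).
Qed.

Let mBw : measurable_fun setT (fun w : VTV => \1_B w.1.1 : R).
Proof.
have mBi : measurable_fun setT (\1_B : 'rV[R]_d -> R) by exact: measurable_indic.
exact: (measurableT_comp mBi (measurableT_comp measurable_fst measurable_fst)).
Qed.

Let mQslice t : measurable_fun setT (fun x => (Q (x, t))%:E).
Proof. exact: (measurableT_comp mEQ (pair2_measurable t)). Qed.

Let iBQ_plus : Rintegrable mm (fun w : VTV => \1_B w.1.1 * Q (w.1.1 + w.2, w.1.2)).
Proof.
apply: Rintegrable_ball_slice.
  by apply: measurable_funM => //; exact: (measurableT_comp mQ mplus).
move=> [x t] /=; under eq_integral do rewrite ger0_norm ?mulr_ge0// EFinM addrC.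
rewrite ge0_integralZl//.
- congr (_ * _)%E; exact: (integral_rV_translate x (mQslice t)).
- apply: (measurableT_comp (mQslice t)); exact: measurable_rVD.
Qed.

Let iBQ_minus : Rintegrable mm (fun w : VTV => \1_B w.1.1 * Q (w.1.1 - w.2, w.1.2)).
Proof.
apply: Rintegrable_ball_slice.
  by apply: measurable_funM => //; exact: (measurableT_comp mQ mminus).
move=> [x t] /=; under eq_integral do rewrite ger0_norm ?mulr_ge0// EFinM.
rewrite ge0_integralZl//.
- congr (_ * _)%E; exact: (integral_rV_reflect x (mQslice t)).
- exact: (measurableT_comp (mQslice t) (measurable_reflect x)).
Qed.

Lemma Rintegrable_test_symu_far :
  Rintegrable mm (fun w : VTV => theta w.1 * (symu w.1 w.2 * (k w.2 * \1_[set z | 1 < enorm z] w.2))).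
Proof.
have [A1 [A2 H]] := cut_symu_far_le.
have il := Rintegrable_large kv.
have HH (w : VTV) := H w.1 w.2; apply: (Rintegrable_dom _ HH).
  apply: measurable_funM; first exact: (measurableT_comp mtheta measurable_fst).
  apply: measurable_funM; first exact: measurable_sym.
  exact: (measurableT_comp (Rintegrable_meas il) measurable_snd).
apply: RintegrableD; apply: RintegrableZl; first exact: (@Rintegrable_tensor _ _ VT 'rV[R]_d R m mu _ _ (iIB r0) il).
have := RintegrableD iBQ_plus iBQ_minus; congr Rintegrable; apply/funext => w.
by rewrite mulrDr.
Qed.

Let cylinder_shift (z : VT) (x : 'rV[R]_d) : cylinder T z -> cylinder T (x, z.2).
Proof. by []. Qed.

Let symuE (z : VT) (y : 'rV[R]_d) : cylinder T z ->
  symu z y = sym_diff (fun x => u (x, z.2)) z.1 y.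
Proof. by move=> zT; rewrite /symu /sym_diff !cutE//; exact: cylinder_shift. Qed.

Let symu_off (z : VT) (y : 'rV[R]_d) : ~ cylinder T z -> symu z y = 0.
Proof.
move=> zT; have E (x : 'rV[R]_d) : ut (x, z.2) = 0 by rewrite /cut patchE memNset.
by rewrite /symu /sym_diff !E addr0 mul0r subrr.
Qed.

Let S_cylinder (z : VT) : S z -> cylinder T z.
Proof. by have [_ _] := Htheta; exact. Qed.

(** The function whose local integrability is assumed. It only involves jumps of
length at most one; [Rintegrable_test_symu_far] deals with the others. *)
Let F (z : VT) := (\int[mu]_(y in [set y : 'rV[R]_d | (enorm y <= 1)%R])
  (`|sym_diff (fun x => u (x, z.2)) z.1 y| * K y)%:E)%E.

Let kn (y : 'rV[R]_d) := k y * \1_[set z | enorm z <= 1] y.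

Let FE z : S z -> F z = (\int[mu]_y (`|symu z y| * kn y)%:E)%E.
Proof.
move=> /S_cylinder zT; rewrite /F integral_mkcond; apply: integral_ae.
apply: filterS (kv_ae kv) => y Ky; rewrite patchE symuE// /kn indicE.
by case: ifPn => _; rewrite ?mulr1 ?mulr0 ?Ky.
Qed.

Let mkn : measurable_fun setT kn.
Proof.
apply: measurable_funM => //; apply: measurable_indic.
have := @measurable_enorm_preimage R d `]-oo, 1]%classic (measurable_itv _).
by congr measurable; apply/seteqP; split => y /=; rewrite in_itv.
Qed.

Let Rintegrable_near : Rintegrable mm (fun w : VTV => \1_S w.1 * (`|symu w.1 w.2| * kn w.2)).
Proof.
have [_ cS cylS] := Htheta.
apply: Rintegrable_prod.
  apply: measurable_funM.
    apply: (measurableT_comp (f := \1_S : VT -> R)) => //.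
    by apply: measurable_indic; exact: compact_measurable_rVR.
  apply: measurable_funM; last exact: (measurableT_comp mkn measurable_snd).
  by apply: measurableT_comp => //; exact: measurable_sym.
have [_] := Hloc cS cylS; apply: le_lt_trans.
rewrite [leRHS]integral_mkcond; apply: ge0_le_integralT => z.
  by apply: integral_ge0 => y _; rewrite lee_fin.
under eq_integral do rewrite /= indicE.
rewrite patchE /=; case: ifPn => [|zS]; last first.
  by rewrite integral0_eq// => y _; rewrite mul0r normr0.
rewrite inE => zS; rewrite -/(F z) FE// gee0_abs; last first.
  by apply: integral_ge0 => y _; rewrite lee_fin mulr_ge0// mulr_ge0.
apply: ge0_le_integralT => y; first by rewrite lee_fin.
by rewrite lee_fin mul1r ger0_norm// mulr_ge0// mulr_ge0.
Qed.

Let Af (w : VTV) := theta w.1 * (symu w.1 w.2 * k w.2).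
Let Bf (w : VTV) := ut w.1 * (symt w.1 w.2 * k w.2).

Let Rintegrable_Af : Rintegrable mm Af.
Proof.
have [N N0 HN] := test_bounded Htheta.
have i1 : Rintegrable mm (fun w : VTV => theta w.1 * (symu w.1 w.2 * kn w.2)).
  apply: (Rintegrable_dom _ _ (RintegrableZl N Rintegrable_near)).
    apply: measurable_funM; first exact: (measurableT_comp mtheta measurable_fst).
    apply: measurable_funM; first exact: measurable_sym.
    exact: (measurableT_comp mkn measurable_snd).
  move=> -[z y] /=; have kn0 : 0 <= kn y by rewrite mulr_ge0.
  rewrite (normrM (theta z)) (normrM (symu z y)) (ger0_norm kn0) indicE.
  have [_|zS] := boolP (z \in S); first by rewrite mul1r ler_wpM2r// mulr_ge0.
  rewrite (test_off (theta := theta)) ?normr0 ?mul0r ?mulr0//.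
  by move: zS; rewrite notin_setE.
have := RintegrableD i1 Rintegrable_test_symu_far; congr Rintegrable; apply/funext => -[z y].
rewrite /Af /kn /= -mulrDr -mulrDr -mulrDr; congr (_ * (_ * _)).
rewrite -[RHS]mulr1; congr (_ * _); rewrite !indicE.
have [y1|y1] := leP (enorm y) 1.
  by rewrite mem_set// memNset ?addr0//= ltNge y1.
by rewrite memNset ?mem_set ?add0r//=; apply/negP; rewrite -ltNge.
Qed.

Let msymu z : measurable_fun setT (symu z).
Proof. exact: (measurableT_comp (measurable_sym mut) (pair1_measurable z)). Qed.

Let msymt z : measurable_fun setT (symt z).
Proof. exact: (measurableT_comp (measurable_sym mtheta) (pair1_measurable z)). Qed.

Let slice_u z : Rintegrable mu (fun y => symu z y * k y).
Proof.
have mf : measurable_fun setT (fun y => symu z y * k y) by exact: measurable_funM.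
have [zT|zT] := pselect (cylinder T z); last first.
  have -> : (fun y => symu z y * k y) = fun=> 0.
    by apply/funext => y; rewrite symu_off// mul0r.
  exact: integrable0.
have [_ fin] := Hsol zT.
apply/integrableP; split; first exact/measurable_EFinP.
apply: le_lt_trans fin; apply: ge0_le_integral_ae => //.
by apply: filterS (kv_ae kv) => y /= ->; rewrite symuE.
Qed.

Let slice_t z : Rintegrable mu (fun y => symt z y * k y).
Proof.
have [M M0 HM] := symt_le.
apply: (Rintegrable_dom _ _ (RintegrableZl M (kv_levy kv))); first exact: measurable_funM.
by move=> y; rewrite normrM (ger0_norm (k0 y)) mulrA ler_wpM2r.
Qed.

(** For fixed [y], both integrands of the duality are combinations of [b] and of its
translate [c]. *)
Let b y (z : VT) := theta z * ut (z.1 + y, z.2).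

Let Rintegrable_b y : Rintegrable m (b y).
Proof.
have [N N0 HN] := test_bounded Htheta.
have [U U0 HU] := cut_bounded (r + `|y|).
apply: (Rintegrable_dom _ _ (RintegrableZl (N * U) (iIB r0))).
  by apply: measurable_funM => //; exact: (measurableT_comp mut (measurable_shift y)).
move=> -[x t] /=; rewrite /b /= -/B indicB indicI.
have [[xr tI]|nxt] := pselect (`|x| <= r /\ t \in `[e, T1]); last first.
  by rewrite (theta_off (z := (x, t)))// mul0r normr0 mulr_ge0 ?mulr_ge0.
rewrite xr tI !mulr1 normrM ler_pM//; apply: HU; split => /=.
  by rewrite (le_trans (ler_normD _ _))// lerD2r.
by move: tI; rewrite in_itv.
Qed.

Let c y (z : VT) := theta (z.1 + y, z.2) * ut z.

Let cE y : c y = fun z => b (- y) (z.1 + y, z.2).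
Proof. by apply/funext => -[x t]; rewrite /c /b /= addrK. Qed.

Let Rintegrable_c y : Rintegrable m (c y).
Proof. by rewrite cE; exact: (Rintegrable_shift y (Rintegrable_b _)). Qed.

Let Rintegral_c y : \int[m]_z c y z = \int[m]_z b (- y) z.
Proof.
rewrite cE /Rintegral; congr fine.
exact: (integral_shift y (Rintegrable_meas (Rintegrable_b (- y)))).
Qed.

Let AfE y : (fun z => Af (z, y)) =
  (fun z => k y * (b 0 z - 2^-1 * (b y z + b (- y) z))).
Proof.
by apply/funext => -[x t]; rewrite /Af /b /symu /sym_diff /= addr0; ring.
Qed.

Let BfE y : (fun z => Bf (z, y)) =
  (fun z => k y * (b 0 z - 2^-1 * (c y z + c (- y) z))).
Proof.
by apply/funext => -[x t]; rewrite /Bf /b /c /symt /sym_diff /= addr0; ring.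
Qed.

Let Rintegrable_Afz y : Rintegrable m (fun z => Af (z, y)).
Proof.
rewrite AfE.
exact: (RintegrableZl (k y) (RintegrableB (Rintegrable_b 0) (RintegrableZl 2^-1 (RintegrableD (Rintegrable_b y) (Rintegrable_b (- y)))))).
Qed.

Let Rintegrable_Bfz y : Rintegrable m (fun z => Bf (z, y)).
Proof.
rewrite BfE.
exact: (RintegrableZl (k y) (RintegrableB (Rintegrable_b 0) (RintegrableZl 2^-1 (RintegrableD (Rintegrable_c y) (Rintegrable_c (- y)))))).
Qed.

(** For a single jump [y] the symmetric difference is self-adjoint, by
translation invariance; [y] and [- y] exchange their roles. *)
Let duality_slice y : \int[m]_z Af (z, y) = \int[m]_z Bf (z, y).
Proof.
have ib := RintegrableD (Rintegrable_b y) (Rintegrable_b (- y)).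
have ic := RintegrableD (Rintegrable_c y) (Rintegrable_c (- y)).
have i1 := RintegrableZl 2^-1 ib; have i2 := RintegrableZl 2^-1 ic.
rewrite AfE BfE (RintegralZl _ measurableT (RintegrableB (Rintegrable_b 0) i1)).
rewrite (RintegralZl _ measurableT (RintegrableB (Rintegrable_b 0) i2)); congr (_ * _).
rewrite (RintegralB measurableT (Rintegrable_b 0) i1) (RintegralB measurableT (Rintegrable_b 0) i2).
congr (_ - _).
rewrite (RintegralZl _ measurableT ib) (RintegralZl _ measurableT ic); congr (_ * _).
rewrite (RintegralD measurableT (Rintegrable_b y) (Rintegrable_b (- y))).
rewrite (RintegralD measurableT (Rintegrable_c y) (Rintegrable_c (- y))).
by rewrite !Rintegral_c opprK addrC.
Qed.

(** [duality_slice] integrated over the jumps: both integrands are absolutely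
integrable over space-time and jumps, so Fubini's theorem applies to each. *)
Lemma nonlocal_duality :
  [/\ Rintegrable m (fun z => theta z * Lx K u z), Rintegrable m (fun z => ut z * Lx K theta z) &
    \int[m]_z (theta z * Lx K u z) = \int[m]_z (ut z * Lx K theta z)].
Proof.
have a1 z : Rintegrable mu (fun y => Af (z, y)) by exact: (RintegrableZl (theta z) (slice_u z)).
have b1 z : Rintegrable mu (fun y => Bf (z, y)) by exact: (RintegrableZl (ut z) (slice_t z)).
have LxE (f : VT -> R) z : Lx K f z =
    \int[mu]_y (sym_diff (fun x => f (x, z.2)) z.1 y * k y).
  rewrite /Lx /nonlocal_op /Rintegral; congr fine; apply: integral_ae.
  by apply: filterS (kv_ae kv) => y ->.
have Au z : \int[mu]_y Af (z, y) = theta z * Lx K u z.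
  rewrite (_ : \int[mu]_y Af (z, y) = theta z * \int[mu]_y (symu z y * k y)); last first.
    by have := RintegralZl (theta z) measurableT (slice_u z).
  have [zS|zS] := pselect (S z); last by rewrite (test_off zS) !mul0r.
  congr (_ * _); rewrite LxE; apply: eq_Rintegral => y _.
  by rewrite symuE//; exact: S_cylinder.
have Bt z : \int[mu]_y Bf (z, y) = ut z * Lx K theta z.
  by rewrite LxE; have := RintegralZl (ut z) measurableT (slice_t z).
have EA : (fun z => theta z * Lx K u z) = (fun z => \int[mu]_y Af (z, y)).
  by apply/funext => z; rewrite Au.
have EB : (fun z => ut z * Lx K theta z) = (fun z => \int[mu]_y Bf (z, y)).
  by apply/funext => z; rewrite Bt.
rewrite EA EB; split.
- exact: (Rintegrable_Rintegral2 Rintegrable_Af a1).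
- exact: (Rintegrable_Rintegral2 Rintegrable_cut_symt b1).
rewrite (fubini_Rintegral Rintegrable_Af a1 Rintegrable_Afz).
rewrite (fubini_Rintegral Rintegrable_cut_symt b1 Rintegrable_Bfz).
by apply: eq_Rintegral => y _; exact: duality_slice.
Qed.

End fixed_slab.
End duality.

(** * Duality in time *)

Section time_parts.
Context {R : realType} {d : nat}.
Local Notation mu := (@lebesgue_rV R d).
Local Notation leb := (@lebesgue_measure R).
Local Notation VT := ('rV[R]_d * measurableTypeR R)%type.
Local Notation m := (@stm R d).

Lemma integral_derive1M_eq0 (f g : R -> R) (a b : R) : a < b ->
  {in `[a, b], forall t, derivable f t 1} -> {in `[a, b], forall t, derivable g t 1} ->
  {in `[a, b], continuous (derive1 f)} -> {in `[a, b], continuous (derive1 g)} ->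
  g a = 0 -> g b = 0 ->
  (\int[leb]_(t in `[a, b]) (f t * derive1 g t + g t * derive1 f t)%:E = 0)%E.
Proof.
move=> ab df dg cf cg ga gb.
have cont (h : R -> R) : {in `[a, b], forall t, derivable h t 1} -> {in `[a, b], continuous h}.
  by move=> dh t tI; apply: differentiable_continuous; apply/derivable1_diffP; exact: dh.
have dfg : {in `[a, b], forall t, derivable (f * g) t 1}.
  by move=> t tI; apply: derivableM; [exact: df|exact: dg].
have aI : a \in `[a, b] by rewrite in_itv /= lexx ltW.
have bI : b \in `[a, b] by rewrite in_itv /= lexx ltW.
rewrite (continuous_FTC2 (F := f * g) ab).
- by rewrite -[(f * g) b]/(f b * g b) -[(f * g) a]/(f a * g a) ga gb !mulr0 subee.
- apply: continuous_in_subspaceT => t; rewrite mem_setE => tI.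
  by apply: cvgD; apply: cvgM; [exact: cont tI|exact: cg|exact: cont tI|exact: cf].
- split.
  + move=> t /subset_itv_oo_cc; exact: dfg.
  + by apply: cvg_at_right_filter; exact: (cont _ dfg).
  + by apply: cvg_at_left_filter; exact: (cont _ dfg).
- move=> t /subset_itv_oo_cc tI.
  by rewrite derive1E deriveM ?derive1E; [| exact: df|exact: dg].
Qed.

Variables (T : R) (u theta : 'rV[R]_d * R -> R).
Hypothesis cu : {within cylinder T, continuous u}.
Hypothesis du : forall z, cylinder T z -> derivable (fun s => u (z.1, s)) z.2 1.
Hypothesis cdu : {within cylinder T, continuous (dt u)}.
Hypothesis Htheta : test_function (cylinder T) theta.
Variables (r e T1 : R).
Hypotheses (r0 : 0 <= r) (e0 : 0 < e) (eT1 : e < T1) (T1T : T1 < T).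
Hypothesis S_slab : forall z, closure [set z | theta z != 0] z ->
  `|z.1| <= r /\ e < z.2 < T1.

Let off (z : 'rV[R]_d * R) : ~ slab r e T1 z -> ~ closure [set z | theta z != 0] z.
Proof.
by move=> zn /S_slab [z1 /andP[z2 z3]]; apply: zn; split => //; rewrite !ltW.
Qed.

Let mT (f : 'rV[R]_d * R -> R) : continuous f -> measurable_fun setT (f : VT -> R).
Proof.
move=> cf; have := @continuous_measurable_rVR R d setT f openT.
by rewrite patch_setT; apply; exact: continuous_subspaceT.
Qed.

Lemma Rintegrable_cut_dt_test : Rintegrable m (fun z => cut T u z * dt theta z).
Proof.
have [U U0 HU] := slab_bounded r e0 T1T cu.
have [N N0 HN] := dt_test_bounded Htheta.
apply: (@Rintegrable_bounded_slab _ _ _ r e T1 (U * N)) => //.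
- apply: measurable_funM; last exact: (mT (continuous_dt_test Htheta)).
  exact: (continuous_measurable_rVR (@open_cylinder R d T) cu).
- by move=> z zs; rewrite normrM ler_pM//; exact: HU.
- by move=> z /off zs; rewrite (dt_test_off Htheta zs) mulr0.
Qed.

Lemma Rintegrable_test_dt_cut : Rintegrable m (fun z => theta z * (dt u \_ (cylinder T)) z).
Proof.
have [U U0 HU] := slab_bounded r e0 T1T cdu.
have [N N0 HN] := test_bounded Htheta.
apply: (@Rintegrable_bounded_slab _ _ _ r e T1 (N * U)) => //.
- apply: measurable_funM; first exact: (mT (test_continuous Htheta)).
  exact: (continuous_measurable_rVR (@open_cylinder R d T) cdu).
- by move=> z zs; rewrite normrM ler_pM//; exact: HU.
- by move=> z /off zs; rewrite (test_off zs) mul0r.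
Qed.

Let in_cylinder (x : 'rV[R]_d) (t : R) : t \in `[e, T1] -> cylinder T (x, t).
Proof.
rewrite in_itv /= => /andP[t1 t2]; rewrite /cylinder /=.
by rewrite (lt_le_trans e0 t1) (le_lt_trans t2 T1T).
Qed.

Let cslice (f : 'rV[R]_d * R -> R) (x : 'rV[R]_d) (t : R) : {for (x, t), continuous f} ->
  {for t, continuous (fun s => f (x, s))}.
Proof.
move=> cf; apply: (@continuous_comp R ('rV[R]_d * R)%type R (fun s : R => (x, s)) f) => //.
have c1 : (fun s : R => x) @ nbhs t --> x by exact: cvg_cst.
have c2 : (fun s : R => s) @ nbhs t --> t by exact: cvg_id.
exact (cvg_pair c1 c2).
Qed.

(** On each line parallel to the time axis this is the integral of the derivative of
[u * theta], which vanishes at both ends. *)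
Lemma dt_duality :
  \int[m]_z (cut T u z * dt theta z + theta z * (dt u \_ (cylinder T)) z) = 0.
Proof.
have ii := RintegrableD Rintegrable_cut_dt_test Rintegrable_test_dt_cut.
suff slice (x : 'rV[R]_d) : (\int[leb]_t
    (cut T u (x, t) * dt theta (x, t) + theta (x, t) * (dt u \_ (cylinder T)) (x, t))%:E = 0)%E.
  by rewrite /Rintegral -(integral12_prod_meas1 ii) integral0_eq// => x _; exact: slice.
rewrite -(integral_derive1M_eq0 (f := fun s => u (x, s)) (g := fun s => theta (x, s)) eT1).
- rewrite [RHS]integral_mkcond; apply: eq_integral => t _.
  rewrite [RHS]patchE; case: ifPn; rewrite mem_setE => tI.
    have xT := in_cylinder x tI; rewrite (cutE u xT) patchE mem_set//.
  have tn : ~ closure [set z | theta z != 0] (x, t).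
    by apply: off => -[_ /= tI']; move: tI; rewrite in_itv /= tI'.
  by rewrite (dt_test_off Htheta tn) (test_off tn) mulr0 mul0r addr0.
- by move=> t /(in_cylinder x) /du.
- by move=> t _; have := derivable_test Htheta (z := (x, t)).
- move=> t tI; apply: (cslice (f := dt u)).
  move: cdu; rewrite continuous_open_subspace; last exact: open_cylinder.
  move=> c; have /mem_set xT := in_cylinder x tI.
  by have := c _ xT.
- move=> t _; apply: (cslice (f := dt theta)); exact: (continuous_dt_test Htheta).
- by apply: test_off => /S_slab [_ /=]; rewrite ltxx.
- by apply: test_off => /S_slab [_ /=]; rewrite ltxx andbF.
Qed.

End time_parts.

(** * Classical solutions are very weak solutions *)

Lemma continuous_L1loc (R : realType) (d : nat) (T : R) (u : 'rV[R]_d * R -> R) :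
  0 < T -> {within cylinder T, continuous u} -> L1loc (cylinder T) (EFin \o u).
Proof.
move=> T0 cu C cC CT.
have [r [e [T1 [r0 e0 eT1 T1T Cs]]]] := compact_sub_slab T0 cC CT.
have [U U0 HU] := slab_bounded r e0 T1T cu.
have mut := continuous_measurable_rVR (@open_cylinder R d T) cu.
have mC := compact_measurable_rVR cC.
have cutC z : C z -> (u \_ (cylinder T)) z = u z.
  by move=> /CT zT; rewrite patchE mem_set.
split.
  exists (fun z => ((u \_ (cylinder T)) z)%:E).
    by apply: measurable_funTS; exact/measurable_EFinP.
  by apply/aeW => z Cz /=; rewrite cutC.
have iC : Rintegrable stm (fun z => (u \_ (cylinder T)) z * \1_C z).
  apply: (Rintegrable_bounded_slab (r := r) (e := e) (T1 := T1) (M := U)) => //.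
  - by apply: measurable_funM => //; exact: measurable_indic.
  - move=> z zs; rewrite normrM (le_trans (ler_piMr _ _) (HU z zs))//.
    by rewrite indicE; case: (z \in C); rewrite ?normr1 ?normr0.
  - move=> z zs; rewrite indicE memNset ?mulr0// => /Cs [z1 /andP[z2 z3]].
    by apply: zs; split => //; rewrite !ltW.
have /integrableP[_] := iC; apply: le_lt_trans.
rewrite integral_mkcond; apply: ge0_le_integralT => z; rewrite patchE.
  by case: ifPn => // _; exact: abse_ge0.
case: ifPn => [zC|_]; last exact: abse_ge0.
by rewrite /= indicE zC mulr1 cutC ?lexx//; move: zC; rewrite inE.
Qed.

Theorem proposition3p18 (R : realType) (d : nat) (d_gt0 : (0 < d)%N)
    (K : 'rV[R]_d -> R) (HK : mixed_growth_kernel K)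
    (P : R -> 'rV[R]_d -> R) (HP : heat_kernel K P)
    (T : R) (T_gt0 : 0 < T)
    (u : 'rV[R]_d * R -> R) (Hu : classical_solution K T u)
    (HuP : L1loc_time_L1 T (P 1) u)
    (Hloc : L1loc (cylinder T) (fun z =>
       (\int[lebesgue_rV]_(y in [set y : 'rV[R]_d | (enorm y <= 1)%R])
          (`|sym_diff (fun x => u (x, z.2)) z.1 y| * K y)%:E)%E)) :
  very_weak_solution K T u.
Proof.
have [cu [du cdu] [iL _] eqn] := Hu.
split; first exact: continuous_L1loc.
move=> theta Htheta; have [_ cS ST] := Htheta.
have [r [e [T1 [r0 e0 eT1 T1T Ss]]]] := compact_sub_slab T_gt0 cS ST.
have [k [kap [C kv]]] := kernel_versionP d_gt0 HK.
have [C0 C00 dom] := heat_kernel_dominates kv HP d_gt0.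
have [cP P0 _ _] := HP 1 ltr01.
have mP := continuous_measurable_rV cP.
have [iA iB eAB] :=
  nonlocal_duality kv mP P0 C00 dom cu HuP Htheta iL Hloc r0 e0 eT1 T1T Ss.
have iD := Rintegrable_cut_dt_test cu Htheta r0 e0 T1T Ss.
have iE := Rintegrable_test_dt_cut cdu Htheta r0 e0 T1T Ss.
have E0 := dt_duality cu du cdu Htheta r0 e0 eT1 T1T Ss.
split.
  (* [stm] unfolds to the product measure *)
  change (\int[@stm R d]_(z in cylinder T) (`|u z| * `|Lx K theta z|)%:E < +oo)%E.
  have /integrableP[_] := iB; apply: le_lt_trans.
  rewrite [leLHS]integral_mkcond; apply: ge0_le_integralT => z; rewrite patchE.
    by case: ifPn => // _; rewrite lee_fin mulr_ge0.
  case: ifPn => [|_]; last exact: abse_ge0.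
  by rewrite inE => zT /=; rewrite cutE// normrM.
have iF : Rintegrable stm (fun z => cut T u z * dt theta z - cut T u z * Lx K theta z).
  exact: (RintegrableB iD iB).
transitivity (\int[stm]_z (cut T u z * dt theta z - cut T u z * Lx K theta z)%:E)%E.
  rewrite integral_mkcond; apply: eq_integral => z _; rewrite patchE.
  case: ifPn => [|]; first by rewrite inE => zT; rewrite cutE// mulrBr.
  by move=> zT; rewrite /cut patchE (negbTE zT) !mul0r subrr.
rewrite -EFin_Rintegral//; congr EFin.
rewrite (RintegralB measurableT iD iB) -eAB -(RintegralB measurableT iD iA).
rewrite -[RHS]E0; apply: eq_Rintegral => z _; rewrite patchE.
have [zT|zT] := pselect (cylinder T z).
  (* inside the cylinder the equation turns [L u] into minus the time derivative *)
  by rewrite mem_set// -mulrN; congr (_ + _ * _); apply/eqP; rewrite eq_sym -addr_eq0 eqn.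
(* outside it the test function vanishes *)
by rewrite memNset// (test_off (theta := theta)) ?mul0r ?subr0 ?addr0// => /ST.
Qed.
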